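(* Let $A=A_{\alpha,\beta}=\alpha\mathbf 1_{s\times s}+(\beta-\alpha)I_s$ with $0<\alpha<\beta$. Assume asymptotically equal block sizes, i.e. $\Gamma=\frac1s I_{sq}$ (equivalently $\gamma_k=1/s$ for all $k$), and the high temperature condition $$\lVert\sqrt\Gamma\,\mathcal A\sqrt\Gamma\rVert_2=\lim_{N\to\infty}\lVert\sqrt S A\sqrt S/N\rVert_2<\zeta_q .$$ Then, under the Gibbs measures $\mu_N$, as $N\to\infty$, $$\sqrt{\mathcal S}\,\big(m-\tfrac1q\mathbf 1_{sq}\big)\Rightarrow W ,$$ where $W\sim\mathcal N(0,\Sigma)$ is an $sq$-dimensional centered Gaussian random vector with singular covariance matrix $$\Sigma=s\,\mathcal A^{-1}\left(\Big(I_{sq}+\frac{\mathcal A}{s}\big(I_s\otimes(\tfrac1{q^2}\mathbf 1_{q\times q}-\tfrac1q I_q)\big)\Big)^{-1}-I_{sq}\right).$$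
   Context: Block Potts model. Fix integers $s\ge1$ (number of blocks) and $q\ge2$ (number of colors). For each $N\in\mathbb N$ the set $\{1,\dots,N\}$ is partitioned into $s$ non-empty blocks $S_1,\dots,S_s$ (depending on $N$), and the limits $\gamma_k=\lim_{N\to\infty}|S_k|/N$ are assumed to exist. $\mathbf 1_{d\times e}$ is the $d\times e$ all-ones matrix, $\mathbf 1_d=\mathbf 1_{d\times1}$, $I_d$ is the identity matrix, $\otimes$ is the Kronecker product, $e_k\in\mathbb R^s$, $e_c\in\mathbb R^q$ are standard unit vectors, $\lVert\cdot\rVert_2$ is the spectral norm. Let $A$ be the real $s\times s$ interaction matrix, $S=\operatorname{diag}(|S_1|,\dots,|S_s|)$, $\mathcal S=S\otimes I_q$, $\mathcal A=A\otimes I_q$, $\Gamma=\lim_{N\to\infty}\mathcal S/N=\operatorname{diag}(\gamma)\otimes I_q$. For $\omega\in\{1,\dots,q\}^N$ the magnetization is the vector $m=m(\omega)\in\mathbb R^{sq}$ with components $m_{k,c}=(e_k\otimes e_c)^Tm=\frac1{|S_k|}\sum_{i\in S_k}\mathbf 1_{\{\omega_i=c\}}$. The Hamiltonian is $H_N(\omega)=-\frac1{2N}m^T\mathcal S\mathcal A\mathcal S m$ and the Gibbs measure on $\{1,\dots,q\}^N$ is $\mu_N(\omega)=\exp(-H_N(\omega))/\sum_{\omega'}\exp(-H_N(\omega'))$. For $A=A_{\alpha,\beta}$ this means $H_N(\omega)=-\frac{\beta}{2N}\sum_{i\sim j}\mathbf 1_{\omega_i=\omega_j}-\frac{\alpha}{2N}\sum_{i\nsim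 j}\mathbf 1_{\omega_i=\omega_j}$, sums over ordered pairs $(i,j)$ (with $i\sim i$), where $i\sim j$ means that $i,j$ are in the same block and $i\nsim j$ that they are in different blocks. Critical value: $\zeta_q=2\,\frac{q-1}{q-2}\log(q-1)$ for $q\ge3$, and $\zeta_2=2$. The symbol $\Rightarrow$ denotes convergence in distribution (of the law under $\mu_N$) as $N\to\infty$. *)

(* Defs.v *)
From HB Require Import structures.
From mathcomp Require Export all_boot all_order all_algebra.
From mathcomp Require Export mxtens.
From mathcomp Require Export all_classical all_reals all_analysis.

Set Implicit Arguments.
Unset Strict Implicit.
Unset Printing Implicit Defensive.

Export Order.TTheory GRing.Theory Num.Theory.
Export numFieldNormedType.Exports.

Local Open Scope classical_set_scope.
Local Open Scope ring_scope.

(* The Kronecker product is [_ *t _] of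
   [mxtens]: the row of e_k (x) e_c is [mxtens_index (k, c)], and
   [mxtens_unindex] recovers the pair (k, c) of a row index. *)

Section LinearAlgebra.
Variable R : realType.

Definition l2norm n (x : 'cV[R]_n) : R := Num.sqrt (\sum_(i < n) x i 0 ^+ 2).

Definition spectral_norm n (M : 'M[R]_n) : R :=
  sup [set l2norm (M *m x) | x in [set x : 'cV[R]_n | l2norm x = 1]].

(* Entrywise square root.  It is only applied to diagonal matrices with
   nonnegative entries, where it is the positive semidefinite square root. *)
Definition sqrt_diag n (M : 'M[R]_n) : 'M[R]_n := map_mx Num.sqrt M.

Definition qform n (M : 'M[R]_n) (x : 'cV[R]_n) : R := (x^T *m M *m x) 0 0.

End LinearAlgebra.

Section Gaussian.
Variable R : realType.

(* N(0, v) for a variance v >= 0.  The degenerate case is treated apart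
   because [normal_prob m 0] is not the Dirac mass at m; the second argument
   of [normal_prob] is the standard deviation. *)
Definition centered_normal (v : R) (B : set R) : \bar R :=
  if v == 0 then dirac (0 : R) B else normal_prob 0 (Num.sqrt v) B.

Definition random_vector d (T : measurableType d) (P : probability T R) n
    (W : 'I_n -> {RV P >-> R}) (x : T) : 'cV[R]_n :=
  \col_(i < n) W i x.

(* W ~ N(0, Sigma), with Sigma possibly singular: every linear combination
   t^T W has the one-dimensional law N(0, t^T Sigma t). *)
Definition is_centered_gaussian d (T : measurableType d) (P : probability T R)
    n (W : 'I_n -> {RV P >-> R}) (Sigma : 'M[R]_n) : Prop :=
  Sigma^T = Sigma /\
  forall t : 'cV[R]_n,
    0 <= qform Sigma t /\
    forall B : set R, measurable B ->
      P ((fun x => (t^T *m random_vector W x) 0 0) @^-1` B)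
        = centered_normal (qform Sigma t) B.

End Gaussian.

Section BlockPotts.
Variables (R : realType) (s q : nat).

Definition is_block_partition N (S : 'I_s -> {set 'I_N}) : Prop :=
  (forall k : 'I_s, exists i : 'I_N, i \in S k) /\
  (forall i : 'I_N, exists! k : 'I_s, i \in S k).

Definition config N := {ffun 'I_N -> 'I_q}.

Definition interaction (alpha beta : R) : 'M[R]_s :=
  alpha *: const_mx 1 + (beta - alpha) *: 1%:M.

Definition calA (A : 'M[R]_s) : 'M[R]_(s * q) := A *t (1%:M : 'M[R]_q).

Definition Gamma (gamma : 'rV[R]_s) : 'M[R]_(s * q) :=
  diag_mx gamma *t (1%:M : 'M[R]_q).

Definition block_size_mx N (S : 'I_s -> {set 'I_N}) : 'M[R]_s :=
  diag_mx (\row_(k < s) #|S k|%:R).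

Definition calS N (S : 'I_s -> {set 'I_N}) : 'M[R]_(s * q) :=
  block_size_mx S *t (1%:M : 'M[R]_q).

Definition magnetization N (S : 'I_s -> {set 'I_N}) (w : config N) :
    'cV[R]_(s * q) :=
  \col_j let: (k, c) := mxtens_unindex j in
         #|S k|%:R^-1 * \sum_(i in S k) (w i == c)%:R.

Definition hamiltonian (A : 'M[R]_s) N (S : 'I_s -> {set 'I_N})
    (w : config N) : R :=
  - (2 * N%:R)^-1 *
    qform (calS S *m calA A *m calS S) (magnetization S w).

Definition gibbs (A : 'M[R]_s) N (S : 'I_s -> {set 'I_N}) (w : config N) : R :=
  expR (- hamiltonian A S w) /
  \sum_(w' : config N) expR (- hamiltonian A S w').

Definition gibbs_mean (A : 'M[R]_s) N (S : 'I_s -> {set 'I_N})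
    (g : config N -> R) : R :=
  \sum_(w : config N) gibbs A S w * g w.

(* Convergence in distribution, under the Gibbs measures, of the vectors X_N
   to W: convergence of the expectations of bounded continuous functions. *)
Definition gibbs_cvg_in_law (A : 'M[R]_s) (S : forall N, 'I_s -> {set 'I_N})
    n (X : forall N, config N -> 'cV[R]_n)
    d (T : measurableType d) (P : probability T R)
    (W : 'I_n -> {RV P >-> R}) : Prop :=
  forall f : 'cV[R]_n -> R,
    continuous f ->
    (exists M : R, forall x, `|f x| <= M) ->
    (gibbs_mean A (S N) (f \o X N))%:E @[N --> \oo]
      --> ('E_P[f \o random_vector W])%E.

Definition fluctuation N (S : 'I_s -> {set 'I_N}) (w : config N) :
    'cV[R]_(s * q) :=
  sqrt_diag (calS S) *m (magnetization S w - const_mx q%:R^-1).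

Definition zeta : R :=
  if q == 2 then 2
  else 2 * ((q%:R - 1) / (q%:R - 2)) * ln (q%:R - 1).

Definition color_mx : 'M[R]_q :=
  (q%:R ^+ 2)^-1 *: const_mx 1 - q%:R^-1 *: 1%:M.

Definition limit_cov (A : 'M[R]_s) : 'M[R]_(s * q) :=
  s%:R *: (invmx (calA A) *m
    (invmx (1%:M + (s%:R^-1 *: calA A) *m ((1%:M : 'M[R]_s) *t color_mx))
       - 1%:M)).

End BlockPotts.

Arguments zeta R q : clear implicits.
Arguments interaction {R} s alpha beta.
Arguments calA {R s} q A.
Arguments Gamma {R s} q gamma.
Arguments limit_cov {R s} q A.
Arguments fluctuation R {s q N} S w.

(* Main.v *)
(* Under the uniform measure on configurations, the fluctuation vector v has
   moment generating function at most exp (|t|^2 / (2 zeta)): for each spin this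
   is a sharp inequality for a uniform color, which reduces to vectors taking
   two values.  Since - H = const + v^T (sqrt S A sqrt S / N) v / 2 and the
   spectral norm is below zeta, averaging over an auxiliary Gaussian vector
   shows that exp (- H) stays uniformly integrable, with room to spare.  Under
   the uniform measure the characteristic functions of v converge to those of a
   Gaussian Z; exponential moments of |v|^2 and approximation by trigonometric
   polynomials extend this convergence to the functions
   cos (t.v + c) exp (v^T (A / s) v / 2).  In an orthonormal basis of eigenvectors
   the tilted Gaussian Z is again Gaussian, of covariance Sigma, and the Gibbs
   means of cos (t.v + c) converge to the means under N(0, Sigma).  The same
   approximation argument then gives all bounded continuous functions. *)

From HB Require Import structures.
Require Import Defs.
From mathcomp Require Import ring lra measurable_realfun lebesgue_integral_under.

Set Implicit Arguments.
Unset Strict Implicit.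
Unset Printing Implicit Defensive.

Local Open Scope classical_set_scope.
Local Open Scope ring_scope.

(** * The moment generating function of a uniform color *)

(** Two different thresholds are involved. The limit covariance makes sense as soon as the top
    eigenvalue of A / s is below q, because the indicator vector of one uniform color has covariance
    eigenvalues 0 and 1 / q. Integrability of exp (- H) uniformly in N asks for more: a moment
    generating bound at every t, not only near 0. Its best constant is zeta, which is smaller than q
    for q >= 3, and equality holds at 0 and also at a nonzero vector; so a second-order expansion
    cannot produce it, and the bound needs its own convexity argument.

    Errors of approximation are measured against the weight exp (k |x|^2). The unbounded tilt and
    the bounded test functions then fall under one convergence statement, at the price of a strict
    gap between growth rate and available moment. Test functions are cosines with a phase, which
    keeps the Fourier analysis real. The interaction and the color covariance are both combinations
    of the identity and an all-ones matrix, so one reflection per tensor factor diagonalizes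
    everything explicitly, and the singular directions are coordinates of variance zero. *)

Section PointwiseDerivatives.
Variable R : realType.
Implicit Types (f g : R -> R) (a b c x : R).

(* A copy of [is_derive] that typeclass resolution ignores. *)
Definition derives f x a : Prop := is_derive x 1 f a.

Lemma derD f g a b x : derives f x a -> derives g x b ->
  derives (fun y => f y + g y) x (a + b).
Proof. exact: is_deriveD. Qed.

Lemma derN f a x : derives f x a -> derives (fun y => - f y) x (- a).
Proof. exact: is_deriveN. Qed.

Lemma derM f g a b x : derives f x a -> derives g x b ->
  derives (fun y => f y * g y) x (f x * b + g x * a).
Proof. exact: is_deriveM. Qed.

Lemma derC c x : derives (fun=> c) x 0.
Proof. exact: is_derive_cst. Qed.

Lemma derI x : derives (fun y : R => y) x 1.
Proof. exact: is_derive_id. Qed.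

Lemma derexp f a x : derives f x a ->
  derives (fun y => expR (f y)) x (expR (f x) * a).
Proof. by move=> fa; apply: is_derive1_comp. Qed.

Lemma derln f a x : 0 < f x -> derives f x a ->
  derives (fun y => ln (f y)) x ((f x)^-1 * a).
Proof. by move=> f0 fa; exact: (@is_derive1_comp _ (@ln R) f x _ _ (is_derive1_ln f0) fa). Qed.

Lemma derV f a x : f x != 0 -> derives f x a ->
  derives (fun y => (f y)^-1) x (- (f x) ^- 2 * a).
Proof. by move=> f0 fa; apply: is_deriveV. Qed.

Lemma dersin f a x : derives f x a ->
  derives (fun y => sin (f y)) x (cos (f x) * a).
Proof. by move=> fa; apply: is_derive1_comp. Qed.

Lemma dercos f a x : derives f x a ->
  derives (fun y => cos (f y)) x (- sin (f x) * a).
Proof. by move=> fa; apply: is_derive1_comp. Qed.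

Lemma der_eq f a b x : derives f x a -> a = b -> derives f x b.
Proof. by move=> ? <-. Qed.

End PointwiseDerivatives.

Ltac derive := first
  [ exact: derC | exact: derI | apply: derexp; derive | apply: derN; derive
  | apply: derD; derive | apply: derM; derive | apply: dersin; derive
  | apply: dercos; derive | by eauto ].

Section Calculus.
Variable R : realType.
Implicit Types (f df : R -> R) (a b l u v x t T c : R).

Lemma MVT_is_derive f df a b : a < b -> (forall x, a <= x <= b -> derives f x (df x)) ->
  exists2 c, a < c < b & f b - f a = df c * (b - a).
Proof.
move=> ab fd.
have [x||c cab ->] := @MVT R f df a b ab; last by exists c => //; move: cab; rewrite in_itv.
  by rewrite in_itv /= => /andP[ax xb]; apply: fd; rewrite !ltW.
apply: derivable_within_continuous => x; rewrite in_itv /= => xab.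
by have [] := fd x xab.
Qed.

Lemma ger0_derive_le f df a b : a <= b ->
  (forall x, a <= x <= b -> derives f x (df x)) ->
  (forall x, a < x < b -> 0 <= df x) -> f a <= f b.
Proof.
rewrite le_eqVlt => /predU1P[->//|ab] fd df0.
have [c cab e] := MVT_is_derive ab fd.
by rewrite -subr_ge0 e mulr_ge0 ?df0 // subr_ge0 ltW.
Qed.

Lemma derive_sign_min f df a l : a <= l ->
  (forall x, a <= x -> derives f x (df x)) ->
  (forall x, a < x -> 0 <= df x * (x - l)) -> forall x, a <= x -> f l <= f x.
Proof.
move=> al fd df0 x ax; have [lx|xl] := leP l x.
  apply: (ger0_derive_le lx (df := df)) => y /andP[ly yx].
    by apply: fd; rewrite (le_trans al).
  by have := df0 y (le_lt_trans al ly); rewrite pmulr_lge0 ?subr_gt0.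
rewrite -lerN2; apply: (@ger0_derive_le (fun y => - f y) (fun y => - df y) _ _ (ltW xl)).
  by move=> y /andP[xy yl]; apply: derN; apply: fd; rewrite (le_trans ax).
move=> y /andP[xy yl]; have := df0 y (le_lt_trans ax xy).
by rewrite -mulrNN pmulr_lge0 // oppr_gt0 subr_lt0.
Qed.

(** Divided by [t ^+ 3], this is the derivative of (e^t - 1 - t) / t^2; halved, it is the sign
    condition of [cosh2_le] for [c = 1 / 8], the case of two colors. *)
Lemma expR_quad_ge0 t : 0 <= t -> 0 <= (t - 2) * expR t + t + 2.
Proof.
move=> t0; pose f x : R := (x - 2) * expR x + x + 2.
have -> : 0 = f 0 by rewrite /f expR0; lra.
apply: (@ger0_derive_le f (fun x => (x - 1) * expR x + 1) _ _ t0) => x _.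
  apply: der_eq; first by rewrite /f; derive.
  by rewrite /=; ring.
have /(ler_wpM2r (expR_ge0 x)) := expR_ge1Dx (- x).
rewrite expRN mulVf ?gt_eqF ?expR_gt0 //; lra.
Qed.

Lemma expR_ge_quad t : 0 <= t -> 1 + t + t ^+ 2 / 2 <= expR t.
Proof.
move=> t0; pose f x : R := expR x - x - x * x / 2.
have : f 0 <= f t; last by rewrite /f expR0 expr2; lra.
apply: (@ger0_derive_le f (fun x => expR x - (1 + x)) _ _ t0) => x _.
  apply: der_eq; first by rewrite /f; derive.
  by rewrite /=; field.
by rewrite subr_ge0 expR_ge1Dx.
Qed.

Lemma expR_le_quad t : t <= 0 -> expR t <= 1 + t + t ^+ 2 / 2.
Proof.
move=> t0; pose f x : R := expR x - x - x * x / 2.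
have : f t <= f 0; last by rewrite /f expR0 expr2; lra.
apply: (@ger0_derive_le f (fun x => expR x - (1 + x)) _ _ t0) => x _.
  apply: der_eq; first by rewrite /f; derive.
  by rewrite /=; field.
by rewrite subr_ge0 expR_ge1Dx.
Qed.

(** The ratio (e^t - 1 - t) / t^2 increases for t > 0, and for t <= 0 the coefficient 1 / 2 already
    suffices. The parabola is tangent to the exponential at 0 and meets it at [T]. *)
Lemma expR_le_parabola t T : 0 < T -> t <= T ->
  expR t <= 1 + t + (expR T - 1 - T) / T ^+ 2 * t ^+ 2.
Proof.
move=> T0 tT; have T20 : 0 < T ^+ 2 by rewrite exprn_gt0.
have [t0|t0] := leP t 0.
  apply: (le_trans (expR_le_quad t0)); rewrite lerD2l mulrC ler_wpM2r ?sqr_ge0 //.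
  by rewrite ler_pdivlMr // mulrC; have := expR_ge_quad (ltW T0); lra.
pose f x : R := (expR x - 1 - x) * (x * x)^-1.
suff : f t <= f T.
  rewrite /f -!expr2 ler_pdivrMr ?exprn_gt0 //; lra.
apply: (@ger0_derive_le f (fun x => ((x - 2) * expR x + x + 2) / x ^+ 3) _ _ tT) => x.
  move=> /andP[tx _]; have x0 : x != 0 by rewrite gt_eqF // (lt_le_trans t0).
  apply: der_eq.
    by rewrite /f; apply: derM; [derive|apply: derV; [rewrite mulf_neq0|derive]].
  by rewrite /=; field.
move=> /andP[tx _]; have x0 := lt_trans t0 tx.
by rewrite divr_ge0 ?exprn_ge0 ?expR_quad_ge0 // ltW.
Qed.

(** This is sinh x >= x multiplied by 2 e^x. *)
Lemma expR_sinh_ge x : 0 <= x -> 2 * x * expR x <= expR x * expR x - 1.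
Proof.
move=> x0; pose f y : R := expR y * expR y - 1 - 2 * y * expR y.
suff : f 0 <= f x by rewrite /f expR0; lra.
apply: (@ger0_derive_le f (fun y => 2 * expR y * (expR y - (1 + y))) _ _ x0) => y _.
  by apply: der_eq; [rewrite /f; derive|rewrite /=; ring].
by rewrite mulr_ge0 ?mulr_ge0 ?expR_ge0 // subr_ge0 expR_ge1Dx.
Qed.

(* The function is [u / tanh (u / 2)]. *)
Lemma coth_homo u v : 0 < u -> u <= v ->
  u * (expR u + 1) / (expR u - 1) <= v * (expR v + 1) / (expR v - 1).
Proof.
move=> u0 uv; pose f y : R := y * (expR y + 1) * (expR y - 1)^-1.
apply: (@ger0_derive_le f (fun y => (expR y * expR y - 1 - 2 * y * expR y) / (expR y - 1) ^+ 2) _ _ uv).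
  move=> x /andP[ux _]; have x0 : expR x - 1 != 0.
    by rewrite gt_eqF // subr_gt0 expR_gt1 (lt_le_trans u0).
  apply: der_eq.
    by rewrite /f; apply: derM; [derive|apply: derV; [|derive]].
  by rewrite /=; field.
move=> x /andP[ux _]; rewrite divr_ge0 ?sqr_ge0 // subr_ge0 expR_sinh_ge //.
by rewrite ltW // (lt_trans u0).
Qed.

Definition cosh2 u : R := expR (u / 2) + expR (- (u / 2)).

Lemma cosh2_gt0 u : 0 < cosh2 u.
Proof. by rewrite addr_gt0 ?expR_gt0. Qed.

Lemma cosh2N u : cosh2 (- u) = cosh2 u.
Proof. by rewrite /cosh2 mulNr opprK addrC. Qed.

(* The tangent line of the concave function [y |-> ln (cosh2 (sqrt y))] at
   [l ^+ 2]; the hypothesis says that [c] is its slope. *)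
Lemma cosh2_le c l u : 0 <= l ->
  (forall x, 0 < x -> 0 <= (4 * c * x * (expR x + 1) - (expR x - 1)) * (x - l)) ->
  cosh2 u <= cosh2 l * expR (c * (u ^+ 2 - l ^+ 2)).
Proof.
move=> l0 hc; wlog u0 : u / 0 <= u => [hw|].
  have [|/ltW] := leP 0 u; first exact: hw.
  by rewrite -oppr_ge0 => /hw; rewrite cosh2N sqrrN.
pose f x : R := c * (x * x) - ln (cosh2 x).
have : f l <= f u.
  apply: (@derive_sign_min f (fun x => (4 * c * x * (expR x + 1) - (expR x - 1))
    / (2 * (expR x + 1))) 0) => // x x0.
    have ex : expR x = expR (x / 2) ^+ 2 by rewrite -expRM_natl; congr expR; field.
    have e2 : expR (x / 2) != 0 by rewrite gt_eqF ?expR_gt0.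
    apply: der_eq.
      rewrite /f; apply: derD; first by derive.
      by apply: derN; apply: derln; [exact: cosh2_gt0|rewrite /cosh2; derive].
    rewrite /cosh2 expRN ex /=; field; rewrite e2 /=.
    by rewrite andbT gt_eqF // addr_gt0 // exprn_gt0 // expR_gt0.
  rewrite mulrAC divr_ge0 ?hc // mulr_ge0 // addr_ge0 ?expR_ge0 //.
rewrite /f -!expr2 => h.
have E x : expR (ln (cosh2 x)) = cosh2 x by rewrite lnK // posrE cosh2_gt0.
rewrite -(E u) -(E l).
by rewrite -expRD ler_expR mulrBr; lra.
Qed.

Lemma Cauchy_Schwarz_sum (I : finType) (P : pred I) (a b : I -> R) :
  (\sum_(i | P i) a i * b i) ^+ 2 <=
    (\sum_(i | P i) a i ^+ 2) * (\sum_(i | P i) b i ^+ 2).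
Proof.
set A := \sum_(i | P i) a i ^+ 2; set B := \sum_(i | P i) b i ^+ 2.
set C := \sum_(i | P i) a i * b i.
have B0 : 0 <= B by apply: sumr_ge0 => i _; exact: sqr_ge0.
have : 0 <= \sum_(i | P i) (B * a i - C * b i) ^+ 2.
  by apply: sumr_ge0 => i _; exact: sqr_ge0.
have -> : \sum_(i | P i) (B * a i - C * b i) ^+ 2 =
    B ^+ 2 * A - 2 * B * C * C + C ^+ 2 * B.
  rewrite [in RHS]/A {3}/C {4}/B; move: B C {B0} => B C.
  by rewrite !mulr_sumr -sumrB -big_split /=; apply: eq_bigr => i _; ring.
have -> : B ^+ 2 * A - 2 * B * C * C + C ^+ 2 * B = B * (A * B - C ^+ 2) by ring.
move: B0; rewrite le_eqVlt => /predU1P[B0|B0]; last by rewrite pmulr_rge0 // subr_ge0.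
have b0 i : P i -> b i = 0.
  move=> Pi; apply/eqP; rewrite -sqrf_eq0.
  move/esym/eqP: B0; rewrite psumr_eq0 => [/allP/(_ i)|j _]; last exact: sqr_ge0.
  by rewrite mem_index_enum Pi => /(_ isT).
move=> _; rewrite /C big1 ?expr0n /= => [|i /b0 ->]; last by rewrite mulr0.
by rewrite -B0 mulr0.
Qed.

Lemma zeta_gt0 q : (2 <= q)%N -> 0 < zeta R q.
Proof.
move=> q2; rewrite /zeta; case: eqP => [//|/eqP q_neq2].
have q3 : (3 <= q%:R :> R) by rewrite (ler_nat R 3) ltn_neqAle eq_sym q_neq2.
rewrite mulr_gt0 ?ln_gt0 ?mulr_gt0 ?invr_gt0 //; lra.
Qed.

Lemma ln_le_half_diff x : 1 <= x -> ln x <= (x ^+ 2 - 1) / (2 * x).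
Proof.
move=> x1; have x0 : 0 < x by lra.
have := expR_sinh_ge (ln_ge0 x1); rewrite lnK // => h.
by rewrite ler_pdivlMr; [nra|lra].
Qed.

(** The bound ln p <= (p^2 - 1) / (2 p) at p = q - 1 cancels exactly to q. Through it the high
    temperature condition gives [tilt i < 1], hence a well-defined limit covariance. *)
Lemma zeta_le q : (2 <= q)%N -> zeta R q <= q%:R.
Proof.
move=> q2; rewrite /zeta; case: eqP => [->//|/eqP q_neq2].
have q3 : (3 <= q%:R :> R) by rewrite (ler_nat R 3) ltn_neqAle eq_sym q_neq2.
have := @ln_le_half_diff (q%:R - 1); rewrite ler_pdivlMr; last lra.
move=> /(_ _); rewrite mulrA => h.
rewrite mulrAC ler_pdivrMr; last lra.
have {}h := h ltac:(lra); lra.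
Qed.

(* The maximum of the moment generating function of the uniform color on a
   sphere is attained at vectors with one large and [q - 1] equal entries. *)
Lemma two_valued_mgf_le q a : (2 <= q)%N ->
  expR a + (q%:R - 1) * expR (- (a / (q%:R - 1))) <=
    q%:R * expR (a ^+ 2 * (q%:R / (q%:R - 1)) / (2 * zeta R q)).
Proof.
move=> q2; rewrite /zeta; case: eqP => [->|/eqP q_neq2].
  have -> : 2 - 1 = 1 :> R by lra.
  rewrite !divr1 mul1r.
  (* For two colors the tangent point is 0, and ln cosh (u / 2) = u^2 / 8 + o(u^2) gives the slope 1
     / 8. *)
  have c8 x : 0 < x -> 0 <= (4 * (1 / 8) * x * (expR x + 1) - (expR x - 1)) * (x - 0).
    move=> x0; rewrite subr0 mulr_ge0 //; last exact: ltW.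
    by have := expR_quad_ge0 (ltW x0); lra.
  have := cosh2_le (2 * a) (lexx 0) c8.
  rewrite /cosh2 [0 / 2]mul0r oppr0 expR0.
  have -> : 2 * a / 2 = a by field.
  by have -> : 1 / 8 * ((2 * a) ^+ 2 - 0 ^+ 2) = a ^+ 2 * 2 / (2 * 2) by field.
have q3 : (3 <= q%:R :> R) by rewrite (ler_nat R 3) ltn_neqAle eq_sym q_neq2.
set p := q%:R - 1; have qE : q%:R = p + 1 :> R by rewrite /p; lra.
have p2 : 2 <= p by rewrite /p; lra.
have p0 : 0 < p by lra.
have l0 : 0 < ln p by rewrite ln_gt0; lra.
rewrite qE; have -> : p + 1 - 2 = p - 1 by lra.
(* The shift by ln p turns the weights 1 and p into a symmetric pair, so the left side becomes a
   multiple of [cosh2 u]. The slope [c] is tanh (l / 2) / (4 l). The tangent touches at u = l and,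
   by evenness, at u = - l, that is at a = 0: this double contact is the origin of zeta. *)
pose l := ln p; pose u := a * (p + 1) / p - l.
pose c := (p - 1) / (4 * (p + 1) * l).
have cE : forall x, 0 < x -> 0 <= (4 * c * x * (expR x + 1) - (expR x - 1)) * (x - l).
  move=> x x0; have -> : 4 * c * x * (expR x + 1) - (expR x - 1) =
    (expR x - 1) * ((p - 1) / ((p + 1) * l)) * (x * (expR x + 1) / (expR x - 1) - l * (p + 1) / (p - 1)).
    by rewrite /c; field; rewrite ?gt_eqF // ?subr_gt0 ?expR_gt1 //; lra.
  have e1 : 0 <= expR x - 1 by rewrite subr_ge0 -expR0 ler_expR ltW.
  have e2 : 0 < (p + 1) * l by rewrite mulr_gt0 //; lra.
  rewrite -[leRHS]mulrA mulr_ge0 //.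
    by rewrite mulr_ge0 // divr_ge0 ?(ltW e2) //; lra.
  have [lx|xl] := leP l x.
    have := coth_homo l0 lx; rewrite lnK // => h.
    by rewrite mulr_ge0 // subr_ge0.
  have := coth_homo x0 (ltW xl); rewrite lnK // => h.
  by rewrite -mulrNN mulr_ge0 // oppr_ge0 subr_le0 // ltW.
have := cosh2_le u (ltW l0) cE.
have -> : cosh2 (ln p) = expR (- (l / 2)) * (p + 1).
  rewrite /cosh2 mulrDr mulr1; congr +%R.
  by rewrite -{2}(lnK p0) -expRD; congr expR; rewrite /l; field.
move=> h; rewrite [expR (- (l / 2)) * _]mulrC -mulrA -expRD in h.
have -> : expR a + p * expR (- (a / p)) = p * expR (- (a / p) + u / 2) * cosh2 u.
  rewrite /cosh2 mulrDr -!(mulrA p) -!expRD; congr +%R; last by congr (_ * expR _); lra.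
  rewrite -{1}(lnK p0) -expRD; congr expR; rewrite /u /l; field.
  by rewrite gt_eqF.
apply: (le_trans (ler_wpM2l _ h)); first by rewrite mulr_ge0 ?expR_ge0 // ltW.
rewrite mulrCA ler_pM2l; last lra.
rewrite -{1}(lnK p0) -!expRD ler_expR le_eqVlt; apply/orP; left; apply/eqP.
rewrite /u /c -/l; field.
by rewrite !gt_eqF //; lra.
Qed.

(** Cauchy-Schwarz on the other q - 1 entries bounds every entry by [a], the large value of the
    extremal vector (a, b, ..., b) with the same sum and the same norm. Each exponential lies below
    the parabola tangent at [b] and meeting it at [a]. The sum of these parabolas depends only on
    the sum and the norm of [x], so it equals its value at the extremal vector, where the bound is
    exact. *)
Lemma uniform_mgf_le q (x : 'I_q -> R) : (2 <= q)%N -> \sum_c x c = 0 ->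
  q%:R^-1 * \sum_c expR (x c) <= expR ((\sum_c x c ^+ 2) / (2 * zeta R q)).
Proof.
move=> q2 sx0; set rho := \sum_c x c ^+ 2.
have q2R : 2 <= q%:R :> R by rewrite (ler_nat R 2).
set p : R := q%:R - 1; have qE : q%:R = p + 1 :> R by rewrite /p; lra.
have p0 : 0 < p by rewrite /p; lra.
have rho0 : 0 <= rho by apply: sumr_ge0 => i _; exact: sqr_ge0.
rewrite ler_pdivrMl; last lra.
pose a := Num.sqrt (rho * p / (p + 1)).
have a2 : a ^+ 2 = rho * p / (p + 1) by rewrite sqr_sqrtr // divr_ge0 ?mulr_ge0 //; lra.
have a0 : 0 <= a by exact: sqrtr_ge0.
have xa (c : 'I_q) : x c <= a.
  have [xc0|/ltW xc0] := leP (x c) 0; first exact: (le_trans xc0).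
  rewrite -(@ler_pXn2r _ 2%N) ?nnegrE // a2 ler_pdivlMr; last lra.
  have : (\sum_(d | d != c) x d) ^+ 2 <= p * \sum_(d | d != c) x d ^+ 2.
    have -> : p = \sum_(d : 'I_q | d != c) 1 ^+ 2.
      rewrite (eq_bigr (fun=> 1)) => [|i _]; last by rewrite expr1n.
      have := sumr_const (pred_of_simpl (@predT 'I_q)) (1 : R).
      rewrite (bigD1 c) //= card_ord /p => <-; lra.
    have := Cauchy_Schwarz_sum (fun d => d != c) (fun=> 1) x.
    by under eq_bigr do rewrite mul1r.
  have -> : rho = x c ^+ 2 + \sum_(d | d != c) x d ^+ 2 by rewrite /rho (bigD1 c).
  have -> : \sum_(d | d != c) x d = - x c.
    by move/eqP: sx0; rewrite (bigD1 c) //= addrC addr_eq0 => /eqP.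
  rewrite sqrrN; lra.
have [rho00|rho_neq0] := eqVneq rho 0.
  have x0 (c : 'I_q) : x c = 0.
    apply/eqP; rewrite -sqrf_eq0; move/eqP: rho00.
    rewrite psumr_eq0 => [/allP/(_ c)|j _]; last exact: sqr_ge0.
    by rewrite mem_index_enum => /(_ isT).
  rewrite rho00 mul0r expR0 mulr1 (eq_bigr (fun=> 1)) => [|c _]; last by rewrite x0 expR0.
  by rewrite sumr_const card_ord.
have {}a0 : 0 < a by rewrite sqrtr_gt0 divr_gt0 ?mulr_gt0 ?lt_def ?rho_neq0 //=; lra.
pose b := - (a / p); pose T := a - b; pose k := (expR T - 1 - T) / T ^+ 2.
have ap : 0 < a / p by rewrite divr_gt0.
have T0 : 0 < T by rewrite /T /b; lra.
have -> : rho = a ^+ 2 * (q%:R / (q%:R - 1)).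
  by rewrite a2 -/p qE; field; rewrite !gt_eqF //; lra.
apply: le_trans (two_valued_mgf_le a q2); rewrite -/p -/b.
have h (c : 'I_q) : expR (x c) <= expR b * (1 + (x c - b) + k * (x c - b) ^+ 2).
  have -> : expR (x c) = expR b * expR (x c - b) by rewrite -expRD addrC subrK.
  by rewrite ler_wpM2l ?expR_ge0 // expR_le_parabola // lerD2r.
apply: (@le_trans _ _ (\sum_c expR b * (1 + (x c - b) + k * (x c - b) ^+ 2))).
  by apply: ler_sum => c _; exact: h.
rewrite -mulr_sumr.
have -> : \sum_c (1 + (x c - b) + k * (x c - b) ^+ 2) =
    (1 - b + k * b ^+ 2) * q%:R + (1 - 2 * k * b) * (\sum_c x c) + k * rho.
  rewrite /rho !mulr_sumr mulr_natr -[q in _ *+ q]card_ord -sumr_const -!big_split /=.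
  by apply: eq_bigr => c _; ring.
rewrite sx0 mulr0 addr0 le_eqVlt; apply/orP; left; apply/eqP.
have -> : expR a = expR b * expR T by rewrite -expRD /T addrC subrK.
have -> : rho = a ^+ 2 * (p + 1) / p by rewrite a2; field; rewrite !gt_eqF //; lra.
rewrite mulrC [p * _]mulrC -mulrDr mulrC; congr (_ * _).
rewrite qE /k /T /b; field.
by rewrite !gt_eqF //; nra.
Qed.

End Calculus.

(** * Gaussian integrals *)

Section NormalIntegral.
Variable R : realType.
Implicit Types (sigma a b c x : R).
Local Notation mu := lebesgue_measure.

Lemma ge0_integral_normal_prob sigma (f : R -> \bar R) : sigma != 0 ->
  measurable_fun setT f -> (forall x, 0 <= f x)%E ->
  (\int[normal_prob 0 sigma]_x f x =
   \int[mu]_x (f x * (normal_pdf 0 sigma x)%:E))%E.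
Proof.
move=> s0 mf f0; have dom := normal_prob_dominates (0 : R) sigma.
rewrite -(Radon_Nikodym_SigmaFinite.change_of_variables dom) //.
apply: ae_eq_integral => //.
- apply: emeasurable_funM => //.
  exact: measurable_int (Radon_Nikodym_SigmaFinite.f_integrable dom).
- apply: emeasurable_funM => //.
  by apply/measurable_EFinP; exact: measurable_normal_pdf.
- apply: ae_eqe_mul2l; apply: integral_ae_eq => //.
  + exact: Radon_Nikodym_SigmaFinite.f_integrable.
  + by apply/measurable_EFinP; exact: measurable_normal_pdf.
  + by move=> A _ mA; rewrite -Radon_Nikodym_SigmaFinite.f_integral.
Qed.

Lemma integral_normal_probE sigma (f : R -> \bar R) E : sigma != 0 ->
  measurable E -> (normal_prob 0 sigma).-integrable E f ->
  (\int[normal_prob 0 sigma]_(x in E) f x =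
   \int[mu]_(x in E) (f x * (normal_pdf 0 sigma x)%:E))%E.
Proof.
move=> s0 mE fi; have dom := normal_prob_dominates (0 : R) sigma.
rewrite -(Radon_Nikodym_change_of_variables dom) //.
apply: ae_eq_integral => //.
- apply: emeasurable_funM; first exact: measurable_int fi.
  apply: measurable_funTS; apply: measurable_int.
  exact: Radon_Nikodym_integrable.
- apply: emeasurable_funM => //; first exact: measurable_int fi.
  by apply: measurable_funTS; apply/measurable_EFinP; exact: measurable_normal_pdf.
- apply: ae_eqe_mul2l; apply: integral_ae_eq => //.
  + by apply: (integrableS measurableT) => //; exact: Radon_Nikodym_integrable.
  + by apply: measurable_funTS; apply/measurable_EFinP; exact: measurable_normal_pdf.
  + by move=> A _ mA; rewrite -Radon_Nikodym_integral.
Qed.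

Lemma integral_normal_expR sigma c : sigma != 0 ->
  (\int[normal_prob 0 sigma]_x (expR (c * x))%:E =
   (expR (sigma ^+ 2 * c ^+ 2 / 2))%:E)%E.
Proof.
move=> s0; have mf : measurable_fun setT (fun x => (expR (c * x))%:E).
  by apply/measurable_EFinP; apply: measurableT_comp.
rewrite ge0_integral_normal_prob //.
transitivity (\int[mu]_x ((expR (sigma ^+ 2 * c ^+ 2 / 2))%:E *
    (normal_pdf (sigma ^+ 2 * c) sigma x)%:E))%E.
  apply: eq_integral => x _; rewrite -!EFinM !normal_pdfE // /normal_fun /=.
  congr EFin; rewrite mulrCA [RHS]mulrCA -!expRD; congr (_ * expR _); field.
  exact: s0.
rewrite ge0_integralZl ?integral_normal_pdf ?mule1 ?lee_fin ?expR_ge0 //=.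
  by apply/measurable_EFinP; exact: measurable_normal_pdf.
by move=> x _; rewrite lee_fin normal_pdf_ge0.
Qed.

Lemma integrable_normal_expR sigma c : sigma != 0 ->
  (normal_prob 0 sigma).-integrable setT (fun x => (expR (c * x))%:E).
Proof.
move=> s0; apply/integrableP; split.
  by apply/measurable_EFinP; apply: measurableT_comp.
under eq_integral do rewrite gee0_abs ?lee_fin ?expR_ge0 //.
by rewrite integral_normal_expR // ltry.
Qed.

Lemma integrable_normal_abs sigma : sigma != 0 ->
  (normal_prob 0 sigma).-integrable setT (fun x => `|x|%:E).
Proof.
move=> s0; have le_abs (y : R) : `|y| <= expR (1 * y) + expR (-1 * y).
  rewrite mulN1r mul1r; have := expR_ge1Dx y; have := expR_ge1Dx (- y).
  by have := expR_gt0 y; have := expR_gt0 (- y); case: (ger0P y) => _; lra.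
have i1 := integrable_normal_expR (- 1) s0.
have i2 := integrable_normal_expR 1 s0.
have := integrableD measurableT i2 i1; apply: le_integrable => //.
  by apply/measurable_EFinP; exact: normr_measurable.
move=> x _; by rewrite /= lee_fin normr_id [leRHS]ger0_norm ?addr_ge0 ?expR_ge0.
Qed.

Lemma normal_pdf_derives sigma x : sigma != 0 ->
  derives (normal_pdf 0 sigma) x (- (x / sigma ^+ 2) * normal_pdf 0 sigma x).
Proof.
move=> s0; rewrite normal_pdfE // /normal_fun; set k := normal_peak sigma.
have -> : (fun y : R => k * expR (- (y - 0) ^+ 2 / (sigma ^+ 2 *+ 2))) =
    (fun y => k * expR (- (y * y) * (sigma ^+ 2 *+ 2)^-1)).
  by apply/funext => y; rewrite subr0 expr2.
apply: der_eq; first by derive.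
by rewrite subr0 /=; field.
Qed.

(** Stein's identity for sin (a x + b): against Lebesgue measure the integrand is the derivative of
    sin (a x + b) times the density, which vanishes at infinity. The integral is the limit of its
    truncations to compact intervals. *)
Lemma integral_normal_stein sigma a b : 0 < sigma ->
  (\int[normal_prob 0 sigma]_x (a * cos (a * x + b) - x / sigma ^+ 2 * sin (a * x + b))%:E = 0)%E.
Proof.
move=> s_gt0; have s0 : sigma != 0 by rewrite gt_eqF.
pose h x : R := a * cos (a * x + b) - x / sigma ^+ 2 * sin (a * x + b).
have ch : continuous h.
  move=> x; apply: differentiable_continuous; apply/derivable1_diffP.
  have [d hd] : exists d, derives h x d by eexists; rewrite /h; derive.
  by case: hd.
have mh : measurable_fun setT h by exact: continuous_measurable_fun.
have ih : (normal_prob 0 sigma).-integrable setT (EFin \o h).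
  have i1 := finite_measure_integrable_cst (normal_prob 0 sigma) `|a| (@measurableT _ R).
  have i2 := integrableZl measurableT (sigma ^- 2) (integrable_normal_abs s0).
  have := integrableD measurableT i1 i2; apply: le_integrable => //.
    exact/measurable_EFinP.
  move=> x _; rewrite /= lee_fin [leRHS]ger0_norm; last first.
    by rewrite addr_ge0 // mulr_ge0 // invr_ge0 sqr_ge0.
  rewrite /h (le_trans (ler_normB _ _)) // !normrM lerD //.
    by rewrite ler_piMr // cos_max.
  rewrite normfV (ger0_norm (sqr_ge0 sigma)) [leRHS]mulrC ler_piMr // ?sin_max //.
  by rewrite mulr_ge0 // invr_ge0 sqr_ge0.
(* The successor keeps every interval nondegenerate, as the fundamental theorem of calculus
   requires. *)
pose E (n : nat) : set (measurableTypeR R) := `[- n.+1%:R, n.+1%:R]%classic.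
pose hn (n : nat) := (EFin \o h) \_ (E n).
have [|||||_ _ hcvg] := @dominated_convergence _ _ _ (normal_prob 0 sigma) _ measurableT hn
    (EFin \o h) (fun x => `|h x|%:E).
- move=> n; apply/(measurable_restrictT _ _).1; first exact: measurable_itv.
  by apply: measurable_funTS; exact/measurable_EFinP.
- exact/measurable_EFinP.
- apply: aeW => x _.
  apply: cvg_near_cst.
  near=> n.
  have xn : `|x| <= n%:R by near: n; exact: nbhs_infty_ger.
  rewrite /hn patchE mem_set // /E /= in_itv /= -ler_norml; apply: (le_trans xn).
  by rewrite ler_nat.
- exact: integrable_norm.
- apply: aeW => x n _; rewrite /hn patchE; case: ifP => //= _.
  by rewrite normr0 lee_fin.

pose G x := sin (a * x + b) * normal_pdf 0 sigma x.
pose g x := h x * normal_pdf 0 sigma x.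
have dG x : is_derive x 1 G (g x).
  have : derives G x (sin (a * x + b) * (- (x / sigma ^+ 2) * normal_pdf 0 sigma x) +
      normal_pdf 0 sigma x * (cos (a * x + b) * a)).
    apply: derM; last exact: normal_pdf_derives.
    by apply: der_eq; [derive|rewrite /=; ring].
  by move/der_eq; apply; rewrite /g /h; ring.
have cG : continuous G.
  by move=> x; apply: differentiable_continuous; apply/derivable1_diffP; case: (dG x).
have cg : continuous g.
  by move=> x; apply: cvgM; [exact: ch|exact: continuous_normal_pdf].
have e n : (\int[normal_prob 0 sigma]_x (hn n x) =
   (G n.+1%:R - G (- n.+1%:R))%:E)%E.
  have mE : measurable (E n) by exact: measurable_itv.
  have ihE := integrableS measurableT mE (@subsetT _ _) ih.
  rewrite -integral_mkcond (integral_normal_probE s0 mE ihE).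
  transitivity (\int[mu]_(x in E n) (g x)%:E)%E.
    by apply: eq_integral => x _; rewrite /= -EFinM.
  rewrite /E (@continuous_FTC2 _ g G) //.
  - by rewrite gtrN.
  - exact: continuous_subspaceT.
  - split.
    + by move=> x _; case: (dG x).
    + exact/cvg_at_right_filter/cG.
    + exact/cvg_at_left_filter/cG.
  - by move=> x _; rewrite derive1E; case: (dG x).
have Gn0 : (G n.+1%:R - G (- n.+1%:R))%:E @[n --> \oo] --> 0%E.
  apply: cvg_EFin; first exact: nearW.
  apply/cvgr0Pnorm_le => eps e0.
  pose k := 4 * normal_peak sigma * sigma ^+ 2.
  have k0 : 0 <= k by rewrite mulr_ge0 ?sqr_ge0 // mulr_ge0 // normal_peak_ge0.
  near=> n; rewrite /=.
  set m : R := n.+1%:R.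
  have m1 : 1 <= m by rewrite /m (ler_nat R 1).
  (* Decay of order 1 / m is enough for the boundary terms, and e^y >= 1 + y provides it once m >=
     1. *)
  have pdfm : normal_pdf 0 sigma m <= 2 * normal_peak sigma * sigma ^+ 2 / m.
    rewrite normal_pdfE // /normal_fun subr0.
    have : 0 < sigma ^+ 2 by rewrite exprn_gt0.
    move: (sigma ^+ 2) => v v0.
    rewrite -!mulrA mulrCA ler_wpM2l ?normal_peak_ge0 //.
    rewrite mulNr expRN -[leRHS]invrK lef_pV2 ?posrE ?invr_gt0 ?expR_gt0 ?mulr_gt0 ?invr_gt0 //; try lra.
    apply: le_trans (expR_ge1Dx _).
    rewrite -subr_ge0.
    have -> : 1 + m ^+ 2 / (v *+ 2) - (2 * (v / m))^-1 =
       1 + m * (m - 1) / (2 * v) by field; rewrite !gt_eqF //; lra.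
    rewrite addr_ge0 // divr_ge0 ?mulr_ge0 //; lra.
  have pdfN : normal_pdf 0 sigma (- m) = normal_pdf 0 sigma m.
    by rewrite !normal_pdfE // /normal_fun !subr0 sqrrN.
  rewrite /G pdfN -mulrBl normrM (ger0_norm (normal_pdf_ge0 _ _ _)).
  apply: (@le_trans _ _ (k / m)).
    have -> : k / m = 2 * (2 * normal_peak sigma * sigma ^+ 2 / m) by rewrite /k; field; lra.
    apply: ler_pM => //; first exact: normal_pdf_ge0.
    rewrite (le_trans (ler_normB _ _)) //.
    by have := sin_max (a * m + b); have := sin_max (a * - m + b); lra.
  rewrite ler_pdivrMr; last lra.
  rewrite mulrC -ler_pdivrMr // /m.
  have /le_trans : k / eps <= n%:R by near: n; exact: nbhs_infty_ger.
  by apply; rewrite ler_nat.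
apply: (cvg_unique _ _ Gn0) => //.
move: hcvg; under eq_fun do rewrite e.
done.
Unshelve. all: end_near.
Qed.

(** As a function of the frequency c, the integral [F] solves F' = - sigma^2 c F, by differentiation
    under the integral and Stein's identity. Hence F(c) exp (sigma^2 c^2 / 2) is constant, equal to
    its value cos b at 0. *)
Lemma integral_normal_cos sigma a b : 0 < sigma ->
  (\int[normal_prob 0 sigma]_x (cos (a * x + b))%:E = (cos b * expR (- (sigma ^+ 2 * a ^+ 2 / 2)))%:E)%E.
Proof.
move=> s_gt0; have s0 : sigma != 0 by rewrite gt_eqF.
pose P := normal_prob 0 sigma; pose f c x : R := cos (c * x + b).
have cf c : continuous (f c).
  move=> x; apply: differentiable_continuous; apply/derivable1_diffP.
  have [d hd] : exists d, derives (f c) x d by eexists; rewrite /f; derive.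
  by case: hd.
have mf c : measurable_fun setT (f c) by exact: continuous_measurable_fun.
have i_f c : P.-integrable setT (EFin \o f c).
  have := finite_measure_integrable_cst P 1 measurableT; apply: le_integrable => //.
    by apply/measurable_EFinP; exact: mf.
  by move=> x _; rewrite /= lee_fin normr1 cos_max.
have d1f c x : 'D_1 (f ^~ x) c = - sin (c * x + b) * x.
  have : derives (f ^~ x) c (- sin (c * x + b) * x).
    by apply: der_eq; [rewrite /f; derive|rewrite /=; ring].
  by case.
have df c x : derivable (f ^~ x) c 1.
  have [d hd] : exists d, derives (f ^~ x) c d by eexists; rewrite /f; derive.
  by case: hd.
pose F c := (\int[P]_(x in setT) f c x)%R.
have FE c : (F c)%:E = (\int[P]_x (f c x)%:E)%E.
  by rewrite /F /Rintegral fineK //; exact: (integrable_fin_num measurableT (i_f c)).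
pose D c := (\int[P]_(x in setT) (- sin (c * x + b) * x))%R.
have isin c : P.-integrable setT (EFin \o (fun x => - sin (c * x + b) * x)).
  have := integrable_normal_abs s0; apply: le_integrable => //.
    apply/measurable_EFinP; apply: continuous_measurable_fun => x.
    apply: differentiable_continuous; apply/derivable1_diffP.
    have [d hd] : exists d, derives (fun x => - sin (c * x + b) * x) x d by eexists; derive.
    by case: hd.
  move=> x _; rewrite /= lee_fin normr_id normrM normrN ler_piMl //.
  exact: sin_max.
have dF c : is_derive c 1 F (D c).
  have bI : `]c - 1, c + 1[%classic c by rewrite /= in_itv /=; apply/andP; split; lra.
  have h1 x y : `]c - 1, c + 1[%classic x -> setT y -> derivable (f ^~ y) x 1 by [].
  have h2 x y : `]c - 1, c + 1[%classic x -> setT y -> `|partial1of2 f x y| <= `|y|.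
    move=> _ _; rewrite partial1of2E d1f normrM normrN ler_piMl //; exact: sin_max.
  have h3 x : `]c - 1, c + 1[%classic x -> P.-integrable setT (EFin \o f x) by [].
  have := @derivable_under_integral _ _ _ P f setT measurableT c (c - 1) (c + 1) bI h3 h1
    _ (fun=> normr_ge0 _) (integrable_normal_abs s0) h2.
  have := @differentiation_under_integral _ _ _ P f setT measurableT c (c - 1) (c + 1) bI h3 h1
    _ (fun=> normr_ge0 _) (integrable_normal_abs s0) h2.
  rewrite derive1E => dE dF; split => //; rewrite dE /D.
  by apply: eq_Rintegral => x _; rewrite partial1of2E d1f.
have DE c : D c = - (sigma ^+ 2 * c) * F c.
  have De : (D c)%:E = (\int[P]_x (- sin (c * x + b) * x)%:E)%E.
    by rewrite /D /Rintegral fineK //; exact: (integrable_fin_num measurableT (isin c)).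
  have : (\int[P]_x (c%:E * (f c x)%:E + (sigma ^- 2)%:E * (- sin (c * x + b) * x)%:E) = 0)%E.
    rewrite -(integral_normal_stein c b s_gt0); apply: eq_integral => x _.
    by rewrite -!EFinM -EFinD /f; congr EFin; field.
  rewrite integralD //; last 2 first.
  - exact: (integrableZl measurableT c (i_f c)).
  - exact: (integrableZl measurableT (sigma ^- 2) (isin c)).
  rewrite (integralZl measurableT (i_f c)) (integralZl measurableT (isin c)).
  rewrite -FE -De -!EFinM -EFinD => -[] h.
  apply: (mulfI (_ : sigma ^- 2 != 0)); first by rewrite invr_eq0 sqrf_eq0.
  have -> : sigma ^- 2 * (- (sigma ^+ 2 * c) * F c) = - (c * F c) by field.
  by apply/eqP; rewrite -addr_eq0 addrC h.
pose K c := F c * expR (sigma ^+ 2 / 2 * (c * c)).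
have dK c : is_derive c 1 K 0.
  have : derives K c (F c * (expR (sigma ^+ 2 / 2 * (c * c)) * (sigma ^+ 2 / 2 * (c + c)))
     + expR (sigma ^+ 2 / 2 * (c * c)) * D c).
    apply: derM; first exact: dF.
    by apply: der_eq; [derive|rewrite /=; ring].
  by move/der_eq; apply; rewrite DE; field.
have := is_derive_0_is_cst a 0 dK.
rewrite /K mulr0 mulr0 expR0 mulr1 => Ka.
rewrite -FE; congr EFin.
have F0 : F 0 = cos b.
  apply: EFin_inj; rewrite FE.
  under eq_integral do rewrite /f mul0r add0r.
  by rewrite integral_cst //= probability_setT mule1.
apply: (mulIf (_ : expR (sigma ^+ 2 / 2 * (a * a)) != 0)); first by rewrite gt_eqF ?expR_gt0.
rewrite Ka F0 -(mulrA (cos b)) -expRD.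
have -> : - (sigma ^+ 2 * a ^+ 2 / 2) + sigma ^+ 2 / 2 * (a * a) = 0 by field.
by rewrite expR0 mulr1.
Qed.

End NormalIntegral.

(** * Normal variables under a quadratic exponential tilt *)

Section TiltedNormal.
Variable R : realType.
Implicit Types (a b c m x : R).
Local Notation mu := lebesgue_measure.

Lemma derives_continuous (f df : R -> R) :
  (forall x, derives f x (df x)) -> continuous f.
Proof.
by move=> fd x; apply: differentiable_continuous; apply/derivable1_diffP; case: (fd x).
Qed.

(** A quadratic tilt with m < 1 only changes the variance from 1 to 1 / (1 - m), up to the total
    mass (1 - m)^(-1/2). Tilted integrals thereby reduce to untilted ones. *)
Lemma normal_pdf_tilt m x : m < 1 ->
  expR (m * x ^+ 2 / 2) * normal_pdf 0 1 x =
  (Num.sqrt (1 - m))^-1 * normal_pdf 0 (Num.sqrt (1 - m))^-1 x.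
Proof.
move=> m1; have r0 : 0 < Num.sqrt (1 - m) by rewrite sqrtr_gt0 subr_gt0.
have rE : Num.sqrt (1 - m) ^+ 2 = 1 - m by rewrite sqr_sqrtr // subr_ge0 ltW.
rewrite !normal_pdfE ?invr_eq0 ?oner_neq0 ?gt_eqF // /normal_fun /normal_peak.
rewrite mulrCA [RHS]mulrA -expRD; congr (_ * expR _); last first.
  by rewrite exprVn rE; field; lra.
rewrite expr1n mul1r exprVn -mulrnAr sqrtrM ?invr_ge0 ?sqr_ge0 // invfM.
by rewrite sqrtrV ?sqr_ge0 // sqrtr_sqr invrK gtr0_norm // mulrA mulVf ?gt_eqF // mul1r.
Qed.

Lemma integral_tilted_normal_expR c m : m < 1 ->
  (\int[normal_prob 0 1]_x (expR (c * x + m * x ^+ 2 / 2))%:E =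
   ((Num.sqrt (1 - m))^-1 * expR (c ^+ 2 / (2 * (1 - m))))%:E)%E.
Proof.
move=> m1; have r0 : 0 < Num.sqrt (1 - m) by rewrite sqrtr_gt0 subr_gt0.
have rE : Num.sqrt (1 - m) ^+ 2 = 1 - m by rewrite sqr_sqrtr // subr_ge0 ltW.
set s := (Num.sqrt (1 - m))^-1; have s0 : s != 0 by rewrite invr_eq0 gt_eqF.
have mc : measurable_fun [set: R] (fun x : R => (expR (c * x))%:E).
  by apply/measurable_EFinP; apply: measurableT_comp.
have mf : measurable_fun [set: R] (fun x : R => (expR (c * x + m * x ^+ 2 / 2))%:E).
  apply/measurable_EFinP; apply: continuous_measurable_fun.
  apply: (@derives_continuous _ (fun x => expR (c * x + m * (x * x) / 2) * (c + m * x))) => x.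
  apply: der_eq; first by under eq_fun do rewrite expr2; derive.
  by rewrite /=; field.
rewrite ge0_integral_normal_prob ?oner_neq0 //.
transitivity (\int[mu]_x (s%:E * ((expR (c * x))%:E * (normal_pdf 0 s x)%:E)))%E.
  apply: eq_integral => x _; rewrite -!EFinM expRD -(mulrA (expR _)) normal_pdf_tilt //.
  by congr EFin; rewrite mulrCA.
rewrite ge0_integralZl //=; last 3 first.
- apply: emeasurable_funM; first exact: mc.
  by apply/measurable_EFinP; exact: measurable_normal_pdf.
- by move=> x _; rewrite mule_ge0 // lee_fin normal_pdf_ge0.
- by rewrite lee_fin invr_ge0 ltW.
rewrite -ge0_integral_normal_prob // integral_normal_expR // -EFinM.
congr (_ * expR _)%:E; rewrite exprVn rE; field; lra.
Qed.

Lemma measurable_cos_affine a b : measurable_fun [set: R] (fun x : R => cos (a * x + b)).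
Proof.
apply: continuous_measurable_fun.
apply: (@derives_continuous (fun x => cos (a * x + b)) (fun x => - sin (a * x + b) * a)) => x.
by apply: der_eq; [derive|rewrite /=; ring].
Qed.

Lemma measurable_quad m : measurable_fun [set: R] (fun x : R => m * x ^+ 2 / 2).
Proof.
apply: continuous_measurable_fun; apply: (@derives_continuous _ (fun x => m * x)) => x.
apply: der_eq; first by under eq_fun do rewrite expr2; derive.
by rewrite /=; field.
Qed.

Lemma integrable_tilted_normal_cos a b m : m < 1 ->
  (normal_prob 0 1).-integrable setT
    (fun x : R => (cos (a * x + b) * expR (m * x ^+ 2 / 2))%:E).
Proof.
move=> m1.
have me : measurable_fun [set: R] (fun x : R => expR (m * x ^+ 2 / 2)).
  by apply: measurableT_comp => //; exact: measurable_quad.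
have ie : (normal_prob 0 1).-integrable setT (fun x : R => (expR (m * x ^+ 2 / 2))%:E).
  apply/integrableP; split; first exact/measurable_EFinP.
  under eq_integral do rewrite gee0_abs ?lee_fin ?expR_ge0 //.
  under eq_integral => x _ do rewrite -[m * _ / 2]add0r -(mul0r x).
  by rewrite integral_tilted_normal_expR // ltry.
apply: le_integrable ie => //.
  apply/measurable_EFinP; apply: measurable_funM me; exact: measurable_cos_affine.
by move=> x _; rewrite /= lee_fin normrM ler_piMl // cos_max.
Qed.

Lemma integral_tilted_normal_cos a b m : m < 1 ->
  (\int[normal_prob 0 1]_x (cos (a * x + b) * expR (m * x ^+ 2 / 2))%:E =
   (cos b * ((Num.sqrt (1 - m))^-1 * expR (- (a ^+ 2 / (2 * (1 - m))))))%:E)%E.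
Proof.
move=> m1; have r0 : 0 < Num.sqrt (1 - m) by rewrite sqrtr_gt0 subr_gt0.
have rE : Num.sqrt (1 - m) ^+ 2 = 1 - m by rewrite sqr_sqrtr // subr_ge0 ltW.
set s := (Num.sqrt (1 - m))^-1; have s0 : 0 < s by rewrite invr_gt0.
have sn0 : s != 0 by rewrite gt_eqF.
have mc := measurable_cos_affine a b; have iec := integrable_tilted_normal_cos a b m1.
have ic : (normal_prob 0 s).-integrable setT (fun x : R => (cos (a * x + b))%:E).
  have := finite_measure_integrable_cst (normal_prob 0 s) 1 measurableT.
  apply: le_integrable => //; first exact/measurable_EFinP.
  by move=> x _; rewrite /= lee_fin normr1 cos_max.
rewrite integral_normal_probE ?oner_neq0 //.
transitivity (\int[mu]_x (s%:E * ((cos (a * x + b))%:E * (normal_pdf 0 s x)%:E)))%E.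
  apply: eq_integral => x _; rewrite -!EFinM -(mulrA (cos _)) normal_pdf_tilt //.
  by congr EFin; rewrite mulrCA.
rewrite integralZl //=; last first.
  apply: le_integrable (integrable_normal_pdf 0 s) => //.
    apply: emeasurable_funM; first exact/measurable_EFinP.
    by apply/measurable_EFinP; exact: measurable_normal_pdf.
  move=> x _; rewrite /= lee_fin normrM ler_piMl // cos_max //.
rewrite -integral_normal_probE // integral_normal_cos // -EFinM.
congr EFin; rewrite mulrCA; congr (_ * (_ * expR _)); rewrite exprVn rE; field; lra.
Qed.

End TiltedNormal.

(** * Independent standard normal variables, described by their integrals *)

Section GaussianSpace.
Variable R : realType.

(** Together with [tilted_cos_integrals], this is the only interface through which independent
    standard normals are used later; no joint density appears. *)
Definition tilted_exp_integrals d (T : measurableType d) (P : probability T R) n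
    (X : 'I_n -> {RV P >-> R}) : Prop :=
  forall c m : 'I_n -> R, (forall i, m i < 1) ->
  (\int[P]_w (expR (\sum_i (c i * X i w + m i * X i w ^+ 2 / 2)))%:E =
   (\prod_i ((Num.sqrt (1 - m i))^-1 * expR (c i ^+ 2 / (2 * (1 - m i)))))%:E)%E.

Definition tilted_cos_integrals d (T : measurableType d) (P : probability T R) n
    (X : 'I_n -> {RV P >-> R}) : Prop :=
  forall (a m : 'I_n -> R) b, (forall i, m i < 1) ->
  (\int[P]_w (cos (\sum_i a i * X i w + b) * expR (\sum_i m i * X i w ^+ 2 / 2))%:E =
   (cos b * \prod_i ((Num.sqrt (1 - m i))^-1 * expR (- (a i ^+ 2 / (2 * (1 - m i))))))%:E)%E.

Lemma mfun_of d d' (T : measurableType d) (U : measurableType d') (f : T -> U) :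
  measurable_fun setT f -> {g : {mfun T >-> U} | g = f :> (T -> U)}.
Proof.
move=> mf; pose m := isMeasurableFun.Build _ _ _ _ f mf.
pose g : {mfun T >-> U} := HB.pack f m.
by exists g.
Qed.

Lemma integrable_tilted_cos d (T : measurableType d) (P : probability T R) n
    (X : 'I_n -> {RV P >-> R}) (a m : 'I_n -> R) b :
  tilted_exp_integrals X -> (forall i, m i < 1) ->
  P.-integrable setT
    (fun w => (cos (\sum_i a i * X i w + b) * expR (\sum_i m i * X i w ^+ 2 / 2))%:E).
Proof.
move=> Xexp m1.
have me : measurable_fun setT (fun w => expR (\sum_i m i * X i w ^+ 2 / 2)).
  apply: measurableT_comp => //; apply: measurable_sum => i.
  by apply: (measurableT_comp (measurable_quad (m i))).
have mf : measurable_fun setT (fun w => cos (\sum_i a i * X i w + b)).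
  apply: (@measurableT_comp _ _ _ _ _ _ (@cos R)).
    by apply: continuous_measurable_fun; exact: continuous_cos.
  apply: measurable_funD => //; apply: measurable_sum => i.
  by apply: measurable_funM.
have ie : P.-integrable setT (fun w => (expR (\sum_i m i * X i w ^+ 2 / 2))%:E).
  apply/integrableP; split; first exact/measurable_EFinP.
  under eq_integral do rewrite gee0_abs ?lee_fin ?expR_ge0 //.
  have <- : (\int[P]_w (expR (\sum_i (0 * X i w + m i * X i w ^+ 2 / 2)))%:E =
      \int[P]_w (expR (\sum_i m i * X i w ^+ 2 / 2))%:E)%E.
    apply: eq_integral => w _; congr (expR _)%:E; apply: eq_bigr => i _.
    by rewrite mul0r add0r.
  by rewrite (Xexp (fun=> 0) m m1) ltry.
apply: le_integrable ie => //.
  by apply/measurable_EFinP; exact: measurable_funM.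
by move=> w _; rewrite /= lee_fin normrM ler_piMl // cos_max.
Qed.

Section Step.
Context d (T : measurableType d) (P : probability T R) (n : nat).
Variable X : 'I_n -> {RV P >-> R}.
Hypotheses (Xexp : tilted_exp_integrals X) (Xcos : tilted_cos_integrals X).

Let Q := (normal_prob (0 : R) 1 \x P)%E.

Let Y0 (i : 'I_n.+1) (w : measurableTypeR R * T) : R :=
  oapp (fun j => X j w.2) w.1 (unlift ord0 i).

Let mY0 i : measurable_fun setT (Y0 i).
Proof.
rewrite /Y0; case: (unlift ord0 i) => [j|] /=; last exact: measurable_fst.
by apply: measurableT_comp; last exact: measurable_snd.
Qed.

Let Y i : {mfun (measurableTypeR R * T)%type >-> R} := projT1 (mfun_of (mY0 i)).

Let YE i w : Y i w = Y0 i w.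
Proof. by rewrite /Y; case: (mfun_of _) => g /= ->. Qed.

Let sumY (F : 'I_n.+1 -> R -> R) w :
  \sum_i F i (Y i w) = F ord0 w.1 + \sum_i F (lift ord0 i) (X i w.2).
Proof.
rewrite big_ord_recl YE /Y0 unlift_none; congr (_ + _).
by apply: eq_bigr => i _; rewrite YE /Y0 liftK.
Qed.

Let msum (F : 'I_n.+1 -> R -> R) : (forall i, measurable_fun setT (F i)) ->
  measurable_fun setT (fun w => \sum_i F i (Y i w)).
Proof.
move=> mF; apply: measurable_sum => i.
by apply: measurableT_comp.
Qed.

Lemma tilted_exp_integrals_step : @tilted_exp_integrals _ _ Q n.+1 Y.
Proof.
move=> c m m1.
have mF i : measurable_fun setT (fun x : R => c i * x + m i * x ^+ 2 / 2).
  apply: continuous_measurable_fun.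
  apply: (@derives_continuous _ _ (fun x => c i + m i * x)) => x.
  apply: der_eq; first by under eq_fun do rewrite expr2; derive.
  by rewrite /=; field.
pose f w := (expR (\sum_i (c i * Y i w + m i * Y i w ^+ 2 / 2)))%:E.
have mf : measurable_fun setT f.
  by apply/measurable_EFinP; apply: measurableT_comp => //; exact: msum mF.
rewrite -/(\int[Q]_w f w)%E (@fubini_tonelli1 _ _ _ _ _ (normal_prob 0 1) P f) //; last first.
  by move=> w; rewrite lee_fin expR_ge0.
pose C := \prod_(i < n) ((Num.sqrt (1 - m (lift ord0 i)))^-1 *
  expR (c (lift ord0 i) ^+ 2 / (2 * (1 - m (lift ord0 i))))).
have C0 : 0 <= C.
  by apply: prodr_ge0 => i _; rewrite mulr_ge0 ?expR_ge0 // invr_ge0 sqrtr_ge0.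
pose e0 (x : R) := expR (c ord0 * x + m ord0 * x ^+ 2 / 2).
have me0 : measurable_fun [set: R] (EFin \o e0).
  by apply/measurable_EFinP; apply: measurableT_comp => //; exact: mF.
transitivity (\int[normal_prob 0 1]_x (C%:E * (e0 x)%:E))%E.
  apply: eq_integral => x _; rewrite /fubini_F /f.
  under eq_integral => y _ do rewrite (sumY (fun i z => c i * z + m i * z ^+ 2 / 2)) /= expRD EFinM.
  have mS : measurable_fun [set: T] (fun y => (expR (\sum_(i < n)
      (c (lift ord0 i) * X i y + m (lift ord0 i) * X i y ^+ 2 / 2)))%:E).
    apply/measurable_EFinP; apply: measurableT_comp => //; apply: measurable_sum => i.
    by apply: (measurableT_comp (mF (lift ord0 i))).
  rewrite ge0_integralZl //= ?lee_fin ?expR_ge0 //.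
  by rewrite Xexp // muleC.
rewrite ge0_integralZl //; last by move=> x _; rewrite lee_fin expR_ge0.
by rewrite integral_tilted_normal_expR // big_ord_recl -EFinM mulrC.
Qed.

(** For a fixed value x of the new coordinate, a_0 x is absorbed into the phase of the cosine. The
    formula for n coordinates applies with that phase, which is why the interface allows an
    arbitrary [b]. *)
Lemma tilted_cos_integrals_step : @tilted_cos_integrals _ _ Q n.+1 Y.
Proof.
move=> a m b m1.
pose f w := (cos (\sum_i a i * Y i w + b) * expR (\sum_i m i * Y i w ^+ 2 / 2))%:E.
have i_f : Q.-integrable setT f by exact: integrable_tilted_cos tilted_exp_integrals_step m1.
rewrite -/(\int[Q]_w f w)%E -(integral12_prod_meas1 i_f).
pose C := \prod_(i < n) ((Num.sqrt (1 - m (lift ord0 i)))^-1 *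
  expR (- (a (lift ord0 i) ^+ 2 / (2 * (1 - m (lift ord0 i)))))).
transitivity (\int[normal_prob 0 1]_x
  (C%:E * (cos (a ord0 * x + b) * expR (m ord0 * x ^+ 2 / 2))%:E))%E.
  apply: eq_integral => x _; rewrite /fubini_F /f.
  under eq_integral => y _.
    rewrite (sumY (fun i z => a i * z)) (sumY (fun i z => m i * z ^+ 2 / 2)) /= expRD.
    rewrite mulrCA addrAC EFinM addrC.
    over.
  rewrite integralZl //=; last exact: integrable_tilted_cos.
  rewrite Xcos // -!EFinM; congr EFin; rewrite -/C; ring.
rewrite integralZl //; last exact: integrable_tilted_normal_cos.
rewrite integral_tilted_normal_cos // big_ord_recl -EFinM -/C; congr EFin; ring.
Qed.

End Step.

Lemma gaussian_space n : exists d (T : measurableType d) (P : probability T R)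
  (X : 'I_n -> {RV P >-> R}), tilted_exp_integrals X /\ tilted_cos_integrals X.
Proof.
elim: n => [|n [d [T [P [X [Xe Xc]]]]]].
  (* With no coordinates both integrands are constant, so any probability space serves as a
     start. *)
  exists _, _, (normal_prob 0 1), (fun i : 'I_0 => cst 0); split=> [c m _|a m b _].
    under eq_integral do rewrite big_ord0 expR0.
    by rewrite big_ord0 integral_cst //= probability_setT mule1.
  under eq_integral do rewrite !big_ord0 expR0 mulr1 add0r.
  by rewrite big_ord0 integral_cst //= probability_setT mule1 mulr1.
do 4 eexists; split; [exact: tilted_exp_integrals_step Xe|exact: tilted_cos_integrals_step Xe Xc].
Qed.

End GaussianSpace.

(** * Trigonometric approximation and weak convergence *)

(* The Bernstein polynomials in [n] variables are the means of functions of
   [coin_mean], for [m] independent coins of bias [u j] per coordinate [j]. *)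
Section BernsteinCoins.
Variables (R : realType) (n m : nat) (u : 'I_n -> R).

Definition coin_weight (w : {ffun 'I_n * 'I_m -> bool}) : R :=
  \prod_a (if w a then u a.1 else 1 - u a.1).

Definition coin_mean (w : {ffun 'I_n * 'I_m -> bool}) (j : 'I_n) : R :=
  m%:R^-1 * \sum_(l < m) (w (j, l))%:R.

(** Independence of the coins: the mean of a product of one-coin functions is the product of their
    means, by distributing the product over the sums. *)
Lemma coin_moment (phi : 'I_n * 'I_m -> bool -> R) :
  \sum_w coin_weight w * \prod_a phi a (w a) =
  \prod_a (u a.1 * phi a true + (1 - u a.1) * phi a false).
Proof.
transitivity (\prod_a \sum_(b : bool) ((if b then u a.1 else 1 - u a.1) * phi a b)).
  by rewrite bigA_distr_bigA; apply: eq_bigr => w _; rewrite -big_split.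
by apply: eq_bigr => a _; rewrite big_bool.
Qed.

Lemma coin_weight_sum : \sum_w coin_weight w = 1.
Proof.
transitivity (\sum_w coin_weight w * \prod_(a : 'I_n * 'I_m) 1).
  by apply: eq_bigr => w _; rewrite big1_eq mulr1.
by rewrite (coin_moment (fun _ _ => 1)) big1 // => a _; ring.
Qed.

Hypothesis u01 : forall j, 0 <= u j <= 1.

Lemma coin_weight_ge0 w : 0 <= coin_weight w.
Proof.
by apply: prodr_ge0 => a _; have /andP[? ?] := u01 a.1; case: ifP => // _; rewrite subr_ge0.
Qed.

Let dev (w : {ffun 'I_n * 'I_m -> bool}) j l : R := (w (j, l))%:R - u j.

Lemma coin_cov j l l' :
  \sum_w coin_weight w * (dev w j l * dev w j l') = (l == l')%:R * (u j * (1 - u j)).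
Proof.
pose phi (l : 'I_m) (a : 'I_n * 'I_m) (b : bool) : R :=
  if a == (j, l) then b%:R - u j else 1.
have phiE (w : {ffun 'I_n * 'I_m -> bool}) k : \prod_a phi k a (w a) = dev w j k.
  rewrite (bigD1 (j, k)) //= /phi eqxx big1 ?mulr1 // => a /negbTE ->.
  by [].
transitivity (\sum_w coin_weight w * \prod_a (phi l a (w a) * phi l' a (w a))).
  by apply: eq_bigr => w _; rewrite big_split /= !phiE.
rewrite (coin_moment (fun a b => phi l a b * phi l' a b)) (bigD1 (j, l)) //=.
have [<-|ll'] := eqVneq l l'.
  rewrite /phi eqxx big1 => [|a /negbTE ->]/=; ring.
by rewrite /phi eqxx xpair_eqE eqxx /= (negbTE ll') /=; ring.
Qed.

Lemma coin_variance j : (0 < m)%N ->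
  \sum_w coin_weight w * (coin_mean w j - u j) ^+ 2 <= m%:R^-1.
Proof.
move=> m0; have mR : m%:R != 0 :> R by rewrite pnatr_eq0 -lt0n.
have meanE w : (coin_mean w j - u j) ^+ 2 =
    m%:R ^- 2 * \sum_(l < m) \sum_(l' < m) dev w j l * dev w j l'.
  have -> : coin_mean w j - u j = m%:R^-1 * \sum_(l < m) dev w j l.
    rewrite /dev sumrB sumr_const card_ord mulrBr /coin_mean -(mulr_natl (u j)).
    by rewrite mulrA mulVf ?mul1r.
  by rewrite exprMn exprVn ; congr (_ * _); rewrite expr2 mulr_suml; under eq_bigr do rewrite mulr_sumr.
under eq_bigr do rewrite meanE mulrCA mulr_sumr.
rewrite -mulr_sumr exchange_big /=.
have -> : \sum_(l < m) \sum_w coin_weight w * \sum_(l' < m) dev w j l * dev w j l' =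
    m%:R * (u j * (1 - u j)).
  transitivity (\sum_(l < m) (u j * (1 - u j))); last by rewrite sumr_const card_ord mulr_natl.
  apply: eq_bigr => l _; under eq_bigr do rewrite mulr_sumr.
  rewrite exchange_big /=; under eq_bigr do rewrite coin_cov.
  by rewrite (bigD1 l) //= eqxx mul1r big1 ?addr0 // => i /negbTE; rewrite eq_sym => ->; rewrite mul0r.
have -> : m%:R ^- 2 * (m%:R * (u j * (1 - u j))) = m%:R^-1 * (u j * (1 - u j)).
  by field.
rewrite ler_piMr ?invr_ge0 //.
by have /andP[? ?] := u01 j; nra.
Qed.

End BernsteinCoins.

Section TrigPolynomials.
Variables (R : realType) (n : nat).
Implicit Types (f g : 'cV[R]_n -> R).

(** Arbitrary phases put sines into the class and, through product-to-sum formulas, make it closed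
    under products. The inductive form lets a linear functional be treated generator by
    generator. *)
Inductive trigpoly : ('cV[R]_n -> R) -> Prop :=
| Trig_cos (t : 'I_n -> R) b : trigpoly (fun x => cos (\sum_i t i * x i 0 + b))
| Trig_add f g : trigpoly f -> trigpoly g -> trigpoly (fun x => f x + g x)
| Trig_scale c f : trigpoly f -> trigpoly (fun x => c * f x).

Lemma trigpoly_cst c : trigpoly (fun=> c).
Proof.
have := Trig_scale c (Trig_cos (fun=> 0) 0); congr trigpoly; apply/funext => x.
by rewrite big1 ?addr0 ?cos0 ?mulr1 // => i _; rewrite mul0r.
Qed.

Lemma trigpoly_mul f g : trigpoly f -> trigpoly g -> trigpoly (fun x => f x * g x).
Proof.
elim=> [t b|f1 f2 _ IH1 _ IH2|c f1 _ IH] tg.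
- elim: tg => [t' b'|g1 g2 _ IH1 _ IH2|c g1 _ IH].
  + have h1 := Trig_cos (fun i => t i + t' i) (b + b').
    have h2 := Trig_cos (fun i => t i - t' i) (b - b').
    have := Trig_scale 2^-1 (Trig_add h1 h2); congr trigpoly; apply/funext => x.
    have -> : \sum_i (t i + t' i) * x i 0 + (b + b') =
      (\sum_i t i * x i 0 + b) + (\sum_i t' i * x i 0 + b').
      by rewrite addrACA -big_split /=; under eq_bigr do rewrite mulrDl.
    have -> : \sum_i (t i - t' i) * x i 0 + (b - b') =
      (\sum_i t i * x i 0 + b) - (\sum_i t' i * x i 0 + b').
      by rewrite opprD addrACA -sumrB; under eq_bigr do rewrite mulrBl.
    by rewrite cosD cosB; field.
  + by have := Trig_add IH1 IH2; congr trigpoly; apply/funext => x; rewrite mulrDr.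
  + by have := Trig_scale c IH; congr trigpoly; apply/funext => x; rewrite mulrCA.
- by have := Trig_add (IH1 tg) (IH2 tg); congr trigpoly; apply/funext => x; rewrite mulrDl.
- by have := Trig_scale c (IH tg); congr trigpoly; apply/funext => x; rewrite mulrA.
Qed.

Lemma trigpoly_sum (I : Type) (r : seq I) (F : I -> 'cV[R]_n -> R) :
  (forall i, trigpoly (F i)) -> trigpoly (fun x => \sum_(i <- r) F i x).
Proof.
move=> tF; elim: r => [|i r IH].
  by under eq_fun do rewrite big_nil; exact: trigpoly_cst.
by under eq_fun do rewrite big_cons; exact: Trig_add.
Qed.

Lemma trigpoly_prod (I : Type) (r : seq I) (F : I -> 'cV[R]_n -> R) :
  (forall i, trigpoly (F i)) -> trigpoly (fun x => \prod_(i <- r) F i x).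
Proof.
move=> tF; elim: r => [|i r IH].
  by under eq_fun do rewrite big_nil; exact: trigpoly_cst.
by under eq_fun do rewrite big_cons; exact: trigpoly_mul.
Qed.

Lemma trigpoly_sin c j : trigpoly (fun x => sin (c * x j 0)).
Proof.
have := Trig_cos (fun i => (i == j)%:R * c) (- (pi / 2)); congr trigpoly; apply/funext => x.
rewrite cosBpihalf (bigD1 j) //= eqxx mul1r big1 ?addr0 // => i /negbTE ->.
by rewrite !mul0r.
Qed.

Lemma trigpoly_bounded f : trigpoly f -> exists B, forall x, `|f x| <= B.
Proof.
elim=> [t b|f1 f2 _ [B1 h1] _ [B2 h2]|c f1 _ [B h]].
- by exists 1 => x; exact: cos_max.
- by exists (B1 + B2) => x; rewrite (le_trans (ler_normD _ _)) // lerD.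
- by exists (`|c| * B) => x; rewrite normrM ler_wpM2l.
Qed.

End TrigPolynomials.

Section TrigDensity.
Variables (R : realType) (n : nat).
Implicit Types (f : 'cV[R]_n -> R) (x y : 'cV[R]_n).

Lemma cvg_colP (T : Type) (F : set_system T) {FF : Filter F} (h : T -> 'cV[R]_n) (l : 'cV[R]_n) :
  (forall j, h z j 0 @[z --> F] --> l j 0) -> h @ F --> l.
Proof.
move=> hl; apply/cvg_ballP => e e0.
have : \forall z \near F, forall j, ball (l j 0) e (h z j 0).
  by apply: filter_forall => j; move/cvg_ballP: (hl j); exact.
by apply: filterS => z hz; split => // i k; rewrite ord1.
Qed.

Lemma compact_cube (r : R) : compact [set x : 'cV[R]_n | forall j, `|x j 0| <= r].
Proof.
have := @rV_compact R n (fun=> `[- r, r]%classic) (fun=> @segment_compact _ _ _).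
set K := [set v | _] => cK.
have -> : [set x : 'cV[R]_n | forall j, `|x j 0| <= r] = [set v^T | v in K].
  apply/seteqP; split => [x /= xr|x /= [v Kv <-] j].
    exists x^T; last by rewrite trmxK.
    by move=> j /=; rewrite mxE in_itv /= -ler_norml; exact: xr.
  by rewrite mxE ler_norml; have := Kv j; rewrite /= in_itv.
apply: continuous_compact => //; apply: continuous_subspaceT => v.
apply: (@cvg_colP _ (nbhs v) (nbhs_filter v) trmx v^T) => j; rewrite mxE.
rewrite (_ : (fun z : 'rV[R]_n => z^T j 0) = (fun z => z 0 j)).
  exact: coord_continuous.
by apply/funext => z; rewrite mxE.
Qed.

(** The coordinates y_j = (1 + sin (x_j / L)) / 2 map the cube injectively into the unit cube, with
    inverse [xi]. The Bernstein polynomial of [f \o xi], evaluated at y, is a trigonometric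
    polynomial in x because its coin weights are products of y_j and 1 - y_j. Being an average of
    values of [f], it keeps the bound [B] on the whole space, not only on the cube. *)
Lemma trigpoly_approx_cube f (B r e : R) : continuous f -> (forall x, `|f x| <= B) ->
  0 < r -> 0 < e ->
  exists p, [/\ trigpoly p, forall x, `|p x| <= B &
    forall x, (forall j, `|x j 0| <= r) -> `|f x - p x| <= e].
Proof.
move=> cf fB r0 e0.
have B0 : 0 <= B by apply: le_trans (fB 0).
(* With L = 2 r the angles x_j / L stay within 1 / 2 < pi / 2, inside the range where asin inverts
   sin and is continuous at the image. *)
pose L := 2 * r; have L0 : 0 < L by rewrite mulr_gt0.
pose xi (y : 'cV[R]_n) : 'cV[R]_n := \col_j (L * asin (2 * y j 0 - 1)).
pose up x : 'cV[R]_n := \col_j ((1 + sin (L^-1 * x j 0)) / 2).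
have upE x j : up x j 0 = (1 + sin (L^-1 * x j 0)) / 2 by rewrite mxE.
have up01 x j : 0 <= up x j 0 <= 1.
  rewrite upE; have := sin_le1 (L^-1 * x j 0); have := sin_geN1 (L^-1 * x j 0) => ? ?.
  by apply/andP; split; lra.
have th x j : `|x j 0| <= r -> - (pi / 2) < L^-1 * x j 0 < pi / 2.
  move=> xr; rewrite -ltr_norml; apply: lt_le_trans (pihalf_ge1 R).
  rewrite normrM gtr0_norm ?invr_gt0 // mulrC ltr_pdivrMr // mul1r /L; lra.
have xi_up x : (forall j, `|x j 0| <= r) -> xi (up x) = x.
  move=> xr; apply/colP => j; rewrite /xi mxE upE.
  have -> : 2 * ((1 + sin (L^-1 * x j 0)) / 2) - 1 = sin (L^-1 * x j 0) by field.
  have /andP[? ?] := th x j (xr j).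
  by rewrite sinK ?in_itv /= ?ltW // mulrA mulfV ?mul1r // gt_eqF.
have cxi x : (forall j, `|x j 0| <= r) -> xi y @[y --> up x] --> x.
  move=> xr; rewrite -{2}(xi_up x xr).
  apply: (@cvg_colP _ (nbhs (up x)) (nbhs_filter _) xi) => j; rewrite mxE.
  rewrite (_ : (fun z => xi z j 0) = (fun z : 'cV[R]_n => L * asin (2 * z j 0 - 1))); last first.
    by apply/funext => z; rewrite mxE.
  apply: cvgMr => //.
  have casin : {for (2 * up x j 0 - 1), continuous (@asin R)}.
    apply: continuous_asin; rewrite upE.
    have -> : 2 * ((1 + sin (L^-1 * x j 0)) / 2) - 1 = sin (L^-1 * x j 0) by field.
    have := cos_gt0_pihalf (th x j (xr j)); have := cos2Dsin2 (L^-1 * x j 0) => h c0.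
    by apply/andP; split; nra.
  apply: (@cvg_comp _ _ _ (fun z : 'cV[R]_n => 2 * z j 0 - 1) (@asin R)); last exact: casin.
  apply: cvgB; last exact: cvg_cst.
  by apply: cvgMr; exact: coord_continuous.
have cup x : up x' @[x' --> x] --> up x.
  apply: (@cvg_colP _ (nbhs x) (nbhs_filter _) up) => j; rewrite mxE.
  rewrite (_ : (fun z => up z j 0) = (fun z : 'cV[R]_n => (1 + sin (L^-1 * z j 0)) / 2)); last first.
    by apply/funext => z; rewrite mxE.
  apply: cvgMl; apply: cvgD; first exact: cvg_cst.
  apply: (@cvg_comp _ _ _ (fun z : 'cV[R]_n => L^-1 * z j 0) (@sin R)); last exact: continuous_sin.
  by apply: cvgMr; exact: coord_continuous.
(* The modulus [d] is uniform over x in the cube, while y is arbitrary: the coin means need not lie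
   in the image of the cube. *)
have [d d0 unif] : exists2 d, 0 < d & forall x, (forall j, `|x j 0| <= r) ->
    forall y, (forall j, `|y j 0 - up x j 0| < d) -> `|f (xi y) - f x| < e / 2.
  have /compact_near_coveringP cov := @compact_cube r.
  have : \forall d \near (0 : R)^'+, [set x : 'cV[R]_n | forall j, `|x j 0| <= r] `<=`
    [set x | forall y, (forall j, `|y j 0 - up x j 0| < d) -> `|f (xi y) - f x| < e / 2].
    apply: cov => x xr.
    have e4 : 0 < e / 4 by rewrite divr_gt0.
    have : \forall y \near up x, `|f x - f (xi y)| < e / 4.
      have : f (xi y) @[y --> up x] --> f x.
        by apply: (@cvg_comp _ _ _ xi f); [exact: cxi|exact: cf].
      by move/cvgrPdist_lt; exact.
    move=> /nbhs_ballP[eta /= eta0 near_up].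
    have eta2 : 0 < eta / 2 by rewrite divr_gt0.
    near=> x' dd => y ydd.
    have h1 : `|f x - f (xi y)| < e / 4.
      apply: near_up; split => // i j; rewrite (ord1 j) /ball /=.
      have h : ball (up x) (eta / 2) (up x').
        by near: x'; move/cvg_ballP: (cup x); exact.
      case: h => _ /(_ i 0); rewrite /ball /= => h.
      have h3 : dd < eta / 2 by near: dd; exact: nbhs_right_lt.
      apply: (le_lt_trans (ler_distD (up x' i 0) _ _)).
      rewrite (splitr eta) ltrD //; last by rewrite distrC (lt_trans (ydd i)).
    have h2 : `|f x - f x'| < e / 4 by near: x'; move/cvgrPdist_lt: (cf x); exact.
    have := ler_distD (f x) (f (xi y)) (f x'); rewrite (distrC (f (xi y)) (f x)); lra.
  by move/(filterI (nbhs_right_gt (0 : R))) => /filter_ex [d [d0 hd]]; exists d.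
have [m m0 me] : exists2 m : nat, (0 < m)%N & 2 * B * n%:R / d ^+ 2 <= e / 2 * m%:R.
  pose c := 2 * B * n%:R / d ^+ 2 / (e / 2).
  have c0 : 0 <= c by rewrite !divr_ge0 ?mulr_ge0 ?sqr_ge0 // ltW.
  exists (Num.bound c).
    by rewrite -(ltr0n R) (le_lt_trans c0) // archi_boundP.
  rewrite [leRHS]mulrC -ler_pdivrMr ?divr_gt0 // ltW //; exact: archi_boundP.
pose p x := \sum_(w : {ffun 'I_n * 'I_m -> bool})
  coin_weight (fun j => up x j 0) w * f (xi (\col_j coin_mean R w j)).
have W0 x w : 0 <= coin_weight (fun j => up x j 0) w :> R by exact: coin_weight_ge0.
have W1 x : \sum_(w : {ffun 'I_n * 'I_m -> bool}) coin_weight (fun j => up x j 0) w = 1 :> R.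
  exact: coin_weight_sum.
exists p; split.
- apply: trigpoly_sum => w.
  have -> : (fun x => coin_weight (fun j => up x j 0) w * f (xi (\col_j coin_mean R w j)))
    = (fun x => f (xi (\col_j coin_mean R w j)) * coin_weight (fun j => up x j 0) w).
    by apply/funext => x; rewrite mulrC.
  apply: Trig_scale; apply: trigpoly_prod => a.
  have tup : trigpoly (fun x => up x a.1 0).
    have := Trig_scale 2^-1 (Trig_add (trigpoly_cst _ 1) (trigpoly_sin L^-1 a.1)).
    by congr trigpoly; apply/funext => x; rewrite upE mulrC.
  case: (w a) => //.
  have := Trig_add (trigpoly_cst _ 1) (Trig_scale (-1) tup).
  by congr trigpoly; apply/funext => x; rewrite mulN1r.
- move=> x; apply: (le_trans (ler_norm_sum _ _ _)).
  rewrite -[B]mul1r -(W1 x) mulr_suml; apply: ler_sum => w _.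
  by rewrite normrM ger0_norm // ler_wpM2l.
move=> x xr.
have -> : f x - p x = \sum_(w : {ffun 'I_n * 'I_m -> bool})
    coin_weight (fun j => up x j 0) w * (f x - f (xi (\col_j coin_mean R w j))).
  by under eq_bigr do rewrite mulrBr; rewrite sumrB -mulr_suml W1 mul1r.
apply: (le_trans (ler_norm_sum _ _ _)).
apply: (@le_trans _ _ (\sum_(w : {ffun 'I_n * 'I_m -> bool})
    coin_weight (fun j => up x j 0) w *
    (e / 2 + 2 * B / d ^+ 2 * \sum_j (coin_mean R w j - up x j 0) ^+ 2))).
  apply: ler_sum => w _; rewrite normrM ger0_norm // ler_wpM2l //.
  have d20 : 0 < d ^+ 2 by rewrite exprn_gt0.
  have S0 : 0 <= \sum_j (coin_mean R w j - up x j 0) ^+ 2.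
    by apply: sumr_ge0 => j _; exact: sqr_ge0.
  (* Chebyshev's argument: if some coin mean deviates by at least d, the sum of squared deviations
     divided by d^2 is at least 1 and pays for the trivial bound 2 B. *)
  have [close|/existsNP [j /negP far]] :=
      pselect (forall j, `|coin_mean R w j - up x j 0| < d).
    rewrite distrC (le_trans (ltW (unif x xr _ _))) //.
      by move=> j; rewrite mxE.
    by rewrite lerDl mulr_ge0 // divr_ge0 ?mulr_ge0 // ltW.
  rewrite -leNgt in far.
  apply: (le_trans (ler_normB _ _)); apply: (@le_trans _ _ (2 * B)).
    by have := fB x; have := fB (xi (\col_j coin_mean R w j)); lra.
  apply: (@le_trans _ _ (2 * B / d ^+ 2 * \sum_j (coin_mean R w j - up x j 0) ^+ 2)); last first.
    by rewrite lerDr ltW // divr_gt0.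
  rewrite mulrAC ler_pdivlMr // ler_wpM2l ?mulr_ge0 //.
  rewrite (bigD1 j) //= -[leLHS]addr0 lerD //; last by apply: sumr_ge0 => i _; exact: sqr_ge0.
  by rewrite -[leRHS]real_normK ?num_real // ler_pXn2r ?nnegrE // ltW.
under eq_bigr do rewrite mulrDr.
rewrite big_split /= -mulr_suml W1 mul1r [leRHS](_ : e = e / 2 + e / 2); last by field.
rewrite lerD2l.
under eq_bigr do rewrite mulrCA mulr_sumr.
rewrite -mulr_sumr exchange_big /=.
apply: (@le_trans _ _ (2 * B / d ^+ 2 * \sum_(j < n) m%:R^-1)).
  rewrite ler_wpM2l ?divr_ge0 ?sqr_ge0 ?mulr_ge0 //; apply: ler_sum => j _.
  exact: (coin_variance (up01 x)).
rewrite sumr_const card_ord -(mulr_natl m%:R^-1) mulrA ler_pdivrMr ?ltr0n //.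
by rewrite mulrAC.
Unshelve. all: end_near.
Qed.

End TrigDensity.

(** * Convergence of expectations from convergence of cosines *)

Section Levy.
Variables (R : realType) (n : nat).
Implicit Types (f g p : 'cV[R]_n -> R) (x y : 'cV[R]_n) (k C M e : R).

Lemma continuous_add f g : continuous f -> continuous g -> continuous (fun x => f x + g x).
Proof. by move=> cf cg x; apply: continuousD; [exact: cf|exact: cg]. Qed.

Lemma continuous_mul f g : continuous f -> continuous g -> continuous (fun x => f x * g x).
Proof. by move=> cf cg x; exact: (cvgM (cf x) (cg x)). Qed.

Lemma continuous_const (c : R) : continuous (fun _ : 'cV[R]_n => c).
Proof. exact: cst_continuous. Qed.

Lemma continuous_comp_real (h : R -> R) f : continuous h -> continuous f ->
  continuous (fun x => h (f x)).
Proof. by move=> ch cf x; apply: continuous_comp; [exact: cf|exact: ch]. Qed.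

Lemma continuous_sum (I : Type) (r : seq I) (F : I -> 'cV[R]_n -> R) :
  (forall i, continuous (F i)) -> continuous (fun x => \sum_(i <- r) F i x).
Proof.
move=> cF; elim: r => [|i r IH].
  by under eq_fun do rewrite big_nil; exact: continuous_const.
by under eq_fun do rewrite big_cons; exact: continuous_add.
Qed.

Definition sqnorm m (x : 'cV[R]_m) : R := \sum_i x i 0 ^+ 2.

Lemma expR_ge1 (y : R) : 0 <= y -> 1 <= expR y.
Proof. by move=> y0; rewrite -expR0 ler_expR. Qed.

Lemma sqnorm_ge0 x : 0 <= sqnorm x.
Proof. by apply: sumr_ge0 => i _; exact: sqr_ge0. Qed.

Lemma sqnorm_coord x j : x j 0 ^+ 2 <= sqnorm x.
Proof.
by rewrite /sqnorm (bigD1 j) //= lerDl; apply: sumr_ge0 => i _; exact: sqr_ge0.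
Qed.

(** Truncation at the level [B] that [f] cannot exceed on the ball |x|^2 <= rho leaves [f] unchanged
    there, and the truncated function is approximated on a cube containing the ball. Outside the
    ball both [f] and the approximant are at most M exp (k1 |x|^2), which the larger rate [k] makes
    negligible. *)
Lemma trigpoly_dense f k1 k M : continuous f -> 0 <= k1 < k ->
  (forall x, `|f x| <= M * expR (k1 * sqnorm x)) -> forall e, 0 < e ->
  exists2 p, trigpoly p & forall x, `|f x - p x| <= e * expR (k * sqnorm x).
Proof.
move=> cf /andP[k10 k1k] fM e e0.
have M0 : 0 <= M.
  by have := le_trans (normr_ge0 _) (fM 0); rewrite pmulr_lge0 ?expR_gt0.
(* Chosen so that 2 M <= e (k - k1) rho, which e^y >= 1 + y turns into the estimate outside the
   ball; the summand 1 keeps [rho] positive when M = 0. *)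
pose rho := 2 * M / e / (k - k1) + 1.
have rho0 : 0 < rho by rewrite ltr_wpDl // !divr_ge0 ?mulr_ge0 ?subr_ge0 // ltW.
have rhoE : 2 * M <= e * ((k - k1) * rho).
  have -> : e * ((k - k1) * rho) = 2 * M + e * (k - k1).
    by rewrite /rho; field; rewrite !gt_eqF // subr_gt0.
  by rewrite lerDl mulr_ge0 ?subr_ge0 // ltW.
pose B := M * expR (k1 * rho).
have B0 : 0 <= B by rewrite mulr_ge0 ?expR_ge0.
(* the truncation of [f] to [-B, B] *)
pose g x := (`|f x + B| - `|f x - B|) / 2.
have cg : continuous g.
  have cnorm : continuous (fun y : R => `|y|) by exact: norm_continuous.
  apply: continuous_mul; last exact: continuous_const.
  apply: continuous_add; first apply: (continuous_comp_real cnorm).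
    by apply: continuous_add => //; exact: continuous_const.
  have copp : continuous (fun y : R => - y) by move=> y; exact: opp_continuous.
  apply: (continuous_comp_real copp).
  apply: (continuous_comp_real cnorm).
  by apply: continuous_add => //; exact: continuous_const.
have gB x : `|g x| <= B.
  rewrite /g ler_norml; have := ler_normB (f x + B) (f x - B).
  have := ler_distD (f x - B) (f x + B) 0; have := ler_distD (f x + B) (f x - B) 0.
  rewrite !subr0; have -> : f x + B - (f x - B) = 2 * B by ring.
  have -> : f x - B - (f x + B) = - (2 * B) by ring.
  have n2 : `|2 * B| = 2 * B by rewrite ger0_norm ?mulr_ge0.
  rewrite (normrN (2 * B)) n2 => h1 h2 _.
  by apply/andP; split; lra.
have gf x : `|f x| <= B -> g x = f x.
  rewrite ler_norml => /andP[h1 h2]; rewrite /g ger0_norm ?ler0_norm; lra.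
have [|p [tp pB pf]] := trigpoly_approx_cube cg gB _ e0 (r := Num.sqrt rho).
  by rewrite sqrtr_gt0.
exists p => // x; have [xr|xr] := leP (sqnorm x) rho.
  have -> : f x = g x.
    by rewrite gf // (le_trans (fM x)) // ler_wpM2l // ler_expR ler_wpM2l.
  apply: (@le_trans _ _ e).
    apply: pf => j; rewrite -sqrtr_sqr ler_sqrt ?(ltW rho0) //.
    exact: le_trans (sqnorm_coord x j) xr.
  rewrite ler_peMr ?(ltW e0) // expR_ge1 // mulr_ge0 ?sqnorm_ge0 //; lra.
apply: (le_trans (ler_normB _ _)).
apply: (@le_trans _ _ (2 * M * expR (k1 * sqnorm x))).
  have : B <= M * expR (k1 * sqnorm x).
    by rewrite ler_wpM2l // ler_expR ler_wpM2l // ltW.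
  by have := pB x; have := fM x; lra.
have -> : k * sqnorm x = k1 * sqnorm x + (k - k1) * sqnorm x by ring.
rewrite expRD mulrCA [leLHS]mulrC ler_wpM2l ?expR_ge0 //.
apply: (le_trans rhoE); rewrite ler_wpM2l ?(ltW e0) //.
apply: le_trans (expR_ge1Dx _); rewrite ler_wpDl // ler_wpM2l ?subr_ge0 ?(ltW k1k) //.
exact: ltW.
Qed.

Definition growth k f : Prop :=
  continuous f /\ exists M, forall x, `|f x| <= M * expR (k * sqnorm x).

(* The properties of an expectation [f |-> E (f W)] with
   [E (expR (k * sqnorm W)) <= C] that weak convergence needs. *)
Definition expectation_like k C (I : ('cV[R]_n -> R) -> R) : Prop :=
  [/\ forall f g, growth k f -> growth k g -> I (fun x => f x + g x) = I f + I g,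
      forall c f, growth k f -> I (fun x => c * f x) = c * I f &
      forall f e, growth k f -> (forall x, `|f x| <= e * expR (k * sqnorm x)) -> `|I f| <= e * C].

Lemma trigpoly_continuous p : trigpoly p -> continuous p.
Proof.
elim=> [t b|f g _ cf _ cg|c f _ cf].
- apply: (continuous_comp_real (@continuous_cos R)).
  apply: continuous_add; last exact: continuous_const.
  apply: continuous_sum => i; apply: continuous_mul; first exact: continuous_const.
  exact: coord_continuous.
- exact: continuous_add.
- by apply: continuous_mul => //; exact: continuous_const.
Qed.

Lemma trigpoly_growth k p : 0 <= k -> trigpoly p -> growth k p.
Proof.
move=> k0 tp; split; first exact: trigpoly_continuous.
have [B pB] := trigpoly_bounded tp; exists B => x; apply: (le_trans (pB x)).
by rewrite ler_peMr ?(le_trans _ (pB 0)) // expR_ge1 // mulr_ge0 ?sqnorm_ge0.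
Qed.

Lemma growthW k1 k f : k1 <= k -> growth k1 f -> growth k f.
Proof.
move=> kk [cf [M fM]]; split=> //; exists M => x; apply: (le_trans (fM x)).
rewrite ler_wpM2l ?ler_expR ?ler_wpM2r ?sqnorm_ge0 //.
by have := le_trans (normr_ge0 _) (fM 0); rewrite pmulr_lge0 ?expR_gt0.
Qed.

Lemma growthB k f g : growth k f -> growth k g -> growth k (fun x => f x + -1 * g x).
Proof.
move=> [cf [M fM]] [cg [N gN]]; split.
  apply: continuous_add => //; apply: continuous_mul => //; exact: continuous_const.
exists (M + N) => x; rewrite mulN1r mulrDl (le_trans (ler_normB _ _)) // lerD //.
Qed.

Lemma growthN k f : growth k f -> growth k (fun x => -1 * f x).
Proof.
move=> [cf [M fM]]; split; first by apply: continuous_mul => //; exact: continuous_const.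
by exists M => x; rewrite mulN1r normrN.
Qed.

Lemma expectation_likeB k C I f g e : expectation_like k C I ->
  growth k f -> growth k g -> (forall x, `|f x - g x| <= e * expR (k * sqnorm x)) ->
  `|I f - I g| <= e * C.
Proof.
move=> [ID IZ Ib] gf gg h.
have -> : I f - I g = I (fun x => f x + -1 * g x).
  by rewrite ID ?IZ ?mulN1r //; exact: growthN.
by apply: Ib; [exact: growthB|move=> x; rewrite mulN1r].
Qed.

(** Levy continuity with an exponential moment in place of tightness. Linearity passes from cosines
    to trigonometric polynomials. Density in the weight exp (k |x|^2) then reaches [f] by a
    three-term estimate, since every functional, and the limit too, integrates the weight to at most
    [C]. *)
Lemma expectation_like_cvg k C (I_ : nat -> ('cV[R]_n -> R) -> R) I k1 f :
  (\forall N \near \oo, expectation_like k C (I_ N)) -> expectation_like k C I ->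
  (forall t b, I_ N (fun x => cos (\sum_i t i * x i 0 + b)) @[N --> \oo] -->
     I (fun x => cos (\sum_i t i * x i 0 + b))) ->
  0 <= k1 < k -> growth k1 f -> I_ N f @[N --> \oo] --> I f.
Proof.
move=> EI_ EI Icos k1k gf; have k0 : 0 <= k by case/andP: k1k => *; lra.
have Itrig p : trigpoly p -> I_ N p @[N --> \oo] --> I p.
  elim=> [t b|f1 f2 t1 IH1 t2 IH2|c f1 t1 IH]; first exact: Icos.
  - have [ID _ _] := EI; rewrite ID; try exact: trigpoly_growth.
    apply: cvg_trans (cvgD IH1 IH2); apply: near_eq_cvg.
    by apply: filterS EI_ => N [IDN _ _]; rewrite IDN //; exact: trigpoly_growth.
  - have [_ IZ _] := EI; rewrite IZ; try exact: trigpoly_growth.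
    apply: cvg_trans (cvgM (cvg_cst c) IH); apply: near_eq_cvg.
    by apply: filterS EI_ => N [_ IZN _]; rewrite IZN //; exact: trigpoly_growth.
have C0 : 0 <= C.
  have [_ _ /(_ (fun=> 0) 1)] := EI; rewrite mul1r => h.
  apply: le_trans (h _ _) => //.
    by split; [exact: cst_continuous|exists 0 => x; rewrite normr0 mul0r].
  by move=> x; rewrite normr0 mul1r expR_ge0.
apply/cvgrPdist_le => e e0.
(* Makes e' C at most e / 3 without dividing by a possibly zero [C]. *)
pose e' := e / (3 * (C + 1)).
have e'0 : 0 < e' by rewrite divr_gt0 ?mulr_gt0 //; lra.
have e'C : e' * C <= e / 3.
  have C1 : 0 < C + 1 by lra.
  have -> : e' * C = e / 3 * (C / (C + 1)) by rewrite /e'; field; rewrite gt_eqF.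
  by rewrite ler_piMr ?divr_ge0 ?(ltW e0) // ler_pdivrMr //; lra.
have [cf [M fM]] := gf.
have [p tp pf] := trigpoly_dense cf k1k fM e'0.
have gp := trigpoly_growth k0 tp.
have gf' : growth k f by apply: growthW gf; case/andP: k1k => _ /ltW.
have h1 := expectation_likeB EI gf' gp pf.
have /cvgrPdist_le /(_ (e / 3)) := Itrig p tp.
move=> /(_ (divr_gt0 e0 (ltr0n _ 3))); apply: filterS2 EI_ => N EN h2.
have h3 := expectation_likeB EN gf' gp pf.
apply: (le_trans (ler_distD (I p) _ _)).
have := ler_distD (I_ N p) (I p) (I_ N f).
rewrite [`|I_ N p - _|]distrC; lra.
Qed.

End Levy.

Section Expectations.
Variables (R : realType) (n : nat).
Implicit Types (f g p : 'cV[R]_n -> R) (k C M e : R).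

Lemma finite_expectation_like (Om : finType) (wt : Om -> R) (V : Om -> 'cV[R]_n) k C :
  (forall w, 0 <= wt w) -> \sum_w wt w * expR (k * sqnorm (V w)) <= C ->
  expectation_like k C (fun f => \sum_w wt w * f (V w)).
Proof.
move=> wt0 wtC; split=> [f g _ _|c f _|f e _ fe].
- by rewrite -big_split /=; apply: eq_bigr => w _; rewrite mulrDr.
- by rewrite mulr_sumr; apply: eq_bigr => w _; rewrite mulrCA.
have e0 : 0 <= e.
  by have := le_trans (normr_ge0 _) (fe 0); rewrite pmulr_lge0 ?expR_gt0.
apply: (le_trans (ler_norm_sum _ _ _)).
apply: (@le_trans _ _ (e * \sum_w wt w * expR (k * sqnorm (V w)))); last exact: ler_wpM2l.
rewrite mulr_sumr; apply: ler_sum => w _.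
by rewrite normrM ger0_norm // mulrCA ler_wpM2l.
Qed.

Context d (T : measurableType d) (P : probability T R) (W : T -> 'cV[R]_n).
Hypothesis mW : forall j, measurable_fun setT (fun w => W w j 0).

Lemma measurable_trigpoly_comp p : trigpoly p -> measurable_fun setT (p \o W).
Proof.
elim=> [t b|f g _ mf _ mg|c f _ mf].
- apply: (@measurableT_comp _ _ _ _ _ _ (@cos R)).
    by apply: continuous_measurable_fun; exact: continuous_cos.
  apply: measurable_funD => //; apply: measurable_sum => i.
  by apply: measurable_funM => //.
- exact: measurable_funD.
- exact: measurable_funM.
Qed.

(** Only the coordinates of [W] are known to be measurable. That suffices for trigonometric
    polynomials of [W], and [f \o W] is a pointwise limit of those. Replacing [k] by its maximum
    with 0 meets the sign condition of [trigpoly_dense]. *)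
Lemma measurable_growth_comp k f : growth k f -> measurable_fun setT (f \o W).
Proof.
move=> gf; have {gf} : growth (Num.max k 0) f by apply: growthW gf; rewrite le_max lexx.
set k' := Num.max k 0; have k'0 : 0 <= k' by rewrite le_max lexx orbT.
move=> [cf [M fM]].
have kk : 0 <= k' < k' + 1 by rewrite k'0 /= ltrDl.
have dense (m : nat) : exists p, trigpoly p /\
    forall x, `|f x - p x| <= m.+1%:R^-1 * expR ((k' + 1) * sqnorm x).
  have [|p tp pf] := trigpoly_dense cf kk fM (e := m.+1%:R^-1); first by rewrite invr_gt0.
  by exists p.
have [p pP] := choice dense.
apply: (@measurable_fun_cvg _ _ _ setT (fun m => p m \o W)).
  by move=> m; apply: measurable_trigpoly_comp; case: (pP m).
move=> w _; apply/cvgrPdist_le => e e0; near=> m.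
have [_ /(_ (W w)) h] := pP m; apply: (le_trans h).
set E := expR _; have E0 : 0 < E by exact: expR_gt0.
rewrite mulrC ler_pdivrMr // mulrC -ler_pdivrMr //.
have /le_trans : E / e <= m%:R by near: m; exact: nbhs_infty_ger.
by apply; rewrite ler_nat.
Unshelve. all: end_near.
Qed.

Variables (k C : R).
Hypothesis
  EW : (\int[P]_w (expR (k * sqnorm (W w)))%:E <= C%:E)%E.

Let iexp : P.-integrable setT (fun w => (expR (k * sqnorm (W w)))%:E).
Proof.
apply/integrableP; split.
  apply/measurable_EFinP; apply: measurableT_comp => //; apply: measurable_funM => //.
  apply: measurable_sum => i; exact: measurable_funX.
under eq_integral do rewrite gee0_abs ?lee_fin ?expR_ge0 //.
exact: le_lt_trans EW (ltry _).
Qed.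

Lemma growth_integrable f : growth k f -> P.-integrable setT (EFin \o (f \o W)).
Proof.
move=> gf; have [_ [M fM]] := gf.
apply: le_integrable (integrableZl measurableT M iexp) => //.
  by apply/measurable_EFinP; exact: measurable_growth_comp gf.
move=> w _; rewrite /= lee_fin (le_trans (fM _)) // ler_norm //.
Qed.

Lemma integral_expectation_like :
  expectation_like k C (fun f => \int[P]_(w in setT) f (W w)).
Proof.
split=> [f g gf gg|c f gf|f e gf fe].
- by rewrite -RintegralD //; exact: growth_integrable.
- by rewrite -RintegralZl //; exact: growth_integrable.
apply: (le_trans (le_normr_Rintegral _ _)) => //; first exact: growth_integrable.
have ife := integrableZl measurableT e iexp.
have iabs := integrable_abse (growth_integrable gf).
rewrite -lee_fin /Rintegral fineK; last exact: (integrable_fin_num measurableT).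
apply: (@le_trans _ _ (\int[P]_w (e%:E * (expR (k * sqnorm (W w)))%:E)))%E.
  apply: ge0_le_integral => //.
  - exact: measurable_int iabs.
  - exact: measurable_int ife.
  - by move=> w _; rewrite -EFinM lee_fin.
have e0 : 0 <= e.
  by have := le_trans (normr_ge0 _) (fe 0); rewrite pmulr_lge0 ?expR_gt0.
by rewrite integralZl // EFinM lee_wpmul2l ?lee_fin.
Qed.

End Expectations.

(** * Laws on the line are determined by their cosine integrals *)

Section LawUniqueness.
Variable R : realType.
Notation TR := (measurableTypeR R).

(** The clamp of t to [0, 1], written with absolute values so that continuity is immediate; ramp (m
    (x - y)) tends to the indicator of y < x. *)
Let ramp (t : R) : R := (`|t| - `|t - 1| + 1) / 2.

Let ramp_le0 t : t <= 0 -> ramp t = 0.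
Proof. by move=> t0; rewrite /ramp !ler0_norm; lra. Qed.

Let ramp_ge1 t : 1 <= t -> ramp t = 1.
Proof. by move=> t0; rewrite /ramp !ger0_norm; lra. Qed.

Let ramp_abs t : `|ramp t| <= 1.
Proof.
rewrite ler_norml /ramp; have := ler_norm t; have := ler_norm (t - 1).
have := ler_norm (- t); have := ler_norm (1 - t); rewrite normrN (distrC 1 t).
have := ler_distD (t - 1) t 0; have := ler_distD t (t - 1) 0; rewrite !subr0.
have -> : t - (t - 1) = 1 by ring. have -> : t - 1 - t = - 1 by ring.
by rewrite normrN normr1 => *; apply/andP; split; lra.
Qed.

Let ramp_cont : continuous ramp.
Proof.
move=> t; apply: cvgM; last exact: cvg_cst.
apply: cvgD; last exact: cvg_cst.
apply: cvgB; first exact: norm_continuous.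
apply: (@continuous_comp _ _ _ (fun t : R => t - 1) (fun t : R => `|t|)); last exact: norm_continuous.
by apply: cvgB; [exact: cvg_id|exact: cvg_cst].
Qed.

(** Equality on bounded continuous functions is the convergence statement [expectation_like_cvg]
    applied to a constant sequence, with the line viewed as column vectors of size 1. Ramps then
    give open half-lines, which are stable under intersection and generate the Borel sets. *)
Lemma probability_eq_of_cos (m1 m2 : probability TR R) k C : 0 < k ->
  (\int[m1]_x (expR (k * x ^+ 2))%:E <= C%:E)%E ->
  (\int[m2]_x (expR (k * x ^+ 2))%:E <= C%:E)%E ->
  (forall a b, (\int[m1]_x (cos (a * x + b))%:E = \int[m2]_x (cos (a * x + b))%:E)%E) ->
  forall B, measurable B -> m1 B = m2 B.
Proof.
move=> k0 h1 h2 hcos.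
pose W (x : TR) : 'cV[R]_1 := \col_(i < 1) x.
have mW j : measurable_fun setT (fun x => W x j 0).
  rewrite (_ : (fun x => W x j 0) = id); first exact: measurable_id.
  by apply/funext => x; rewrite mxE.
have sqW x : sqnorm (W x) = x ^+ 2 by rewrite /sqnorm big_ord1 mxE.
have EW1 : (\int[m1]_x (expR (k * sqnorm (W x)))%:E <= C%:E)%E.
  by under eq_integral do rewrite sqW.
have EW2 : (\int[m2]_x (expR (k * sqnorm (W x)))%:E <= C%:E)%E.
  by under eq_integral do rewrite sqW.
have E1 := integral_expectation_like mW EW1; have E2 := integral_expectation_like mW EW2.
have eqf f : growth 0 f -> \int[m1]_(x in setT) f (W x) = \int[m2]_(x in setT) f (W x).
  move=> gf; apply: (@cvg_unique _ _ ((fun=> \int[m1]_(x in setT) f (W x)) @ \oo)) => //.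
    exact: cvg_cst.
  apply: (expectation_like_cvg (I_ := fun=> (fun f => \int[m1]_(x in setT) f (W x))) _ E2 _ _ gf).
  - exact: nearW.
  - move=> t b; apply: cvg_near_cst; apply: nearW => _; rewrite /Rintegral.
    have ce (mu : probability TR R) : (\int[mu]_x (cos (\sum_i t i * W x i 0 + b))%:E =
        \int[mu]_x (cos (t 0 * x + b))%:E)%E.
      by apply: eq_integral => x _; rewrite big_ord1 mxE.
    by rewrite !ce hcos.
  - by rewrite lexx.
have Iy (x : R) : m1 `]-oo, x[%classic = m2 `]-oo, x[%classic.
  pose f (m : nat) (z : 'cV[R]_1) := ramp (m%:R * (x - z 0 0)).
  have gfm m : growth 0 (f m).
    split; last by exists 1 => z; rewrite mul0r expR0 mulr1 ramp_abs.
    apply: continuous_comp_real => //; apply: continuous_mul; first exact: continuous_const.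
    apply: continuous_add; first exact: continuous_const.
    apply: (@continuous_comp_real _ _ (fun y : R => - y)); last exact: coord_continuous.
    by move=> y; exact: opp_continuous.
  have lim (mu : probability TR R) :
      (\int[mu]_y (f m (W y))%:E)%E @[m --> \oo] --> mu `]-oo, x[%classic.
    have -> : mu `]-oo, x[%classic = (\int[mu]_y (\1_(`]-oo, x[%classic) y)%:E)%E.
      by rewrite integral_indic // setIT.
    have [||||| _ _ //] := @dominated_convergence _ _ _ mu setT measurableT
      (fun m y => (f m (W y))%:E) (fun y => (\1_(`]-oo, x[%classic) y)%:E) (cst 1%E).
    - move=> m; apply/measurable_EFinP; exact: (measurable_growth_comp mW (gfm m)).
    - by apply/measurable_EFinP; exact: measurable_indic.
    - apply: aeW => y _; rewrite /f mxE indicE.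
      have [yx|xy] := ltP y x.
        rewrite mem_set /=; last by rewrite in_itv.
        apply: cvg_near_cst; near=> m; congr EFin; apply: ramp_ge1.
        rewrite -ler_pdivrMr ?subr_gt0 //; near: m; exact: nbhs_infty_ger.
      rewrite memNset /=; last by rewrite in_itv /= => /(le_lt_trans xy); rewrite ltxx.
      apply: cvg_near_cst; apply: nearW => m; congr EFin; apply: ramp_le0.
      by rewrite mulr_ge0_le0 // subr_le0.
    - exact: (finite_measure_integrable_cst mu 1 measurableT).
    - apply: aeW => y m _; rewrite /= lee_fin; exact: ramp_abs.
  have e m : (\int[m1]_y (f m (W y))%:E = \int[m2]_y (f m (W y))%:E)%E.
    have := eqf _ (gfm m); rewrite /Rintegral => /(congr1 (@EFin R)).
    have gkm : growth k (f m) by apply: growthW (gfm m); exact: ltW.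
    rewrite !fineK //.
    - exact: (integrable_fin_num measurableT (growth_integrable mW EW2 gkm)).
    - exact: (integrable_fin_num measurableT (growth_integrable mW EW1 gkm)).
  have lim1 := lim m1; have lim2 := lim m2.
  rewrite (_ : (fun m => _) = (fun m => \int[m2]_y (f m (W y))%:E)%E) in lim1.
    exact: (cvg_unique _ lim1 lim2).
  by apply/funext => m; exact: e.
move=> B mB.
have U := @g_sigma_algebra_measure_unique _ R TR (@RGenInftyO.G R).
apply: (U _ (fun m : nat => `]-oo, (m%:R : R)[%classic) _ _ m1 m2).
- by move=> A [x ->]; exact: measurable_itv.
- by move=> i; exists i%:R.
- rewrite -subTset => x _; exists (Num.bound `|x : R|) => //=.
  by rewrite in_itv /= (le_lt_trans (ler_norm _)) // archi_boundP.
- move=> A1 A2 [x ->] [y ->]; exists (Num.min x y).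
  by apply/seteqP; split => z /=; rewrite !in_itv /= lt_min => /andP.
- by move=> A [x ->]; exact: Iy.
- by move=> i; rewrite (le_lt_trans (probability_le1 _ _)) ?ltry //; exact: measurable_itv.
- by move: mB; rewrite [X in X B -> _]RGenInftyO.measurableE.
Unshelve. all: end_near.
Qed.

End LawUniqueness.

(** * Diagonalization of the covariance *)

Section SpectralCalculus.
Variables (R : realType) (n : nat) (Om : 'M[R]_n).
Hypotheses (OT : Om^T = Om) (OO : Om *m Om = 1%:M).
Implicit Types (a b : 'I_n -> R).

(** As [Om] is a symmetric involution, it is its own inverse, and this is the symmetric matrix with
    eigenvalue [a i] on the i-th column of [Om]. Sums, products and inverses become operations on
    the scalars [a i]. *)
Definition spec a : 'M[R]_n := Om *m diag_mx (\row_i a i) *m Om.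

Lemma spec_mul a b : spec a *m spec b = spec (fun i => a i * b i).
Proof.
rewrite /spec !mulmxA -[Om *m _ *m Om *m Om]mulmxA OO mulmx1; congr (_ *m Om).
by rewrite -mulmxA mulmx_diag; congr (_ *m diag_mx _); apply/rowP => i; rewrite !mxE.
Qed.

Lemma spec_add a b : spec a + spec b = spec (fun i => a i + b i).
Proof.
rewrite /spec -mulmxDl -mulmxDr; congr (_ *m _ *m _).
by apply/matrixP => i j; rewrite !mxE mulrnDl.
Qed.

Lemma spec_scale c a : c *: spec a = spec (fun i => c * a i).
Proof.
rewrite /spec scalemxAl scalemxAr; congr (_ *m _ *m _).
by apply/matrixP => i j; rewrite !mxE mulrnAr.
Qed.

Lemma spec_cst c : spec (fun=> c) = c%:M.
Proof.
rewrite /spec (_ : diag_mx _ = c%:M); first by rewrite mul_mx_scalar -scalemxAl OO scalemx1.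
by apply/matrixP => i j; rewrite !mxE.
Qed.

Lemma spec_tr a : (spec a)^T = spec a.
Proof. by rewrite /spec !trmx_mul tr_diag_mx OT mulmxA. Qed.

Lemma spec_inv a : (forall i, a i != 0) -> invmx (spec a) = spec (fun i => (a i)^-1).
Proof.
move=> a0; have aV : spec a *m spec (fun i => (a i)^-1) = 1%:M.
  rewrite spec_mul -(spec_cst 1); congr spec; apply/funext => i; exact: mulfV.
have [ua _] := mulmx1_unit aV.
by rewrite -[RHS](mulKmx ua) aV mulmx1.
Qed.

Lemma spec_det a i : a i = 0 -> \det (spec a) = 0.
Proof.
move=> ai; rewrite /spec !det_mulmx det_diag (bigD1 i) //= mxE ai.
by rewrite mul0r mulr0 mul0r.
Qed.

Lemma spec_qform a (t : 'cV[R]_n) : qform (spec a) t = \sum_i a i * ((Om *m t) i 0) ^+ 2.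
Proof.
rewrite /qform /spec; set x := Om *m t.
have -> : t^T *m (Om *m diag_mx (\row_i a i) *m Om) *m t = x^T *m (diag_mx (\row_i a i) *m x).
  by rewrite /x trmx_mul OT !mulmxA.
by rewrite mxE; apply: eq_bigr => i _; rewrite mul_diag_mx !mxE mulrCA expr2.
Qed.

Lemma spec_sqnorm (t : 'cV[R]_n) : sqnorm (Om *m t) = sqnorm t.
Proof.
have -> : sqnorm (Om *m t) = qform (spec (fun=> 1)) t.
  by rewrite spec_qform; apply: eq_bigr => i _; rewrite mul1r.
rewrite spec_cst /qform mulmx1 mxE; apply: eq_bigr => i _.
by rewrite mxE expr2.
Qed.

Lemma spec_mul_sqnorm a (x : 'cV[R]_n) :
  sqnorm (spec a *m x) = \sum_i (a i * (Om *m x) i 0) ^+ 2.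
Proof.
rewrite /spec -!mulmxA spec_sqnorm; apply: eq_bigr => i _.
by rewrite mul_diag_mx mxE [X in X * _]mxE.
Qed.

End SpectralCalculus.

Section Householder.
Variable R : realType.

(* The reflection exchanging the all-ones vector and [sqrt d * e_0]. *)
Definition householder_vec d : 'cV[R]_d.+1 :=
  \col_i (1 - Num.sqrt d.+1%:R * (i == 0)%:R).

(** The scalar is 2 / |v|^2. For d = 0 the vector vanishes, and the convention that 0 has inverse 0
    yields the identity, which is still the required map. *)
Definition householder d : 'M[R]_d.+1 :=
  1%:M - (d.+1%:R - Num.sqrt d.+1%:R)^-1 *: (householder_vec d *m (householder_vec d)^T).

Let sqrtE d : Num.sqrt (d.+1%:R : R) ^+ 2 = d.+1%:R.
Proof. by rewrite sqr_sqrtr. Qed.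

Lemma householder_tr d : (householder d)^T = householder d.
Proof. by rewrite /householder linearB linearZ /= trmx_mul trmxK trmx1. Qed.

Let vv d : (householder_vec d)^T *m householder_vec d =
  (2 * (d.+1%:R - Num.sqrt d.+1%:R))%:M.
Proof.
rewrite [LHS]mx11_scalar; congr (_%:M); rewrite mxE.
under eq_bigr do rewrite !mxE.
rewrite big_ord_recl /=.
under eq_bigr do rewrite mulr0 subr0 mulr1.
rewrite sumr_const card_ord mulr1.
have := sqrtE d; rewrite -natr1; move: (Num.sqrt (d%:R + 1)) => r.
by move: (d%:R : R) => x; nra.
Qed.

Let v1 d : (householder_vec d)^T *m const_mx 1 = (d.+1%:R - Num.sqrt d.+1%:R)%:M :> 'M[R]_1.
Proof.
rewrite [LHS]mx11_scalar; congr (_%:M); rewrite mxE.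
under eq_bigr do rewrite !mxE mulr1.
rewrite big_ord_recl /=.
under eq_bigr do rewrite mulr0 subr0.
by rewrite sumr_const card_ord mulr1 -natr1; ring.
Qed.

Lemma householder_mul d : householder d *m householder d = 1%:M.
Proof.
rewrite /householder; set v := householder_vec d; set g := d.+1%:R - Num.sqrt d.+1%:R.
have vvv : (v *m v^T) *m (v *m v^T) = (2 * g) *: (v *m v^T).
  by rewrite mulmxA -(mulmxA v) vv mul_mx_scalar -scalemxAl.
have -> : (1%:M - g^-1 *: (v *m v^T)) *m (1%:M - g^-1 *: (v *m v^T)) =
    1%:M - (2 * g^-1 - g^-1 * g^-1 * (2 * g)) *: (v *m v^T).
  rewrite mulmxBl mul1mx mulmxBr mulmx1 -scalemxAl -scalemxAr vvv.
  by apply/matrixP => i j; rewrite !mxE; ring.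
have -> : 2 * g^-1 - g^-1 * g^-1 * (2 * g) = 0.
  have [->|g0] := eqVneq g 0; first by rewrite invr0; ring.
  by field.
by rewrite scale0r subr0.
Qed.

Lemma householder_const d : householder d *m const_mx 1 =
  Num.sqrt d.+1%:R *: (delta_mx 0 0 : 'cV[R]_d.+1).
Proof.
rewrite /householder mulmxBl mul1mx -scalemxAl -mulmxA v1 mul_mx_scalar scalerA.
set g := d.+1%:R - Num.sqrt d.+1%:R; apply/matrixP => i j; rewrite !mxE !ord1 eqxx andbT.
have [g0|g0] := eqVneq g 0; last by rewrite mulVf // mul1r; ring.
rewrite g0 mulr0 mul0r subr0.
have r1 : Num.sqrt d.+1%:R = 1 :> R.
  apply: (@mulfI _ (Num.sqrt d.+1%:R)); first by rewrite sqrtr_eq0 -ltNge ltr0n.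
  by rewrite mulr1 -expr2 sqrtE; apply/eqP; rewrite -subr_eq0; apply/eqP.
have d0 : d = 0%N.
  by have := sqrtE d; rewrite r1 expr1n => /eqP; rewrite eq_sym (eqr_nat _ _ 1) => /eqP [].
by subst d; rewrite r1 (ord1 i) mul1r.
Qed.

Lemma const_mx_spec d :
  const_mx 1 = spec (householder d) (fun i => d.+1%:R * (i == 0)%:R).
Proof.
set H := householder d; pose u : 'cV[R]_d.+1 := const_mx 1.
have -> : const_mx 1 = u *m u^T.
  by apply/matrixP => i j; rewrite !mxE big_ord1 !mxE mulr1.
have uE : u = H *m (Num.sqrt d.+1%:R *: delta_mx 0 0).
  by rewrite -householder_const mulmxA householder_mul mul1mx.
rewrite uE trmx_mul householder_tr /spec mulmxA -(mulmxA H); congr (_ *m _ *m _).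
apply/matrixP => i j; rewrite !mxE big_ord1 !mxE !eqxx !andbT.
rewrite mulrACA -expr2 sqrtE.
have [->|ij] := eqVneq i j; first by case: (j == 0); rewrite ?mulr1 ?mulr0 ?mulr1n.
rewrite mulr0n; have [i0|i0] := eqVneq i 0; last by rewrite mul0r mulr0.
by rewrite -i0 eq_sym (negbTE ij) !mulr0.
Qed.

End Householder.

(** * Spectrum of the interaction and of the color covariance *)

Section PottsSpectrum.
Variables (R : realType) (s q : nat) (alpha beta : R).
Hypotheses (halpha : 0 < alpha) (hbeta : alpha < beta).
Local Notation S := s.+1.
Local Notation Q := q.+1.
Local Notation A := (interaction S alpha beta).

Definition eigenbasis : 'M[R]_(S * Q) := householder R s *t householder R q.
Local Notation Om := eigenbasis.

Lemma eigenbasis_tr : Om^T = Om.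
Proof. by rewrite /eigenbasis trmx_tens !householder_tr. Qed.

Lemma tens1mx m n : (1%:M : 'M[R]_m) *t (1%:M : 'M[R]_n) = 1%:M.
Proof.
apply/matrixP => i j; case: (mxtens_indexP i) => k c; case: (mxtens_indexP j) => l e.
rewrite tensmxE !mxE (can_eq (@mxtens_indexK _ _)) xpair_eqE.
by case: (k == l); case: (c == e); rewrite /= ?mulr1 ?mulr0 ?mul0r.
Qed.

Lemma eigenbasis_mul : Om *m Om = 1%:M.
Proof. by rewrite /eigenbasis tensmx_mul !householder_mul tens1mx. Qed.

Lemma tens_spec (a : 'I_S -> R) (b : 'I_Q -> R) :
  spec (householder R s) a *t spec (householder R q) b =
  spec Om (fun i => a (mxtens_unindex i).1 * b (mxtens_unindex i).2).
Proof.
rewrite /spec -!tensmx_mul; congr (_ *m _ *m _).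
apply/matrixP => i j; case: (mxtens_indexP i) => k c; case: (mxtens_indexP j) => l e.
rewrite tensmxE !mxE mxtens_indexK /= (can_eq (@mxtens_indexK _ _)) xpair_eqE.
by case: (k == l); case: (c == e); rewrite /= ?mulr1n ?mulr0n ?mulr0 ?mul0r.
Qed.

Definition block_eig (k : 'I_S) : R := beta - alpha + alpha * (S%:R * (k == 0)%:R).
(** Eigenvalues of the covariance of the indicator vector of one uniform color, the opposite of
    [color_mx]. The index 0 is the all-ones direction, degenerate because the indicators sum to
    1. *)
Definition color_var (c : 'I_Q) : R := Q%:R^-1 * (c != 0)%:R.

Lemma interaction_spec : A = spec (householder R s) block_eig.
Proof.
rewrite /interaction const_mx_spec -(spec_cst (householder_mul R s) 1).
rewrite !spec_scale spec_add; congr spec; apply/funext => k; rewrite /block_eig mulr1; ring.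
Qed.

Lemma color_mx_spec : color_mx R Q = spec (householder R q) (fun c => - color_var c).
Proof.
rewrite /color_mx const_mx_spec -(spec_cst (householder_mul R q) 1).
rewrite -scaleNr !spec_scale spec_add; congr spec; apply/funext => c; rewrite /color_var.
by case: (c == 0) => /=; field.
Qed.

(* The eigenvalues of [- (s^-1 *: calA) *m (1%:M *t color_mx)]. *)
Definition tilt (i : 'I_(S * Q)) : R :=
  block_eig (mxtens_unindex i).1 * color_var (mxtens_unindex i).2 / S%:R.
(** The variance [color_var] of an eigencoordinate after a quadratic tilt of strength [tilt i]. *)
Definition lim_var (i : 'I_(S * Q)) : R :=
  color_var (mxtens_unindex i).2 / (1 - tilt i).

Lemma block_eig_gt0 k : 0 < block_eig k.
Proof. by rewrite ltr_wpDr ?subr_gt0 // !mulr_ge0 // ltW. Qed.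

Lemma calA_spec : calA Q A = spec Om (fun i => block_eig (mxtens_unindex i).1).
Proof.
rewrite /calA interaction_spec -(spec_cst (householder_mul R q) 1) tens_spec.
by congr spec; apply/funext => i; rewrite mulr1.
Qed.

Lemma color_tens_spec : (1%:M : 'M[R]_S) *t color_mx R Q =
  spec Om (fun i => - color_var (mxtens_unindex i).2).
Proof.
rewrite color_mx_spec -(spec_cst (householder_mul R s) 1) tens_spec.
by congr spec; apply/funext => i; rewrite mul1r.
Qed.

(** All factors are diagonal in [eigenbasis]. With e the block eigenvalue and tau the tilt, the
    formula reads (s / e) (1 / (1 - tau) - 1) = (s tau / e) / (1 - tau), and s tau / e is the color
    variance. *)
Lemma limit_cov_spec : (forall i, tilt i < 1) ->
  limit_cov Q A = spec Om lim_var.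
Proof.
move=> t1; have t10 i : 1 - tilt i != 0 by rewrite gt_eqF // subr_gt0.
rewrite /limit_cov color_tens_spec calA_spec spec_scale (spec_mul eigenbasis_mul).
rewrite -(spec_cst eigenbasis_mul 1) spec_add.
rewrite (_ : (fun i => 1 + _) = (fun i => 1 - tilt i)); last first.
  by apply/funext => i; rewrite /tilt; ring.
rewrite (spec_inv eigenbasis_mul t10) (spec_inv eigenbasis_mul); last first.
  by move=> i; rewrite gt_eqF // block_eig_gt0.
rewrite -scaleN1r spec_scale spec_add (spec_mul eigenbasis_mul) spec_scale.
congr spec; apply/funext => i; rewrite /lim_var.
have -> : color_var (mxtens_unindex i).2 = tilt i * S%:R / block_eig (mxtens_unindex i).1.
  by rewrite /tilt; field; rewrite !gt_eqF ?block_eig_gt0.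
have := block_eig_gt0 (mxtens_unindex i).1; move: (block_eig _) => e e0.
by field; rewrite t10 gt_eqF.
Qed.

(** The coordinate (0, 0) has variance zero, reflecting that fluctuations sum to zero over the
    colors of a block. *)
Lemma limit_cov_det : (forall i, tilt i < 1) -> \det (limit_cov Q A) = 0.
Proof.
move=> t1; rewrite limit_cov_spec //; apply: (@spec_det _ _ _ _ (mxtens_index (0, 0))).
by rewrite /lim_var mxtens_indexK /color_var eqxx mulr0 mul0r.
Qed.

Definition top_eig : R := (beta - alpha) / S%:R + alpha.

Lemma block_eig_le k : block_eig k / S%:R <= top_eig.
Proof.
rewrite /block_eig /top_eig mulrDl lerD2l; case: (k == 0) => /=.
  by rewrite mulr1 mulfK // pnatr_eq0.
by rewrite !mulr0 mul0r ltW.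
Qed.

Lemma top_eigE : block_eig 0 / S%:R = top_eig.
Proof. by rewrite /block_eig /top_eig eqxx mulr1 mulrDl mulfK // pnatr_eq0. Qed.

Lemma top_eig_gt0 : 0 < top_eig.
Proof. by rewrite -top_eigE divr_gt0 // block_eig_gt0. Qed.

Lemma tilt_lt1 : top_eig < Q%:R -> forall i, tilt i < 1.
Proof.
move=> bQ i; rewrite /tilt mulrAC; apply: (@le_lt_trans _ _ (top_eig / Q%:R)); last first.
  by rewrite ltr_pdivrMr // mul1r.
apply: ler_pM; rewrite ?block_eig_le //.
- by rewrite divr_ge0 // ltW // block_eig_gt0.
- by rewrite mulr_ge0 ?invr_ge0.
- by rewrite /color_var ler_piMr ?invr_ge0 //; case: (_ != _).
Qed.

Lemma top_eig_le_spectral_norm (gamma : 'rV[R]_S) :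
  Gamma Q gamma = S%:R^-1 *: 1%:M ->
  top_eig <= spectral_norm (sqrt_diag (Gamma Q gamma) *m calA Q A *m sqrt_diag (Gamma Q gamma)).
Proof.
move=> ->; have -> : sqrt_diag (S%:R^-1 *: 1%:M) = Num.sqrt S%:R^-1 *: 1%:M :> 'M[R]_(S * Q).
  apply/matrixP => i j; rewrite !mxE; case: (i == j) => /=; first by rewrite !mulr1.
  by rewrite !mulr0 sqrtr0.
rewrite -scalemxAl mul1mx -scalemxAr mulmx1 scalerA -expr2 sqr_sqrtr ?invr_ge0 //.
rewrite calA_spec spec_scale; set a := (fun i => _).
have aE i : a i = block_eig (mxtens_unindex i).1 / S%:R by rewrite /a mulrC.
have a0 i : 0 <= a i by rewrite aE divr_ge0 // ltW // block_eig_gt0.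
have ab i : a i <= top_eig by rewrite aE block_eig_le.
have b0 : 0 <= top_eig by rewrite ltW // top_eig_gt0.
(* The supremum dominates its elements only for a bounded set, so a bound on the unit sphere comes
   first. The element used is then column (0, 0) of the eigenbasis, a unit eigenvector for
   [top_eig]. *)
apply: ub_le_sup.
  exists top_eig => _ [x /= x1 <-]; rewrite /l2norm -/(sqnorm _).
  have sx1 : sqnorm x = 1.
    by have := x1; rewrite /l2norm => /(congr1 (fun y => y ^+ 2)); rewrite expr1n sqr_sqrtr ?sqnorm_ge0.
  rewrite -[leRHS](ger0_norm b0) -sqrtr_sqr ler_wsqrtr //.
  rewrite (spec_mul_sqnorm eigenbasis_tr eigenbasis_mul) -[leRHS]mulr1 -sx1.
  rewrite -(spec_sqnorm eigenbasis_tr eigenbasis_mul) mulr_sumr; apply: ler_sum => i _.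
  by rewrite exprMn ler_wpM2r ?sqr_ge0 // ler_sqr ?nnegrE.
pose i0 : 'I_(S * Q) := mxtens_index (0, 0).
have sq0 (c : R) : \sum_i (c * (delta_mx i0 0 : 'cV[R]_(S * Q)) i 0) ^+ 2 = c ^+ 2.
  rewrite (bigD1 i0) //= mxE !eqxx mulr1 big1 ?addr0 // => i ne.
  by rewrite mxE (negbTE ne) mulr0 expr0n.
exists (Om *m delta_mx i0 0) => /=.
  rewrite /l2norm -/(sqnorm _) (spec_sqnorm eigenbasis_tr eigenbasis_mul).
  have := sq0 1; rewrite expr1n; under eq_bigr do rewrite mul1r.
  by rewrite /sqnorm => ->; rewrite sqrtr1.
rewrite /l2norm -/(sqnorm _) (spec_mul_sqnorm eigenbasis_tr eigenbasis_mul).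
rewrite mulmxA eigenbasis_mul mul1mx.
rewrite (_ : \sum_i _ = \sum_i (top_eig * (delta_mx i0 0 : 'cV[R]_(S * Q)) i 0) ^+ 2).
  by rewrite sq0 sqrtr_sqr ger0_norm.
apply: eq_bigr => i _; case: (eqVneq i i0) => [->|ne]; last by rewrite !mxE (negbTE ne) !mulr0.
by rewrite aE mxtens_indexK top_eigE.
Qed.

End PottsSpectrum.

(** * The fluctuations under the uniform and the Gibbs measure *)

Section IndependentSpins.
Variables (R : realType) (q N : nat).
Hypothesis q0 : (0 < q)%N.
Implicit Types (F : config q N -> R) (y : 'I_N -> 'I_q -> R).

Definition unif_weight : R := q%:R^-1 ^+ N.
Definition unif_mean F : R := \sum_w unif_weight * F w.

Lemma unif_weight_ge0 : 0 <= unif_weight.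
Proof. by rewrite exprn_ge0 // invr_ge0. Qed.

Lemma unif_mean_cst (a : R) : unif_mean (fun=> a) = a.
Proof.
rewrite /unif_mean -mulr_sumr sumr_const card_ffun !card_ord /unif_weight.
rewrite -[a *+ _]mulr_natl mulrA natrX -exprMn mulVf ?expr1n ?mul1r //.
by rewrite pnatr_eq0 -lt0n.
Qed.

Lemma unif_meanM (a : R) F : unif_mean (fun w => a * F w) = a * unif_mean F.
Proof. by rewrite /unif_mean mulr_sumr; apply: eq_bigr => w _; rewrite mulrCA. Qed.

Lemma unif_meanB F1 F2 : unif_mean (fun w => F1 w - F2 w) = unif_mean F1 - unif_mean F2.
Proof. by rewrite /unif_mean -sumrB; apply: eq_bigr => w _; rewrite mulrBr. Qed.

Lemma unif_mean_le F1 F2 : (forall w, F1 w <= F2 w) -> unif_mean F1 <= unif_mean F2.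
Proof. by move=> F12; apply: ler_sum => w _; rewrite ler_wpM2l // unif_weight_ge0. Qed.

Lemma unif_mean_norm F (a : R) : (forall w, `|F w| <= a) -> `|unif_mean F| <= a.
Proof.
move=> Fa; rewrite -[leRHS]unif_mean_cst; apply: (le_trans (ler_norm_sum _ _ _)).
by apply: ler_sum => w _; rewrite normrM (ger0_norm unif_weight_ge0) ler_wpM2l // unif_weight_ge0.
Qed.

Lemma unif_mean_expR y : unif_mean (fun w => expR (\sum_i y i (w i))) =
  \prod_i (q%:R^-1 * \sum_c expR (y i c)).
Proof.
rewrite big_split /= prodr_const card_ord bigA_distr_bigA /= /unif_mean -mulr_sumr.
by congr (_ * _); apply: eq_bigr => w _; rewrite expR_sum.
Qed.

Definition update (w : config q N) (j : 'I_N) (c : 'I_q) : config q N :=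
  [ffun i => if i == j then c else w i].

(** Exchanging the fresh color with the old spin at [j] is an involution on pairs of a configuration
    and a color, so resampling one spin preserves the uniform law. *)
Lemma unif_mean_resample F (j : 'I_N) :
  unif_mean F = unif_mean (fun w => q%:R^-1 * \sum_c F (update w j c)).
Proof.
rewrite /unif_mean -!mulr_sumr; congr (_ * _).
rewrite pair_bigA /=.
pose h (p : config q N * 'I_q) := (update p.1 j p.2, p.1 j).
have hK : involutive h.
  move=> [w c]; rewrite /h /= ffunE eqxx; congr (_, _); apply/ffunP => i.
  by rewrite !ffunE; case: eqP => // ->.
rewrite (reindex_inj (inv_inj hK)) /=.
rewrite (eq_bigr (fun p : config q N * 'I_q => F p.1)); last first.
  move=> [w c] _ /=; congr F; apply/ffunP => i.
  by rewrite !ffunE; case: eqP => // ->.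
rewrite -(pair_bigA _ (fun w _ => F w)) /=.
under [X in _ * X]eq_bigr do rewrite sumr_const card_ord -mulr_natl.
by rewrite -mulr_sumr mulrA mulVf ?mul1r // pnatr_eq0 -lt0n.
Qed.


(** Four one-sided Taylor bounds, each integrated from the preceding one, starting from cos <= 1. *)
Lemma cos_sin_quad (x : R) : 0 <= x ->
  [/\ `|cos x - (1 - x ^+ 2 / 2)| <= x ^+ 4 / 24 & `|sin x - x| <= x ^+ 3 / 6].
Proof.
move=> x0.
have sin_le (y : R) : 0 <= y -> sin y <= y.
  move=> y0; have : 0 - sin 0 <= y - sin y; last by rewrite sin0; lra.
  apply: (@ger0_derive_le R (fun z => z - sin z) (fun z => 1 - cos z) _ _ y0) => z _.
    by apply: der_eq; [derive|rewrite /=; ring].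
  by rewrite subr_ge0 cos_le1.
have cos_ge (y : R) : 0 <= y -> 1 - y ^+ 2 / 2 <= cos y.
  move=> y0; have : cos 0 + 0 * 0 / 2 <= cos y + y * y / 2; last by rewrite cos0 expr2; lra.
  apply: (@ger0_derive_le R (fun z => cos z + z * z / 2) (fun z => z - sin z) _ _ y0) => z.
    by move=> _; apply: der_eq; [derive|rewrite /=; field].
  by case/andP => z0 _; rewrite subr_ge0 sin_le // ltW.
have sin_ge (y : R) : 0 <= y -> y - y ^+ 3 / 6 <= sin y.
  move=> y0; have : sin 0 - 0 + 0 * 0 * 0 / 6 <= sin y - y + y * y * y / 6; last first.
    by rewrite sin0 !exprS expr0; lra.
  apply: (@ger0_derive_le R (fun z => sin z - z + z * z * z / 6)
    (fun z => cos z - (1 - z ^+ 2 / 2)) _ _ y0) => z.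
    by move=> _; apply: der_eq; [derive|rewrite /=; field].
  by case/andP => z0 _; rewrite subr_ge0 cos_ge // ltW.
have cos_le (y : R) : 0 <= y -> cos y <= 1 - y ^+ 2 / 2 + y ^+ 4 / 24.
  move=> y0; have : 1 - 0 * 0 / 2 + 0 * 0 * 0 * 0 / 24 - cos 0 <=
      1 - y * y / 2 + y * y * y * y / 24 - cos y; last first.
    by rewrite cos0 !exprS expr0; lra.
  apply: (@ger0_derive_le R (fun z => 1 - z * z / 2 + z * z * z * z / 24 - cos z)
    (fun z => sin z - (z - z ^+ 3 / 6)) _ _ y0) => z.
    by move=> _; apply: der_eq; [derive|rewrite /=; field].
  by case/andP => z0 _; rewrite subr_ge0 sin_ge // ltW.
split; rewrite ler_norml; apply/andP; split.
- have := cos_ge x x0; have : 0 <= x ^+ 4 by rewrite exprn_ge0.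
  by lra.
- by have := cos_le x x0; lra.
- by have := sin_ge x x0; lra.
- have := sin_le x x0; have : 0 <= x ^+ 3 by rewrite exprn_ge0.
  by lra.
Qed.

Lemma cos_sin_norm (x t : R) : `|x| <= t -> t <= 1 ->
  [/\ `|cos x - (1 - x ^+ 2 / 2)| <= t ^+ 3 / 24 & `|sin x - x| <= t ^+ 3 / 6].
Proof.
move=> xt t1; have t0 : 0 <= t by apply: le_trans xt.
have [hc hs] := cos_sin_quad (normr_ge0 x).
have t3 : `|x| ^+ 3 <= t ^+ 3 by rewrite lerXn2r ?nnegrE.
have x1 : `|x| ^+ 4 <= t ^+ 3.
  by rewrite exprSr (le_trans _ t3) // ler_piMr ?exprn_ge0 // (le_trans xt).
split.
  have cos_norm : cos `|x| = cos x by have [x0|x0] := ger0P x; rewrite // cosN.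
  move: hc; rewrite cos_norm real_normK ?num_real // => hc; apply: (le_trans hc).
  by rewrite ler_pM2r // invr_gt0.
have -> : `|sin x - x| = `|sin `|x| - `|x| |.
  by have [x0|x0] := ger0P x; rewrite // sinN -opprD normrN.
by apply: (le_trans hs); rewrite ler_pM2r // invr_gt0.
Qed.

Lemma expRN_lin (u : R) : 0 <= u -> `|expR (- u) - (1 - u)| <= u ^+ 2 / 2.
Proof.
move=> u0; have h1 := expR_ge1Dx (- u).
have h2 : expR (- u) <= 1 + - u + (- u) ^+ 2 / 2 by apply: expR_le_quad; rewrite oppr_le0.
by rewrite ler_norml sqrrN in h2 *; apply/andP; split; have := sqr_ge0 u; lra.
Qed.

Definition spin_var (y : 'I_q -> R) : R := q%:R^-1 * \sum_c y c ^+ 2.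

Lemma one_spin_cos (y : 'I_q -> R) (t a : R) : \sum_c y c = 0 ->
  (forall c, `|y c| <= t) -> t <= 1 ->
  `|q%:R^-1 * (\sum_c cos (y c + a)) - cos a * expR (- (spin_var y / 2))| <= t ^+ 3.
Proof.
move=> y0 yt t1; have t0 : 0 <= t by apply: (le_trans (normr_ge0 _) (yt (Ordinal q0))).
have qn0 : q%:R != 0 :> R by rewrite pnatr_eq0 -lt0n.
have avgc (b : R) : q%:R^-1 * (\sum_(c < q) b) = b.
  by rewrite sumr_const card_ord -[b *+ q]mulr_natl mulrA mulVf // mul1r.
have avg (f : 'I_q -> R) (b : R) : (forall c, `|f c| <= b) -> `|q%:R^-1 * \sum_c f c| <= b.
  move=> fb; rewrite -[leRHS]avgc normrM ger0_norm ?invr_ge0 // ler_wpM2l ?invr_ge0 //.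
  by apply: (le_trans (ler_norm_sum _ _ _)); apply: ler_sum.
set v := spin_var y.
have v0 : 0 <= v by rewrite mulr_ge0 ?invr_ge0 // sumr_ge0 // => c _; rewrite sqr_ge0.
have vt : v <= t ^+ 2.
  rewrite -(avgc (t ^+ 2)) ler_wpM2l ?invr_ge0 //; apply: ler_sum => c _.
  by rewrite -real_normK ?num_real // lerXn2r ?nnegrE.
pose r1 := q%:R^-1 * \sum_c (cos (y c) - (1 - y c ^+ 2 / 2)).
pose r2 := q%:R^-1 * \sum_c (sin (y c) - y c).
have r1t : `|r1| <= t ^+ 3 / 24 by apply: avg => c; have [] := cos_sin_norm (yt c) t1.
have r2t : `|r2| <= t ^+ 3 / 6 by apply: avg => c; have [] := cos_sin_norm (yt c) t1.
have r1E : q%:R^-1 * (\sum_c cos (y c)) = r1 + 1 - v / 2.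
  rewrite /r1 sumrB mulrBr sumrB mulrBr avgc -mulr_suml /v /spin_var; ring.
have r2E : q%:R^-1 * (\sum_c sin (y c)) = r2.
  by rewrite /r2 sumrB y0 subr0.
have -> : q%:R^-1 * (\sum_c cos (y c + a)) = cos a * (r1 + 1 - v / 2) - sin a * r2.
  rewrite -r1E -r2E; under eq_bigr do rewrite cosD.
  by rewrite sumrB -!mulr_suml; ring.
have v2 : v ^+ 2 <= t ^+ 3.
  apply: (@le_trans _ _ (t ^+ 2 * t ^+ 2)).
    by rewrite expr2 ler_pM.
  by rewrite (_ : t ^+ 2 * t ^+ 2 = t ^+ 3 * t) ?ler_piMr ?exprn_ge0 //; ring.
clearbody r1 r2.
have := expRN_lin (divr_ge0 v0 (ler0n _ 2)); set e := expR _ => he.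
have -> : cos a * (r1 + 1 - v / 2) - sin a * r2 - cos a * e =
   cos a * (r1 - (e - (1 - v / 2))) - sin a * r2 by ring.
have c1 : `|cos a| <= 1 by rewrite ler_norml cos_geN1 cos_le1.
have s1 : `|sin a| <= 1 by rewrite ler_norml sin_geN1 sin_le1.
apply: (le_trans (ler_normB _ _)); rewrite !normrM.
apply: (@le_trans _ _ (`|r1 - (e - (1 - v / 2))| + `|r2|)).
  by apply: lerD; rewrite ler_piMl.
have := ler_normB r1 (e - (1 - v / 2)).
have : (v / 2) ^+ 2 / 2 <= t ^+ 3 / 8 by rewrite expr_div_n; lra.
have : 0 <= t ^+ 3 by rewrite exprn_ge0.
by lra.
Qed.

(* The spins are replaced one after the other by their Gaussian factor, each
   time averaging over the current spin with [unif_mean_resample]. *)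
Lemma unif_mean_cos y (tau : 'I_N -> R) (b : R) : (forall i, \sum_c y i c = 0) ->
  (forall i c, `|y i c| <= tau i) -> (forall i, tau i <= 1) ->
  `|unif_mean (fun w => cos (\sum_i y i (w i) + b)) -
    cos b * expR (- ((\sum_i spin_var (y i)) / 2))| <= \sum_i tau i ^+ 3.
Proof.
move=> y0 yt t1.
pose D (j : nat) := unif_mean (fun w => cos (\sum_(i < N | (j <= i)%N) y i (w i) + b)) *
   expR (- ((\sum_(i < N | (i < j)%N) spin_var (y i)) / 2)).
have DE0 : D 0%N = unif_mean (fun w => cos (\sum_i y i (w i) + b)).
  by rewrite /D [X in expR (- (X / 2))]big_pred0 // mul0r oppr0 expR0 mulr1.
have DEN : D N = cos b * expR (- ((\sum_i spin_var (y i)) / 2)).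
  rewrite /D; congr (_ * expR (- (_ / 2))).
    rewrite -[RHS]unif_mean_cst; congr unif_mean; apply/funext => w.
    by rewrite big_pred0 ?add0r // => i; rewrite leqNgt ltn_ord.
  by apply: eq_bigl => i; rewrite ltn_ord.
have sv0 i : 0 <= spin_var (y i).
  by rewrite mulr_ge0 ?invr_ge0 // sumr_ge0 // => c _; rewrite sqr_ge0.
have step (j : 'I_N) : `|D j - D j.+1| <= tau j ^+ 3.
  rewrite /D (unif_mean_resample _ j).
  pose a (w : config q N) := \sum_(i < N | (j < i)%N) y i (w i) + b.
  have -> : \sum_(i < N | (i < j.+1)%N) spin_var (y i) =
      spin_var (y j) + \sum_(i < N | (i < j)%N) spin_var (y i).
    rewrite (bigD1 j) //=; congr (_ + _); apply: eq_bigl => i.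
    by rewrite ltnS ltn_neqAle andbC.
  rewrite mulrDl opprD expRD mulrA -mulrBl normrM [X in _ * X]ger0_norm ?expR_ge0 //.
  apply: (@le_trans _ _ (tau j ^+ 3 * 1)); last by rewrite mulr1.
  apply: ler_pM; rewrite ?normr_ge0 ?expR_ge0 //; last first.
    by rewrite -expR0 ler_expR oppr_le0 divr_ge0 // sumr_ge0.
  rewrite [unif_mean _ * expR _]mulrC -unif_meanM -unif_meanB.
  apply: unif_mean_norm => w; rewrite [expR _ * cos _]mulrC.
  rewrite (eq_bigr (fun c => cos (y j c + a w))); last first.
    move=> c _; rewrite (bigD1 j) //= ffunE eqxx -addrA; congr (cos (_ + (_ + _))).
    apply: eq_big => i; first by rewrite ltn_neqAle [RHS]andbC eq_sym.
    by case/andP => _ ij; rewrite ffunE (negbTE ij).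
  exact: one_spin_cos.
rewrite -DE0 -DEN.
rewrite distrC -(@telescope_sumr _ 0 N D) // big_mkord.
apply: (le_trans (ler_norm_sum _ _ _)); apply: ler_sum => j _.
by rewrite distrC.
Qed.

End IndependentSpins.

Lemma sum_mxtens (R : realType) s q (F : 'I_(s * q) -> R) :
  \sum_j F j = \sum_(k < s) \sum_(c < q) F (mxtens_index (k, c)).
Proof.
rewrite pair_bigA /= (reindex (@mxtens_index s q)) /=; last first.
  by exists (@mxtens_unindex s q) => j _; [exact: mxtens_indexK|exact: mxtens_unindexK].
by apply: eq_bigr => -[k c].
Qed.

(** * Linear functionals of the fluctuation as sums over independent spins *)

Section Fluctuation.
Variables (R : realType) (s q N : nat) (S : 'I_s -> {set 'I_N}).
Hypotheses (q2 : (2 <= q)%N) (hS : is_block_partition S).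
Implicit Types (t : 'cV[R]_(s * q)) (w : config q N) (k : 'I_s) (c : 'I_q).

Lemma block_card_gt0 k : (0 < #|S k|)%N.
Proof. by have [i ik] := hS.1 k; apply/card_gt0P; exists i. Qed.

Lemma block_sum (F : 'I_s -> 'I_N -> R) (b : 'I_N -> 'I_s) : (forall i, i \in S (b i)) ->
  \sum_k \sum_(i in S k) F k i = \sum_i F (b i) i.
Proof.
move=> hb; rewrite (exchange_big_dep xpredT) //=; apply: eq_bigr => i _.
have [k [ik uk]] := hS.2 i.
rewrite (big_pred1 (b i)) // => l /=; apply/idP/eqP => [il|->]; last exact: hb.
by rewrite -(uk _ il) -(uk _ (hb i)).
Qed.

Lemma exists_block : exists b : 'I_N -> 'I_s, forall i, i \in S (b i).
Proof.
have /choice[b hb] : forall i, exists k, i \in S k.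
  by move=> i; have [k [ik _]] := hS.2 i; exists k.
by exists b.
Qed.

Lemma block_card_sum : \sum_k #|S k|%:R = N%:R :> R.
Proof.
have [b hb] := exists_block.
under eq_bigr do rewrite -sum1_card natr_sum.
by rewrite (block_sum (fun _ _ => 1%:R) hb) sumr_const card_ord.
Qed.

Let sn k : R := Num.sqrt #|S k|%:R.

Lemma sqrt_card_gt0 k : 0 < sn k.
Proof. by rewrite sqrtr_gt0 ltr0n block_card_gt0. Qed.

Lemma sqr_sqrt_card k : sn k ^+ 2 = #|S k|%:R.
Proof. by rewrite sqr_sqrtr. Qed.

Lemma sqrt_calS : sqrt_diag (calS R q S) = diag_mx (\row_j sn (mxtens_unindex j).1).
Proof.
apply/matrixP => i j; case: (mxtens_indexP i) => k c; case: (mxtens_indexP j) => l e.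
rewrite mxE /calS tensmxE !mxE mxtens_indexK /= (can_eq (@mxtens_indexK _ _)) xpair_eqE.
by case: (k == l); case: (c == e); rewrite /= ?mulr1n ?mulr0n ?mulr0 ?mul0r ?mulr1 ?sqrtr0 //.
Qed.

Lemma fluctuationE w k c : fluctuation R S w (mxtens_index (k, c)) 0 =
  sn k * (#|S k|%:R^-1 * \sum_(i in S k) (w i == c)%:R - q%:R^-1).
Proof.
by rewrite /fluctuation sqrt_calS mul_diag_mx mxE !mxE mxtens_indexK.
Qed.

Lemma fluctuation_color_sum w k : \sum_c fluctuation R S w (mxtens_index (k, c)) 0 = 0.
Proof.
under eq_bigr do rewrite fluctuationE.
rewrite -mulr_sumr sumrB -mulr_sumr exchange_big /=.
rewrite (eq_bigr (fun=> 1)); last first.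
  by move=> i _; rewrite (bigD1 (w i)) //= eqxx big1 ?addr0 // => c /negbTE; rewrite eq_sym => ->.
rewrite !sumr_const card_ord -[q%:R^-1 *+ q]mulr_natl mulVf; last first.
  by rewrite pnatr_eq0 -lt0n block_card_gt0.
by rewrite mulfV ?subrr ?mulr0 // pnatr_eq0 -lt0n ltnW.
Qed.

Definition color_mean t k : R := q%:R^-1 * \sum_c t (mxtens_index (k, c)) 0.
(** Fluctuations have zero color sum in each block, so [t] acts only through this part, and its own
    zero color sum is what the one-spin estimates require. *)
Definition centered t k c : R := t (mxtens_index (k, c)) 0 - color_mean t k.
Definition centered_sq t : R := \sum_k \sum_c centered t k c ^+ 2.

Lemma centered_sum t k : \sum_c centered t k c = 0.
Proof.
rewrite sumrB sumr_const card_ord -[_ *+ q]mulr_natl mulrA mulfV ?mul1r ?subrr //.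
by rewrite pnatr_eq0 -lt0n ltnW.
Qed.

Lemma centered_sq_le t : centered_sq t <= sqnorm t.
Proof.
rewrite /sqnorm sum_mxtens; apply: ler_sum => k _.
have -> : \sum_c t (mxtens_index (k, c)) 0 ^+ 2 =
    \sum_c (centered t k c ^+ 2 + 2 * color_mean t k * centered t k c + color_mean t k ^+ 2).
  by apply: eq_bigr => c _; rewrite /centered; ring.
rewrite !big_split /= -mulr_sumr centered_sum mulr0 addr0 lerDl sumr_ge0 // => c _.
exact: sqr_ge0.
Qed.

Lemma linear_fluctuation t w (b : 'I_N -> 'I_s) : (forall i, i \in S (b i)) ->
  \sum_j t j 0 * fluctuation R S w j 0 = \sum_i centered t (b i) (w i) / sn (b i).
Proof.
move=> hb; rewrite sum_mxtens -(block_sum (fun k i => centered t k (w i) / sn k) hb).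
apply: eq_bigr => k _; have sk := sqrt_card_gt0 k.
have -> : \sum_c t (mxtens_index (k, c)) 0 * fluctuation R S w (mxtens_index (k, c)) 0 =
    \sum_c centered t k c * fluctuation R S w (mxtens_index (k, c)) 0.
  rewrite (eq_bigr (fun c => centered t k c * fluctuation R S w (mxtens_index (k, c)) 0 +
    color_mean t k * fluctuation R S w (mxtens_index (k, c)) 0)); last first.
    by move=> c _; rewrite /centered; ring.
  by rewrite big_split /= -mulr_sumr fluctuation_color_sum mulr0 addr0.
under eq_bigr do rewrite fluctuationE -sqr_sqrt_card.
rewrite (eq_bigr (fun c => (\sum_(i in S k) centered t k c * (w i == c)%:R) / sn k -
   sn k / q%:R * centered t k c)); last first.
  move=> c _; rewrite -mulr_sumr; field.
  by rewrite pnatr_eq0 -lt0n ltnW // (gt_eqF sk).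
rewrite sumrB -mulr_sumr centered_sum mulr0 subr0 -mulr_suml exchange_big /= mulr_suml.
apply: eq_bigr => i _; congr (_ / _).
rewrite (bigD1 (w i)) //= eqxx mulr1 big1 ?addr0 // => c /negbTE.
by rewrite eq_sym => ->; rewrite mulr0.
Qed.

Lemma site_sum (F : 'I_s -> 'I_q -> R) (b : 'I_N -> 'I_s) : (forall i, i \in S (b i)) ->
  \sum_i \sum_c (F (b i) c / sn (b i)) ^+ 2 = \sum_k \sum_c F k c ^+ 2.
Proof.
move=> hb; rewrite -(block_sum (fun k i => \sum_c (F k c / sn k) ^+ 2) hb).
apply: eq_bigr => k _; rewrite sumr_const -[_ *+ _]mulr_natl mulr_sumr.
apply: eq_bigr => c _; rewrite -sqr_sqrt_card; field.
by rewrite gt_eqF // sqrt_card_gt0.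
Qed.

Lemma fluctuation_mgf t :
  unif_mean (fun w => expR (\sum_j t j 0 * fluctuation R S w j 0)) <=
  expR (sqnorm t / (2 * zeta R q)).
Proof.
have [b hb] := exists_block; have z0 := zeta_gt0 R q2.
rewrite (_ : (fun w => _) = (fun w => expR (\sum_i centered t (b i) (w i) / sn (b i)))); last first.
  by apply/funext => w; rewrite (linear_fluctuation _ _ hb).
rewrite (unif_mean_expR (fun i c => centered t (b i) c / sn (b i))).
apply: (@le_trans _ _ (\prod_i expR ((\sum_c (centered t (b i) c / sn (b i)) ^+ 2) / (2 * zeta R q)))).
  apply: ler_prod => i _; apply/andP; split.
    by rewrite mulr_ge0 ?invr_ge0 // sumr_ge0 // => c _; rewrite expR_ge0.
  apply: uniform_mgf_le => //; by rewrite -mulr_suml centered_sum mul0r.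
rewrite -expR_sum ler_expR -mulr_suml (site_sum _ hb).
by rewrite ler_pM2r ?centered_sq_le // invr_gt0 mulr_gt0.
Qed.

(** A spin of block k has coefficients of size at most T / [sn k]. The |S_k| spins of the block
    together cost |S_k| (T / [sn k])^3 = T^3 / [sn k], a Lindeberg-type error that vanishes for
    large blocks. *)
Lemma fluctuation_cos t (T b : R) : (forall k c, `|centered t k c| <= T) ->
  (forall k, T <= sn k) ->
  `|unif_mean (fun w => cos (\sum_j t j 0 * fluctuation R S w j 0 + b)) -
    cos b * expR (- (q%:R^-1 * centered_sq t / 2))| <= T ^+ 3 * \sum_k (sn k)^-1.
Proof.
move=> tT Ts; have [bl hb] := exists_block.
have q0 : (0 < q)%N by apply: ltnW.
rewrite (_ : (fun w => _) = (fun w => cos (\sum_i centered t (bl i) (w i) / sn (bl i) + b))); last first.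
  by apply/funext => w; rewrite (linear_fluctuation _ _ hb).
have -> : q%:R^-1 * centered_sq t = \sum_i spin_var (fun c => centered t (bl i) c / sn (bl i)).
  by rewrite -mulr_sumr (site_sum _ hb).
apply: le_trans (unif_mean_cos q0 (y := fun i c => centered t (bl i) c / sn (bl i))
  (tau := fun i => T / sn (bl i)) b _ _ _) _.
- by move=> i; rewrite -mulr_suml centered_sum mul0r.
- move=> i c; rewrite normrM normfV (gtr0_norm (sqrt_card_gt0 _)).
  by rewrite ler_pM2r // invr_gt0 sqrt_card_gt0.
- by move=> i; rewrite ler_pdivrMr ?sqrt_card_gt0 // mul1r.
rewrite -(block_sum (fun k i => (T / sn k) ^+ 3) hb) mulr_sumr.
apply: ler_sum => k _; rewrite sumr_const -[_ *+ _]mulr_natl -sqr_sqrt_card.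
rewrite le_eqVlt; apply/orP; left; apply/eqP; field.
by rewrite gt_eqF // sqrt_card_gt0.
Qed.

End Fluctuation.

(* Hubbard-Stratonovich: [expR (eta / 2 * |v|^2)] is the mean of
   [expR (sqrt eta * <X, v>)] over a standard Gaussian [X]; exchange the two
   expectations. *)
Lemma subgaussian_sqnorm (R : realType) n (Om : finType) (wt : Om -> R)
    (V : Om -> 'cV[R]_n) (z eta : R) : 0 <= eta -> eta < z -> (forall w, 0 <= wt w) ->
  (forall t : 'cV[R]_n, \sum_w wt w * expR (\sum_j t j 0 * V w j 0) <= expR (sqnorm t / (2 * z))) ->
  \sum_w wt w * expR (eta / 2 * sqnorm (V w)) <= (Num.sqrt (1 - eta / z))^-1 ^+ n.
Proof.
move=> eta0 etaz wt0 Vz; have z0 : 0 < z by apply: le_lt_trans etaz.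
have [d [T [P [X [Xe _]]]]] := gaussian_space R n.
have m1 : eta / z < 1 by rewrite ltr_pdivrMr // mul1r.
pose f w x := expR (\sum_j (Num.sqrt eta * V w j 0 * X j x + 0 * X j x ^+ 2 / 2)).
have fE w : (\int[P]_x (f w x)%:E)%E = (expR (eta / 2 * sqnorm (V w)))%:E.
  rewrite /f (Xe (fun j => Num.sqrt eta * V w j 0) (fun=> 0)) //; congr EFin.
  rewrite /sqnorm mulr_sumr expR_sum; apply: eq_bigr => j _.
  by rewrite subr0 sqrtr1 invr1 mul1r mulr1 exprMn sqr_sqrtr // mulrAC.
have mf w : measurable_fun setT (f w).
  apply: measurableT_comp => //; apply: measurable_sum => j.
  apply: measurable_funD; first exact: measurable_funM.
  by under eq_fun do rewrite !mul0r; exact: measurable_cst.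
rewrite -lee_fin -sumEFin; under eq_bigr do rewrite EFinM -fE.
rewrite (eq_bigr (fun w => \int[P]_x ((wt w)%:E * (f w x)%:E)))%E; last first.
  move=> w _; rewrite ge0_integralZl ?lee_fin //; last first.
    by move=> x _; rewrite lee_fin expR_ge0.
  exact/measurable_EFinP.
rewrite -ge0_integral_sum //; last 2 first.
- move=> w; apply: emeasurable_funM; [exact: measurable_cst|exact/measurable_EFinP].
- by move=> w x _; rewrite -EFinM lee_fin mulr_ge0 ?expR_ge0.
have <- : (\int[P]_x (expR (\sum_j (0 * X j x + eta / z * X j x ^+ 2 / 2)))%:E =
    ((Num.sqrt (1 - eta / z))^-1 ^+ n)%:E)%E.
  rewrite (Xe (fun=> 0) (fun=> eta / z)) //; congr EFin.
  rewrite expr0n mul0r expR0 mulr1 prodr_const card_ord //.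
apply: ge0_le_integral => //.
- move=> x _; apply: sume_ge0 => w _; by rewrite -EFinM lee_fin mulr_ge0 ?expR_ge0.
- apply: emeasurable_sum => w.
  apply: emeasurable_funM; [exact: measurable_cst|exact/measurable_EFinP].
- apply/measurable_EFinP; apply: measurableT_comp => //; apply: measurable_sum => j.
  apply: measurable_funD; first exact: measurable_funM.
  by apply: measurable_funM => //; apply: measurable_funM => //; exact: measurable_funX.
move=> x _; under eq_bigr do rewrite -EFinM.
rewrite sumEFin lee_fin.
have := Vz (\col_j (Num.sqrt eta * X j x)); congr (_ <= _).
  apply: eq_bigr => w _; congr (_ * expR _); apply: eq_bigr => j _.
  by rewrite mxE !mul0r addr0 mulrAC.
congr expR; rewrite /sqnorm mulr_suml; apply: eq_bigr => j _.
by rewrite mxE exprMn sqr_sqrtr // mul0r add0r invfM; field; rewrite gt_eqF.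
Qed.

(** * The quadratic energy and its bounds *)

Section Energy.
Variables (R : realType) (s q : nat).
Implicit Types (a : 'I_s -> 'I_s -> R) (x : 'cV[R]_(s * q)).

Definition energy a x : R :=
  (\sum_k \sum_l a k l * \sum_c x (mxtens_index (k, c)) 0 * x (mxtens_index (l, c)) 0) / 2.

Lemma energy_continuous a : continuous (energy a).
Proof.
apply: continuous_mul; last exact: continuous_const.
apply: continuous_sum => k; apply: continuous_sum => l.
apply: continuous_mul; first exact: continuous_const.
by apply: continuous_sum => c; apply: continuous_mul; exact: coord_continuous.
Qed.

Lemma color_dot_le x k l :
  `|\sum_c x (mxtens_index (k, c)) 0 * x (mxtens_index (l, c)) 0| <= sqnorm x.
Proof.
have h m : \sum_(c < q) x (mxtens_index (m, c)) 0 ^+ 2 <= sqnorm x.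
  rewrite /sqnorm sum_mxtens [leRHS](bigD1 m) //= lerDl.
  by apply: sumr_ge0 => k' _; apply: sumr_ge0 => c _; exact: sqr_ge0.
rewrite -(ler_sqr (x := `|_|)) ?nnegrE ?sqnorm_ge0 // real_normK ?num_real //.
apply: (le_trans (Cauchy_Schwarz_sum _ _ _)).
by rewrite expr2; apply: ler_pM; rewrite ?h // sumr_ge0 // => c _; exact: sqr_ge0.
Qed.

Lemma energy_diff a a' x :
  `|energy a x - energy a' x| <= (\sum_k \sum_l `|a k l - a' k l|) / 2 * sqnorm x.
Proof.
rewrite /energy -mulrBl normrM [X in _ * X]ger0_norm ?invr_ge0 // mulrAC.
rewrite ler_pM2r ?invr_gt0 // -sumrB mulr_suml.
apply: (le_trans (ler_norm_sum _ _ _)); apply: ler_sum => k _.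
rewrite -sumrB mulr_suml; apply: (le_trans (ler_norm_sum _ _ _)); apply: ler_sum => l _.
by rewrite -mulrBl normrM ler_wpM2l // color_dot_le.
Qed.

(** With p_k = sqrt (|S_k| / N) this is the matrix sqrt S A sqrt S / N; with p_k constant equal to
    sqrt (1 / s) it is its limit A / s. *)
Definition coupling (alpha beta : R) (p : 'I_s -> R) k l : R :=
  interaction s alpha beta k l * (p k * p l).

Lemma energy_couplingE alpha beta p x : energy (coupling alpha beta p) x =
  (\sum_c (alpha * (\sum_k p k * x (mxtens_index (k, c)) 0) ^+ 2 +
     (beta - alpha) * \sum_k (p k * x (mxtens_index (k, c)) 0) ^+ 2)) / 2.
Proof.
rewrite /energy; congr (_ / 2).
rewrite (eq_bigr (fun k => \sum_c \sum_l coupling alpha beta p k l *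
   (x (mxtens_index (k, c)) 0 * x (mxtens_index (l, c)) 0))); last first.
  move=> k _; rewrite exchange_big; apply: eq_bigr => l _ /=; exact: mulr_sumr.
rewrite exchange_big; apply: eq_bigr => c _ /=.
rewrite expr2 mulr_suml !mulr_sumr -big_split; apply: eq_bigr => k _ /=.
rewrite mulr_sumr mulr_sumr (bigD1 k) //= [X in _ = X + _](bigD1 k) //= addrAC.
congr (_ + _).
  by rewrite /coupling !mxE eqxx /= mulr1n; ring.
apply: eq_bigr => l /negbTE; rewrite eq_sym => kl.
by rewrite /coupling !mxE kl /= mulr0n; ring.
Qed.

Lemma energy_ge0 alpha beta p x : 0 <= alpha -> alpha <= beta ->
  0 <= energy (coupling alpha beta p) x.
Proof.
move=> a0 ab; rewrite energy_couplingE divr_ge0 // sumr_ge0 // => c _.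
rewrite addr_ge0 // mulr_ge0 ?sqr_ge0 ?subr_ge0 // sumr_ge0 // => k _; exact: sqr_ge0.
Qed.

(** The alpha part is a squared inner product with [p], handled by Cauchy-Schwarz; the diagonal part
    is bounded entrywise. At r = 1 / s the constant is half of [top_eig], so a slightly larger [r]
    covers all large N. *)
Lemma energy_le alpha beta p (r : R) x : 0 <= alpha -> alpha <= beta ->
  \sum_k p k ^+ 2 <= 1 -> (forall k, p k ^+ 2 <= r) ->
  energy (coupling alpha beta p) x <= ((beta - alpha) * r + alpha) / 2 * sqnorm x.
Proof.
move=> a0 ab p1 pr; rewrite energy_couplingE mulrAC ler_pM2r ?invr_gt0 //.
rewrite /sqnorm sum_mxtens exchange_big /= mulr_sumr; apply: ler_sum => c _.
rewrite [leLHS]addrC [leRHS]mulrDl; apply: lerD.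
  rewrite -mulrA ler_wpM2l ?subr_ge0 // mulr_sumr; apply: ler_sum => k _.
  by rewrite exprMn ler_wpM2r ?sqr_ge0.
rewrite ler_wpM2l //; apply: (le_trans (Cauchy_Schwarz_sum _ _ _)).
by rewrite ler_piMl // sumr_ge0 // => k _; exact: sqr_ge0.
Qed.

End Energy.

Section GibbsTilt.
Variables (R : realType) (s q N : nat) (S : 'I_s -> {set 'I_N}) (alpha beta : R).
Hypotheses (q2 : (2 <= q)%N) (hS : is_block_partition S).
Local Notation A := (interaction s alpha beta).

Definition block_ratio k : R := Num.sqrt (#|S k|%:R / N%:R).

Lemma calSE : calS R q S = diag_mx (\row_j #|S (mxtens_unindex j).1|%:R).
Proof.
apply/matrixP => i j; case: (mxtens_indexP i) => k c; case: (mxtens_indexP j) => l e.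
rewrite /calS tensmxE !mxE mxtens_indexK /= (can_eq (@mxtens_indexK _ _)) xpair_eqE.
by case: (k == l); case: (c == e); rewrite /= ?mulr1n ?mulr0n ?mulr0 ?mul0r ?mulr1.
Qed.

Lemma qform_tens1 (M : 'M[R]_s) (x : 'cV[R]_(s * q)) :
  qform (M *t (1%:M : 'M[R]_q)) x =
  \sum_k \sum_l M k l * \sum_c x (mxtens_index (k, c)) 0 * x (mxtens_index (l, c)) 0.
Proof.
rewrite /qform -mulmxA mxE sum_mxtens; apply: eq_bigr => k _.
transitivity (\sum_c \sum_l x (mxtens_index (k, c)) 0 * (M k l * x (mxtens_index (l, c)) 0)).
  apply: eq_bigr => c _; rewrite [_^T _ _]mxE mxE sum_mxtens mulr_sumr; apply: eq_bigr => l _.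
  congr (_ * _); rewrite (bigD1 c) //= tensmxE [_%:M _ _]mxE eqxx mulr1 big1 ?addr0 // => e ne.
  by rewrite tensmxE [_%:M _ _]mxE eq_sym (negbTE ne) mulr0 mul0r.
rewrite exchange_big; apply: eq_bigr => l _; rewrite mulr_sumr; apply: eq_bigr => c _.
by rewrite mulrCA.
Qed.

(** Substitute S m = sqrt S v + S 1 / q, with v the fluctuation. The terms linear in v vanish by the
    zero color sums, and the constant term does not depend on the configuration. *)
Lemma hamiltonianE : exists K : R, forall w : config q N,
  - hamiltonian A S w = K + energy (coupling alpha beta block_ratio) (fluctuation R S w).
Proof.
exists ((2 * N%:R)^-1 * \sum_k \sum_l A k l * (#|S k|%:R * #|S l|%:R / q%:R)) => w.
have calST : (calS R q S)^T = calS R q S by rewrite calSE tr_diag_mx.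
rewrite /hamiltonian mulNr opprK.
have -> : qform (calS R q S *m calA q A *m calS R q S) (magnetization R S w) =
    qform (calA q A) (calS R q S *m magnetization R S w).
  by rewrite /qform trmx_mul calST !mulmxA.
rewrite /calA qform_tens1 /energy mulr_sumr mulr_suml mulr_sumr -big_split.
apply: eq_bigr => k _ /=; rewrite mulr_sumr mulr_suml mulr_sumr -big_split.
apply: eq_bigr => l _ /=.
pose v (k : 'I_s) (c : 'I_q) : R := fluctuation R S w (mxtens_index (k, c)) 0.
pose sn k : R := Num.sqrt #|S k|%:R.
have q0 : q%:R != 0 :> R by rewrite pnatr_eq0 -lt0n ltnW.
have zE m c : (calS R q S *m magnetization R S w) (mxtens_index (m, c)) 0 =
    sn m * v m c + sn m ^+ 2 / q%:R.
  rewrite calSE mul_diag_mx !mxE mxtens_indexK /v fluctuationE -/(sn m) -sqr_sqrt_card -/(sn m).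
  by field; rewrite q0 gt_eqF // sqrt_card_gt0.
under eq_bigr do rewrite !zE.
have -> : \sum_c (sn k * v k c + sn k ^+ 2 / q%:R) * (sn l * v l c + sn l ^+ 2 / q%:R) =
    sn k * sn l * (\sum_c v k c * v l c) + sn k ^+ 2 * sn l ^+ 2 / q%:R.
  have -> : \sum_c (sn k * v k c + sn k ^+ 2 / q%:R) * (sn l * v l c + sn l ^+ 2 / q%:R) =
    \sum_(c < q) (sn k * sn l * (v k c * v l c) + sn k * sn l ^+ 2 / q%:R * v k c
      + sn k ^+ 2 * sn l / q%:R * v l c + q%:R^-1 * (sn k ^+ 2 * sn l ^+ 2 / q%:R)).
    by apply: eq_bigr => c _; field.
  rewrite !big_split /= -!mulr_sumr !(fluctuation_color_sum _ q2 hS) !mulr0 !addr0.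
  by congr (_ + _); rewrite sumr_const card_ord -mulr_natl; field.
rewrite /coupling /block_ratio !sqrtrM // -/(sn k) -/(sn l) !sqrtrV // !sqr_sqrt_card.
have NN : Num.sqrt (N%:R : R) ^+ 2 = N%:R by rewrite sqr_sqrtr.
set V := \sum_c v k c * v l c.
have -> : sn k / Num.sqrt N%:R * (sn l / Num.sqrt N%:R) = sn k * sn l / N%:R.
  by rewrite -[in RHS]NN expr2 invfM; ring.
by rewrite invfM; ring.
Qed.

Lemma gibbs_meanE (g : config q N -> R) : gibbs_mean A S g =
  unif_mean (fun w => g w * expR (energy (coupling alpha beta block_ratio) (fluctuation R S w))) /
  unif_mean (fun w : config q N => expR (energy (coupling alpha beta block_ratio) (fluctuation R S w))).
Proof.
have [K HK] := hamiltonianE; set E := @energy R s q _.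
have u0 : 0 < unif_weight R q N.
  by rewrite exprn_gt0 // invr_gt0 ltr0n ltnW.
have gE w : expR (- hamiltonian A S w) =
    expR K / unif_weight R q N * (unif_weight R q N * expR (E (fluctuation R S w))).
  by rewrite HK expRD mulrA divfK // gt_eqF.
set k := expR K / _ in gE *; set Z := unif_mean (fun w => expR (E _)).
have ZE : \sum_(w : config q N) expR (- hamiltonian A S w) = k * Z.
  by rewrite /Z /unif_mean mulr_sumr; apply: eq_bigr => w _; exact: gE.
have k0 : k != 0 by rewrite gt_eqF ?divr_gt0 ?expR_gt0.
rewrite /gibbs_mean [X in _ = X / _]/unif_mean mulr_suml; apply: eq_bigr => w _.
by rewrite /gibbs ZE gE -mulf_div mulfV // mul1r; ring.
Qed.

Lemma block_ratio_sum : (0 < N)%N -> \sum_k block_ratio k ^+ 2 = 1.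
Proof.
move=> N0; under eq_bigr do rewrite sqr_sqrtr ?divr_ge0 //.
by rewrite -mulr_suml (block_card_sum _ hS) mulfV // pnatr_eq0 -lt0n.
Qed.

End GibbsTilt.

(** * The limit law *)

Section GaussianImage.
Variables (R : realType) (n : nat) (Om : 'M[R]_n).
Hypotheses (OT : Om^T = Om) (OO : Om *m Om = 1%:M).
Context d (T : measurableType d) (P : probability T R) (X : 'I_n -> {RV P >-> R}).
Hypotheses (Xe : tilted_exp_integrals X) (Xc : tilted_cos_integrals X).
Variable v : 'I_n -> R.
Hypothesis v0 : forall i, 0 <= v i.
Implicit Type t : 'cV[R]_n.

(** Used with two variance profiles on the same normals: [color_var] for the limit under the uniform
    measure, [lim_var] for the limit under the Gibbs measures. *)
Definition gauss_image (w : T) : 'cV[R]_n := Om *m \col_i (Num.sqrt (v i) * X i w).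

Lemma gauss_imageK w : Om *m gauss_image w = \col_i (Num.sqrt (v i) * X i w).
Proof. by rewrite mulmxA OO mul1mx. Qed.

Lemma gauss_image_dot t w :
  \sum_j t j 0 * gauss_image w j 0 = \sum_i (Om *m t) i 0 * Num.sqrt (v i) * X i w.
Proof.
transitivity ((t^T *m gauss_image w) 0 0).
  by rewrite mxE; apply: eq_bigr => j _; rewrite [_^T _ _]mxE.
rewrite mulmxA -[in LHS]OT -trmx_mul mxE; apply: eq_bigr => i _.
by rewrite [_^T _ _]mxE [(\col__ _) _ _]mxE mulrA.
Qed.

Lemma gauss_image_sqnorm w : sqnorm (gauss_image w) = \sum_i v i * X i w ^+ 2.
Proof.
rewrite -(spec_sqnorm OT OO) gauss_imageK; apply: eq_bigr => i _.
by rewrite mxE exprMn sqr_sqrtr.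
Qed.

Lemma measurable_gauss_image j : measurable_fun setT (fun w => gauss_image w j 0).
Proof.
rewrite (_ : (fun w => _) = (fun w => \sum_i Om j i * (Num.sqrt (v i) * X i w))); last first.
  by apply/funext => w; rewrite mxE; apply: eq_bigr => i _; rewrite [(\col__ _) _ _]mxE.
apply: measurable_sum => i; apply: measurable_funM => //.
exact: measurable_funM.
Qed.

(** A tilt that is diagonal in the normals replaces the variances v by v / (1 - m), up to a total
    mass independent of [t] and [b]. This turns the uniform limit into the Gibbs limit. *)
Lemma gauss_image_tilted_cos (m : 'I_n -> R) t b : (forall i, m i < 1) ->
  (\int[P]_w (cos (\sum_j t j 0 * gauss_image w j 0 + b) *
     expR (\sum_i m i * X i w ^+ 2 / 2))%:E =
   (\prod_i (Num.sqrt (1 - m i))^-1 *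
     (cos b * expR (- (\sum_i v i / (1 - m i) * (Om *m t) i 0 ^+ 2 / 2))))%:E)%E.
Proof.
move=> m1; under eq_integral do rewrite gauss_image_dot.
rewrite Xc //; congr EFin; rewrite big_split /= mulrCA; congr (_ * (_ * _)).
rewrite -expR_sum; congr expR; rewrite -sumrN; apply: eq_bigr => i _; congr (- _).
rewrite exprMn sqr_sqrtr //; field.
by rewrite gt_eqF // subr_gt0.
Qed.

Lemma gauss_image_cos t b :
  (\int[P]_w (cos (\sum_j t j 0 * gauss_image w j 0 + b))%:E =
   (cos b * expR (- (\sum_i v i * (Om *m t) i 0 ^+ 2 / 2)))%:E)%E.
Proof.
have h := @gauss_image_tilted_cos (fun=> 0) t b (fun=> ltr01).
transitivity (\int[P]_w (cos (\sum_j t j 0 * gauss_image w j 0 + b) *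
    expR (\sum_i 0 * X i w ^+ 2 / 2))%:E)%E.
  apply: eq_integral => w _; rewrite [X in expR X]big1 ?expR0 ?mulr1 // => i _.
  by rewrite !mul0r.
rewrite h subr0 sqrtr1 invr1 big1_eq mul1r; congr (_ * expR (- _))%:E.
by apply: eq_bigr => i _; rewrite mulr1.
Qed.

Lemma gauss_image_exp_sqnorm k : (forall i, 2 * k * v i < 1) ->
  (\int[P]_w (expR (k * sqnorm (gauss_image w)))%:E =
    (\prod_i (Num.sqrt (1 - 2 * k * v i))^-1)%:E)%E.
Proof.
move=> kv; under eq_integral => w _.
  rewrite gauss_image_sqnorm mulr_sumr.
  rewrite (eq_bigr (fun i => 0 * X i w + 2 * k * v i * X i w ^+ 2 / 2)); last by move=> i _; field.
  over.
rewrite (Xe (fun=> 0)) //; congr EFin; apply: eq_bigr => i _.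
by rewrite expr0n mul0r expR0 mulr1.
Qed.

Lemma gauss_image_RV : exists W : 'I_n -> {RV P >-> R}, random_vector W = gauss_image.
Proof.
exists (fun j => projT1 (mfun_of (measurable_gauss_image j))); apply/funext => w.
apply/matrixP => i j; rewrite mxE ord1.
by case: (mfun_of _) => g /= ->.
Qed.

End GaussianImage.

Lemma integral_normal_exp_sq (R : realType) (sigma k : R) : 0 < sigma ->
  2 * k < sigma ^- 2 ->
  (\int[normal_prob 0 sigma]_x (expR (k * x ^+ 2))%:E =
   (sigma^-1 * (Num.sqrt (sigma ^- 2 - 2 * k))^-1)%:E)%E.
Proof.
(* With this [m], the law N(0, sigma^2) is itself a normalized quadratic tilt of N(0, 1), so both
   tilts merge into one. *)
move=> s0 ks; pose m : R := 1 - sigma ^- 2.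
have si0 : 0 < sigma ^- 2 by rewrite invr_gt0 exprn_gt0.
have m1 : m < 1 by rewrite /m; lra.
have rE : Num.sqrt (1 - m) = sigma^-1.
  by rewrite /m opprB addrC subrK -exprVn sqrtr_sqr gtr0_norm // invr_gt0.
have mq l : measurable_fun setT (fun x : measurableTypeR R => (expR (l * x ^+ 2))%:E).
  apply/measurable_EFinP; apply: measurableT_comp => //.
  apply: measurable_funM => //; exact: measurable_funX.
rewrite ge0_integral_normal_prob ?gt_eqF //; last exact: mq.
have km : 2 * k + m < 1 by rewrite /m; lra.
have h := @integral_tilted_normal_expR R 0 _ km.
rewrite (_ : 1 - (2 * k + m) = sigma ^- 2 - 2 * k) in h; last by rewrite /m; ring.
rewrite expr0n mul0r expR0 mulr1 in h.
rewrite EFinM -h ge0_integral_normal_prob ?oner_neq0 //; last first.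
  have := mq (k + m / 2); congr measurable_fun.
  by apply/funext => x; congr (expR _)%:E; field.
rewrite -ge0_integralZl //=; last 3 first.
- apply: emeasurable_funM; last by apply/measurable_EFinP; exact: measurable_normal_pdf.
  have := mq (k + m / 2); congr measurable_fun.
  by apply/funext => x; congr (expR _)%:E; field.
- by move=> x _; rewrite mule_ge0 // lee_fin normal_pdf_ge0.
- by rewrite lee_fin invr_ge0 ltW.
apply: eq_integral => x _; rewrite -!EFinM; congr EFin.
have := normal_pdf_tilt x m1; rewrite rE invrK => e.
have -> : expR (0 * x + (2 * k + m) * x ^+ 2 / 2) = expR (k * x ^+ 2) * expR (m * x ^+ 2 / 2).
  by rewrite -expRD; congr expR; field.
rewrite -[expR (k * _) * _ * _]mulrA e; field; by rewrite gt_eqF.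
Qed.

Section GaussianLaw.
Variables (R : realType) (n : nat) (Om : 'M[R]_n).
Hypotheses (OT : Om^T = Om) (OO : Om *m Om = 1%:M).
Context d (T : measurableType d) (P : probability T R) (X : 'I_n -> {RV P >-> R}).
Hypotheses (Xe : tilted_exp_integrals X) (Xc : tilted_cos_integrals X).
Variable v : 'I_n -> R.
Hypothesis v0 : forall i, 0 <= v i.

(** A linear combination of variance 0 is identically 0, which gives the Dirac case. Otherwise its
    law and the normal law have equal cosine integrals, since scaling the argument amounts to
    scaling [t]. *)
Lemma gauss_image_gaussian (W : 'I_n -> {RV P >-> R}) :
  random_vector W = gauss_image Om X v -> is_centered_gaussian W (spec Om v).
Proof.
move=> WE; split; first exact: spec_tr.
move=> t; rewrite (spec_qform OT); set V := \sum_i _.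
have V0 : 0 <= V by apply: sumr_ge0 => i _; rewrite mulr_ge0 ?sqr_ge0.
split=> // B mB; pose Y w := \sum_j t j 0 * gauss_image Om X v w j 0.
have -> : (fun w => (t^T *m random_vector W w) 0 0) = Y.
  by apply/funext => w; rewrite WE mxE; apply: eq_bigr => j _; rewrite [_^T _ _]mxE.
have YE w : Y w = \sum_i (Om *m t) i 0 * Num.sqrt (v i) * X i w by exact: gauss_image_dot.
rewrite /centered_normal; case: eqVneq => [VE|Vn0].
  have Y0 : Y = cst 0.
    apply/funext => w; rewrite YE big1 // => i _.
    have := @psumr_eq0P _ _ xpredT (fun i => v i * (Om *m t) i 0 ^+ 2).
    move=> /(_ (fun i _ => mulr_ge0 (v0 i) (sqr_ge0 _)) VE i isT) /eqP.
    rewrite mulf_eq0 sqrf_eq0 => /orP[] /eqP ->; last by rewrite !mul0r.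
    by rewrite sqrtr0 mulr0 mul0r.
  rewrite Y0 preimage_cst diracE; case: (0 \in B); by rewrite ?probability_setT ?measure0.
have Vp : 0 < V by rewrite lt_neqAle eq_sym Vn0.
have s0 : 0 < Num.sqrt V by rewrite sqrtr_gt0.
have mY : measurable_fun setT (Y : T -> measurableTypeR R).
  apply: measurable_sum => j; apply: measurable_funM => //.
  exact: measurable_gauss_image.
have [Y' Y'E] := @mfun_of _ _ T (measurableTypeR R) Y mY.
(* Cauchy-Schwarz gives Y^2 <= V |X|^2, so k Y^2 <= |X|^2 / 4, a tilt of strength 1 / 2 < 1; the
   normal law requires 2 k < 1 / V. *)
pose k := (4 * V)^-1; have k0 : 0 < k by rewrite invr_gt0 mulr_gt0.
have m1 (i : 'I_n) : 2^-1 < 1 :> R by lra.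
pose C1 := \prod_(i < n) ((Num.sqrt (1 - 2^-1 : R))^-1 * expR (0 ^+ 2 / (2 * (1 - 2^-1)))).
pose C2 := (Num.sqrt V)^-1 * (Num.sqrt (Num.sqrt V ^- 2 - 2 * k))^-1.
have mq : measurable_fun setT (fun x : measurableTypeR R => (expR (k * x ^+ 2))%:E).
  apply/measurable_EFinP; apply: measurableT_comp => //.
  apply: measurable_funM => //; exact: measurable_funX.
have -> : P (Y @^-1` B) = distribution P Y' B.
  by rewrite -Y'E.
apply: (@probability_eq_of_cos R _ _ k (Num.max C1 C2)) => //.
- rewrite ge0_integral_distribution //.
  apply: (@le_trans _ _ (C1%:E)); last by rewrite lee_fin le_max lexx.
  rewrite -(Xe (fun=> 0) m1); apply: ge0_le_integral => //.
  + by move=> w _; rewrite lee_fin expR_ge0.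
  + by have := measurableT_comp mq mY; rewrite -Y'E.
  + apply/measurable_EFinP; apply: measurableT_comp => //; apply: measurable_sum => j.
    apply: measurable_funD; first exact: measurable_funM.
    by apply: measurable_funM => //; apply: measurable_funM => //; exact: measurable_funX.
  move=> w _; rewrite /= lee_fin ler_expR Y'E YE.
  rewrite [leRHS](eq_bigr (fun i => 4^-1 * X i w ^+ 2)); last by move=> i _; field.
  rewrite -mulr_sumr.
  have := @Cauchy_Schwarz_sum _ _ xpredT (fun i => (Om *m t) i 0 * Num.sqrt (v i)) (fun i => X i w).
  have -> : \sum_i ((Om *m t) i 0 * Num.sqrt (v i)) ^+ 2 = V.
    by apply: eq_bigr => i _; rewrite exprMn sqr_sqrtr // mulrC.
  move=> h; rewrite /k invfM -mulrA ler_pM2l ?invr_gt0 //.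
  by rewrite mulrC ler_pdivrMr // mulrC.
- rewrite integral_normal_exp_sq //; first by rewrite lee_fin le_max lexx orbT.
  by rewrite sqr_sqrtr // /k invfM mulrA -[ltRHS]mul1r ltr_pM2r ?invr_gt0 //
    ltr_pdivrMr // mul1r (ltr_nat R 2 4).
- move=> a b; rewrite integral_normal_cos // sqr_sqrtr //.
  rewrite integral_distribution; last 2 first.
  + by apply/measurable_EFinP; exact: measurable_cos_affine.
  + have := finite_measure_integrable_cst P 1 measurableT; apply: le_integrable => //.
      by apply/measurable_EFinP; apply: (measurableT_comp (measurable_cos_affine a b)); rewrite Y'E.
    by move=> w _; rewrite /= lee_fin normr1 cos_max.
  rewrite (_ : (_ \o _) = fun w => (cos (\sum_j (a *: t) j 0 * gauss_image Om X v w j 0 + b))%:E).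
    rewrite (gauss_image_cos OT Xc v0); congr (_ * expR (- _))%:E.
    rewrite mulr_suml mulr_suml; apply: eq_bigr => i _.
    by rewrite -scalemxAr mxE exprMn; ring.
  apply/funext => w; rewrite /= Y'E /Y mulr_sumr; congr (cos (_ + _))%:E.
  by apply: eq_bigr => j _; rewrite [(a *: t) j 0]mxE mulrA.
Qed.

End GaussianLaw.

Lemma cvg_le_dist (R : realType) (u e : nat -> R) (l : R) :
  (\forall N \near \oo, `|u N - l| <= e N) -> e N @[N --> \oo] --> (0 : R) ->
  u N @[N --> \oo] --> l.
Proof.
move=> ue e0; apply/cvgrPdist_le => d d0; near=> N.
rewrite distrC; apply: (@le_trans _ _ (e N)); first by near: N.
apply: (le_trans (ler_norm _)); rewrite -[X in `|X|]subr0 distrC.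
by near: N; move/cvgrPdist_le: e0; exact.
Unshelve. all: end_near.
Qed.

Lemma cvg_sum0 (R : realType) (I : finType) (F : nat -> I -> R) :
  (forall i, F N i @[N --> \oo] --> (0 : R)) -> \sum_i F N i @[N --> \oo] --> (0 : R).
Proof.
move=> F0; elim: (index_enum I) => [|i r IH].
  by under eq_fun do rewrite big_nil; exact: cvg_cst.
under eq_fun do rewrite big_cons.
have := cvgD (F0 i) IH; rewrite addr0; exact.
Qed.

Lemma expR_lip (R : realType) (x y m : R) : x <= m -> y <= m ->
  `|expR x - expR y| <= `|x - y| * expR m.
Proof.
wlog xy : x y / x <= y => [hw xm ym|xm ym].
  have [h|/ltW h] := leP x y; first exact: hw.
  by rewrite distrC [`|x - y|]distrC; exact: hw.
rewrite distrC [`|x - y|]distrC !ger0_norm ?subr_ge0 ?ler_expR //.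
apply: (@le_trans _ _ ((y - x) * expR y)); last first.
  by rewrite ler_wpM2l ?subr_ge0 ?ler_expR.
have := expR_ge1Dx (x - y); have : expR x = expR y * expR (x - y) by rewrite -expRD addrC subrK.
have := expR_gt0 y; move: (expR x) (expR y) (expR (x - y)) => a b c b0 -> h; nra.
Qed.

Section BlockAsymptotics.
Variables (R : realType) (s : nat) (S : forall N : nat, 'I_s.+1 -> {set 'I_N}).
Hypothesis hcard : forall k, (#|S N k|%:R / N%:R : R) @[N --> \oo] --> (s.+1%:R^-1 : R).

Lemma block_ratio_cvg k :
  block_ratio R (S N) k @[N --> \oo] --> Num.sqrt (s.+1%:R^-1 : R).
Proof. by apply: (cvg_comp _ _ (hcard k)); exact: sqrt_continuous. Qed.

Lemma sqrt_card_cvg k : (Num.sqrt #|S N k|%:R : R) @[N --> \oo] --> +oo.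
Proof.
apply/cvgryPge => M; near=> N.
have N0 : (0 < N)%N by near: N; exact: nbhs_infty_gt.
apply: (@le_trans _ _ (Num.sqrt (`|M| ^+ 2))); first by rewrite sqrtr_sqr normr_id ler_norm.
apply: ler_wsqrtr.
have h : (2 * s.+1%:R)^-1 <= (#|S N k|%:R / N%:R : R).
  near: N; apply: (cvgr_ge _ (hcard k)).
  by rewrite invfM mulrC gtr_pMr ?invr_gt0 // invf_lt1 // ltr1n.
rewrite ler_pdivlMr ?ltr0n // in h; apply: le_trans h.
rewrite mulrC ler_pdivlMr ?mulr_gt0 //.
by near: N; exact: nbhs_infty_ger.
Unshelve. all: end_near.
Qed.

Lemma sum_inv_sqrt_card_cvg :
  \sum_k (Num.sqrt #|S N k|%:R : R)^-1 @[N --> \oo] --> (0 : R).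
Proof.
apply: cvg_sum0 => k; apply/gtr0_cvgV0; last exact: sqrt_card_cvg.
have /cvgryPgt /(_ 0) := @sqrt_card_cvg k; exact.
Qed.

Definition limit_coupling (alpha beta : R) : 'I_s.+1 -> 'I_s.+1 -> R :=
  coupling alpha beta (fun=> Num.sqrt s.+1%:R^-1).

Lemma coupling_cvg alpha beta :
  (\sum_k \sum_l `|coupling alpha beta (block_ratio R (S N)) k l - limit_coupling alpha beta k l|) / 2
    @[N --> \oo] --> (0 : R).
Proof.
suff h : \sum_k \sum_l `|coupling alpha beta (block_ratio R (S N)) k l -
    limit_coupling alpha beta k l| @[N --> \oo] --> (0 : R).
  have := cvgM h (cvg_cst (2^-1 : R)); rewrite mul0r; exact.
apply: cvg_sum0 => k; apply: cvg_sum0 => l.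
rewrite -(normr0 R); apply: cvg_norm.
rewrite -(subrr (limit_coupling alpha beta k l)); apply: cvgB; last exact: cvg_cst.
apply: cvgM; first exact: cvg_cst.
by apply: cvgM; exact: block_ratio_cvg.
Qed.

Lemma block_ratio_near (r : R) : s.+1%:R^-1 < r ->
  \forall N \near \oo, forall k, block_ratio R (S N) k ^+ 2 <= r.
Proof.
move=> sr; apply: filter_forall => k; near=> N.
rewrite sqr_sqrtr ?divr_ge0 //; near: N.
exact: (cvgr_le _ (hcard k)).
Unshelve. all: end_near.
Qed.

End BlockAsymptotics.

Section ColorVariance.
Variables (R : realType) (s q : nat).
Local Notation S := s.+1.
Local Notation Q := q.+1.
Local Notation Om := (eigenbasis R s q).

Lemma qform_1tens (M : 'M[R]_Q) (x : 'cV[R]_(S * Q)) :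
  qform ((1%:M : 'M[R]_S) *t M) x =
  \sum_k \sum_c \sum_e x (mxtens_index (k, c)) 0 * (M c e * x (mxtens_index (k, e)) 0).
Proof.
rewrite /qform -mulmxA mxE sum_mxtens; apply: eq_bigr => k _; apply: eq_bigr => c _.
rewrite [_^T _ _]mxE mxE sum_mxtens mulr_sumr (bigD1 k) //= [X in _ + X]big1 ?addr0.
  rewrite mulr_sumr; apply: eq_bigr => e _.
  by rewrite tensmxE [_%:M _ _]mxE eqxx mul1r.
move=> l ne; rewrite big1 ?mulr0 // => e _.
by rewrite tensmxE [_%:M _ _]mxE eq_sym (negbTE ne) !mul0r.
Qed.

(** Both sides are the variance of the limiting linear functional: the left as summed over colors
    and blocks, the right as the quadratic form of the color covariance in the eigenbasis. *)
Lemma centered_sqE (t : 'cV[R]_(S * Q)) :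
  Q%:R^-1 * centered_sq t =
  \sum_i color_var R (mxtens_unindex i).2 * (Om *m t) i 0 ^+ 2.
Proof.
have := spec_qform (eigenbasis_tr R s q) (fun i => - color_var R (mxtens_unindex i).2) t.
rewrite -color_tens_spec qform_1tens => h.
transitivity (- \sum_i - color_var R (mxtens_unindex i).2 * (Om *m t) i 0 ^+ 2); last first.
  by rewrite -sumrN; apply: eq_bigr => i _; rewrite mulNr opprK.
rewrite -h -sumrN /centered_sq mulr_sumr; apply: eq_bigr => k _.
set x := fun c => t (mxtens_index (k, c)) 0.
have -> : \sum_c \sum_e x c * (color_mx R Q c e * x e) =
    (Q%:R ^+ 2)^-1 * (\sum_c x c) ^+ 2 - Q%:R^-1 * \sum_c x c ^+ 2.
  rewrite -[(\sum_c x c) ^+ 2]/((\sum_c x c) * (\sum_c x c)) mulr_suml !mulr_sumr -sumrB.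
  apply: eq_bigr => c _.
  rewrite mulr_sumr mulr_sumr (bigD1 c) //= [in RHS](bigD1 c) //= addrAC; congr (_ + _).
    by rewrite !mxE eqxx mulr1n; ring.
  apply: eq_bigr => e; rewrite eq_sym => /negbTE ce.
  by rewrite !mxE ce mulr0n; ring.
have xE c : centered t k c = x c - Q%:R^-1 * \sum_c x c by [].
under eq_bigr do rewrite xE.
rewrite (eq_bigr (fun c => x c ^+ 2 - 2 * (Q%:R^-1 * \sum_c x c) * x c +
  Q%:R^-1 * (Q%:R^-1 * (\sum_c x c) ^+ 2))); last first.
  by move=> c _; ring.
rewrite big_split sumrB -mulr_sumr sumr_const card_ord /= -mulr_natl.
by field.
Qed.

End ColorVariance.

(** * From the uniform measure to the Gibbs measures *)

Section GibbsLimit.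
Variables (R : realType) (s q : nat) (alpha beta : R).
Local Notation Ss := s.+1.
Local Notation Q := q.+1.
Local Notation Om := (eigenbasis R s q).
Local Notation A := (interaction Ss alpha beta).
Hypotheses (halpha : 0 < alpha) (hbeta : alpha < beta) (q2 : (2 <= Q)%N).
Variable S : forall N : nat, 'I_Ss -> {set 'I_N}.
Hypothesis hS : forall N : nat, (Ss <= N)%N -> is_block_partition (S N).
Hypothesis hcard : forall k, (#|S N k|%:R / N%:R : R) @[N --> \oo] --> (Ss%:R^-1 : R).
(** The rate [b] dominates the energies at all large finite N, where the spectral bound holds only
    approximately; [eta] is an available exponential moment. The gap between them absorbs the
    approximation errors. *)
Variables b eta : R.
Hypotheses (topb : top_eig s alpha beta < b) (beta' : b < eta) (etaz : eta < zeta R Q).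
Context d (T : measurableType d) (P : probability T R) (X : 'I_(Ss * Q) -> {RV P >-> R}).
Hypotheses (Xe : tilted_exp_integrals X) (Xc : tilted_cos_integrals X).

Local Notation V := (fun N (w : config Q N) => fluctuation R (S N) w).
Local Notation cv := (fun i : 'I_(Ss * Q) => color_var R (mxtens_unindex i).2).
Local Notation lv := (@lim_var R s q alpha beta).
Local Notation EN N := (@energy R Ss Q (coupling alpha beta (block_ratio R (S N)))).
Local Notation Einf := (@energy R Ss Q (limit_coupling alpha beta)).
Local Notation Z := (gauss_image Om X cv).
Local Notation OT := (eigenbasis_tr R s q).
Local Notation OO := (eigenbasis_mul R s q).

Let b_gt0 : 0 < b. Proof. exact: lt_trans (top_eig_gt0 s halpha hbeta) topb. Qed.
Let eta_gt0 : 0 < eta. Proof. exact: lt_trans beta'. Qed.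
Let eta_ltQ : eta < Q%:R. Proof. exact: lt_le_trans etaz (zeta_le R q2). Qed.

Let tilt1 : forall i, @tilt R s q alpha beta i < 1.
Proof. by apply: tilt_lt1 => //; exact: (lt_trans topb (lt_trans beta' eta_ltQ)). Qed.

Let cv_ge0 i : 0 <= cv i.
Proof. by rewrite mulr_ge0 ?invr_ge0. Qed.

Let lv_ge0 i : 0 <= lv i.
Proof. by rewrite divr_ge0 ?cv_ge0 // subr_ge0 ltW. Qed.

Let cv_le i : cv i <= Q%:R^-1.
Proof. by rewrite /color_var ler_piMr ?invr_ge0 //; case: (_ != _). Qed.

Lemma fluctuation_cos_cvg (t : 'cV[R]_(Ss * Q)) c :
  unif_mean (fun w => cos (\sum_j t j 0 * V N w j 0 + c)) @[N --> \oo] -->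
  cos c * expR (- (\sum_i cv i * (Om *m t) i 0 ^+ 2 / 2)).
Proof.
rewrite -mulr_suml -centered_sqE.
pose B := \sum_k \sum_c `|centered t k c|.
apply: (cvg_le_dist (e := fun N => B ^+ 3 * \sum_k (Num.sqrt #|S N k|%:R)^-1)); last first.
  have := cvgM (cvg_cst (B ^+ 3)) (sum_inv_sqrt_card_cvg hcard).
  by rewrite mulr0; exact.
near=> N; apply: fluctuation_cos => //.
- by apply: hS; near: N; exact: nbhs_infty_ge.
- move=> k c'; rewrite /B (bigD1 k) //= (bigD1 c') //= -addrA lerDl addr_ge0 // sumr_ge0 // => *.
  by rewrite sumr_ge0.
near: N; apply: filter_forall => k.
by have /cvgryPge /(_ B) := @sqrt_card_cvg R s S hcard k; exact.
Unshelve. all: end_near.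
Qed.

Let C1 : R := (Num.sqrt (1 - eta / zeta R Q))^-1 ^+ (Ss * Q).
Let C2 : R := \prod_(i < Ss * Q) (Num.sqrt (1 - 2 * (eta / 2) * cv i))^-1.
Let C := Num.max C1 C2.

Lemma unif_exp_sqnorm : \forall N \near \oo,
  unif_mean (fun w => expR (eta / 2 * sqnorm (V N w))) <= C.
Proof.
near=> N; apply: (@le_trans _ _ C1); last by rewrite /C le_max lexx.
apply: subgaussian_sqnorm etaz _ _; rewrite ?(ltW eta_gt0) //.
  by move=> _; exact: unif_weight_ge0.
move=> t; apply: fluctuation_mgf => //.
by apply: hS; near: N; exact: nbhs_infty_ge.
Unshelve. all: end_near.
Qed.

Lemma unif_expectation_like : \forall N \near \oo,
  expectation_like (eta / 2) C (fun f => unif_mean (fun w => f (V N w))).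
Proof.
near=> N; apply: (@finite_expectation_like R _ _ (fun=> unif_weight R Q N) (V N)).
  by move=> _; exact: unif_weight_ge0.
by near: N; exact: unif_exp_sqnorm.
Unshelve. all: end_near.
Qed.

Lemma limit_expectation_like :
  expectation_like (eta / 2) C (fun f => \int[P]_(w in setT) f (Z w)).
Proof.
apply: integral_expectation_like; first exact: measurable_gauss_image.
rewrite (gauss_image_exp_sqnorm OT OO Xe cv_ge0); first by rewrite lee_fin le_max lexx orbT.
move=> i; rewrite [2 * (eta / 2)]mulrC divfK //.
apply: (@le_lt_trans _ _ (eta / Q%:R)); first by rewrite ler_wpM2l ?(ltW eta_gt0).
by rewrite ltr_pdivrMr // mul1r.
Qed.

Lemma unif_growth_cvg k f : 0 <= k < eta / 2 -> growth k f ->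
  unif_mean (fun w => f (V N w)) @[N --> \oo] --> (\int[P]_(w in setT) f (Z w)).
Proof.
move=> kk; apply: expectation_like_cvg unif_expectation_like limit_expectation_like _ kk.
move=> t c; pose t' : 'cV[R]_(Ss * Q) := \col_i t i.
have tE x : \sum_i t i * x i 0 = \sum_j t' j 0 * x j 0.
  by apply: eq_bigr => j _; rewrite [t' j 0]mxE.
have -> : (fun N => unif_mean (fun w => cos (\sum_i t i * V N w i 0 + c))) =
    (fun N => unif_mean (fun w => cos (\sum_j t' j 0 * V N w j 0 + c))).
  by apply/funext => N; congr unif_mean; apply/funext => w; rewrite tE.
have -> : \int[P]_w cos (\sum_i t i * Z w i 0 + c) =
    cos c * expR (- (\sum_i cv i * (Om *m t') i 0 ^+ 2 / 2)).
  rewrite /Rintegral; under eq_integral do rewrite tE.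
  by rewrite (gauss_image_cos OT Xc cv_ge0).
exact: fluctuation_cos_cvg.
Qed.

Let alpha_ge0 : 0 <= alpha. Proof. exact: ltW. Qed.
Let alpha_le_beta : alpha <= beta. Proof. exact: ltW. Qed.

Lemma limit_energy_gauss w : Einf (Z w) = \sum_i tilt alpha beta i * X i w ^+ 2 / 2.
Proof.
have -> : Einf (Z w) = qform (calA Q A) (Z w) / Ss%:R / 2.
  rewrite /calA qform_tens1 /energy; congr (_ / 2); rewrite mulr_suml; apply: eq_bigr => k _.
  rewrite mulr_suml; apply: eq_bigr => l _.
  by rewrite /limit_coupling /coupling -expr2 sqr_sqrtr ?invr_ge0 // mulrAC.
rewrite calA_spec (spec_qform OT) mulr_suml mulr_suml; apply: eq_bigr => i _.
rewrite (gauss_imageK OO) mxE exprMn sqr_sqrtr // /tilt; ring.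
Qed.

Lemma limit_energy_le x : Einf x <= b / 2 * sqnorm x.
Proof.
apply: (@le_trans _ _ (((beta - alpha) * Ss%:R^-1 + alpha) / 2 * sqnorm x)).
  apply: energy_le => // [|k]; last by rewrite sqr_sqrtr ?invr_ge0.
  under eq_bigr do rewrite sqr_sqrtr ?invr_ge0 //.
  by rewrite sumr_const card_ord -[_ *+ _]mulr_natl mulfV.
by rewrite ler_wpM2r ?sqnorm_ge0 // ler_pM2r ?invr_gt0 //; exact: ltW topb.
Qed.

Lemma energy_near : \forall N \near \oo, forall x, EN N x <= b / 2 * sqnorm x.
Proof.
(* Solves (beta - alpha) r + alpha = b, so that [topb] says exactly that r exceeds 1 / s. *)
pose r := (b - alpha) / (beta - alpha).
have ba0 : 0 < beta - alpha by rewrite subr_gt0.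
have sr : Ss%:R^-1 < r.
  by rewrite /r ltr_pdivlMr // ltrBrDr mulrC; exact: topb.
near=> N => x.
have -> : b = (beta - alpha) * r + alpha by rewrite /r mulrC divfK ?gt_eqF // subrK.
apply: energy_le => //.
  rewrite block_ratio_sum //; last by near: N; exact: nbhs_infty_gt.
  by apply: hS; near: N; exact: nbhs_infty_ge.
by near: N; exact: block_ratio_near.
Unshelve. all: end_near.
Qed.

Let W_cos (t : 'cV[R]_(Ss * Q)) c : R := cos c * expR (- (\sum_i lv i * (Om *m t) i 0 ^+ 2 / 2)).
Let K : R := \prod_i (Num.sqrt (1 - @tilt R s q alpha beta i))^-1.

Let K_gt0 : 0 < K.
Proof. by apply: prodr_gt0 => i _; rewrite invr_gt0 sqrtr_gt0 subr_gt0. Qed.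

Let bk : 0 <= b / 2 < eta / 2.
Proof. by rewrite divr_ge0 ?(ltW b_gt0) //= ltr_pM2r ?invr_gt0. Qed.

(** With the limiting energy the integrand is one fixed function of growth rate b / 2 < eta / 2, so
    the convergence under the uniform measure applies directly. *)
Lemma tilted_limit_cvg (t : 'cV[R]_(Ss * Q)) c :
  unif_mean (fun w => cos (\sum_j t j 0 * V N w j 0 + c) * expR (Einf (V N w))) @[N --> \oo] -->
  K * W_cos t c.
Proof.
pose f (x : 'cV[R]_(Ss * Q)) := cos (\sum_j t j 0 * x j 0 + c) * expR (Einf x).
have gf : growth (b / 2) f.
  split.
    apply: continuous_mul.
      exact: (trigpoly_continuous (Trig_cos (fun j => t j 0) c)).
    apply: (continuous_comp_real (@continuous_expR R)); exact: energy_continuous.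
  exists 1 => x; rewrite normrM mul1r (ger0_norm (expR_ge0 _)).
  apply: (@le_trans _ _ (expR (Einf x))); last by rewrite ler_expR limit_energy_le.
  by rewrite ler_piMl ?expR_ge0 // cos_max.
have := unif_growth_cvg bk gf; rewrite /f /Rintegral.
under eq_integral do rewrite limit_energy_gauss.
by rewrite (gauss_image_tilted_cos OT Xc cv_ge0).
Qed.

(** Exchanging the limiting energy for the one at N costs at most delta_N |x|^2 exp (b |x|^2 / 2).
    The factor |x|^2 is absorbed by exp ((eta - b) |x|^2 / 2), whose product with the rest has
    bounded mean. *)
Lemma tilted_cvg (t : 'cV[R]_(Ss * Q)) c :
  unif_mean (fun w => cos (\sum_j t j 0 * V N w j 0 + c) * expR (EN N (V N w))) @[N --> \oo] -->
  K * W_cos t c.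
Proof.
pose delta N : R := (\sum_k \sum_l
  `|coupling alpha beta (block_ratio R (S N)) k l - limit_coupling alpha beta k l|) / 2.
have d0 : delta N @[N --> \oo] --> (0 : R) by exact: coupling_cvg.
pose g (E : nat -> 'cV[R]_(Ss * Q) -> R) N (w : config Q N) :=
  cos (\sum_j t j 0 * V N w j 0 + c) * expR (E N (V N w)).
rewrite -[K * _]addr0 -/(g (fun N => EN N)).
have -> : (fun N => unif_mean (g (fun N => EN N) N)) = (fun N => unif_mean (g (fun=> Einf) N) +
    (unif_mean (g (fun N => EN N) N) - unif_mean (g (fun=> Einf) N))).
  by apply/funext => N; rewrite addrC subrK.
apply: cvgD; first exact: tilted_limit_cvg.
have e0 : 0 < (eta - b) / 2 by rewrite divr_gt0 // subr_gt0.
apply: (cvg_le_dist (e := fun N => delta N * (((eta - b) / 2)^-1 * C))); last first.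
  have := cvgM d0 (cvg_cst (((eta - b) / 2)^-1 * C)).
  by rewrite mul0r; exact.
near=> N; rewrite subr0 -unif_meanB.
have delta0 : 0 <= delta N.
  by rewrite divr_ge0 // sumr_ge0 // => k _; rewrite sumr_ge0.
have EN_le : forall x, EN N x <= b / 2 * sqnorm x by near: N; exact: energy_near.
have CN : unif_mean (fun w => expR (eta / 2 * sqnorm (V N w))) <= C.
  by near: N; exact: unif_exp_sqnorm.
apply: (@le_trans _ _ (delta N * (((eta - b) / 2)^-1 *
   unif_mean (fun w => expR (eta / 2 * sqnorm (V N w)))))); last first.
  by rewrite !ler_wpM2l // invr_ge0 ltW.
rewrite -!unif_meanM; apply: (le_trans (ler_norm_sum _ _ _)); apply: ler_sum => w _.
rewrite normrM (ger0_norm (unif_weight_ge0 _ _ _)) ler_wpM2l ?unif_weight_ge0 //.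
rewrite /g -mulrBr normrM; set x := V N w.
apply: (@le_trans _ _ (`|expR (EN N x) - expR (Einf x)|)); first by rewrite ler_piMl // cos_max.
apply: (le_trans (expR_lip (EN_le x) (limit_energy_le x))).
apply: (@le_trans _ _ (delta N * sqnorm x * expR (b / 2 * sqnorm x))).
  by rewrite ler_wpM2r ?expR_ge0 // energy_diff.
rewrite -mulrA ler_wpM2l // ler_pdivlMl //.
have -> : eta / 2 * sqnorm x = (eta - b) / 2 * sqnorm x + b / 2 * sqnorm x by ring.
rewrite expRD mulrA ler_wpM2r ?expR_ge0 //.
by apply: le_trans (expR_ge1Dx _); rewrite lerDr.
Unshelve. all: end_near.
Qed.

(** Quotient of two tilted limits; the denominator is the case t = 0, c = 0, whose limit is the mass
    [K], and it cancels. *)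
Lemma gibbs_cos_cvg (t : 'cV[R]_(Ss * Q)) c :
  gibbs_mean A (S N) (fun w : config Q N => cos (\sum_j t j 0 * V N w j 0 + c)) @[N --> \oo] -->
  W_cos t c.
Proof.
have h := @tilted_cvg t c; have h0 := @tilted_cvg 0 0.
have W0 : W_cos 0 0 = 1.
  rewrite /W_cos cos0 mulmx0 big1 ?oppr0 ?expR0 ?mulr1 // => i _.
  by rewrite mxE expr0n mulr0 mul0r.
rewrite W0 mulr1 in h0.
have KE : K * W_cos t c / K = W_cos t c by rewrite mulrAC mulfV ?gt_eqF // mul1r.
have hh := cvgM h (cvgV (lt0r_neq0 K_gt0) h0); rewrite KE in hh.
apply: (cvg_trans _ (hh _ _)).
apply: near_eq_cvg; near=> N; rewrite gibbs_meanE //; last first.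
  by apply: hS; near: N; exact: nbhs_infty_ge.
congr (_ / _); congr unif_mean; apply/funext => w.
rewrite big1 ?addr0 ?cos0 ?mul1r // => i _.
by rewrite mxE mul0r.
Unshelve. all: end_near.
Qed.

Lemma gibbs_ge0 N (w : config Q N) : 0 <= gibbs A (S N) w.
Proof. by rewrite divr_ge0 ?expR_ge0 // sumr_ge0 // => w' _; rewrite expR_ge0. Qed.

(** The energy is nonnegative, so the normalizing denominator is at least 1, and the numerator fits
    under the moment [eta]. *)
Lemma gibbs_exp_sqnorm k : k + b / 2 <= eta / 2 -> \forall N \near \oo,
  gibbs_mean A (S N) (fun w : config Q N => expR (k * sqnorm (V N w))) <= C.
Proof.
move=> kb; near=> N; rewrite gibbs_meanE //; last first.
  by apply: hS; near: N; exact: nbhs_infty_ge.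
have EN_le : forall x, EN N x <= b / 2 * sqnorm x by near: N; exact: energy_near.
have CN : unif_mean (fun w => expR (eta / 2 * sqnorm (V N w))) <= C.
  by near: N; exact: unif_exp_sqnorm.
set D := unif_mean (fun w => expR (EN N _)).
have D1 : 1 <= D.
  rewrite -(@unif_mean_cst R Q N _ 1) //; apply: unif_mean_le => w.
  by rewrite expR_ge1 // energy_ge0.
have C0 : 0 <= C.
  apply: le_trans CN; rewrite -(@unif_mean_cst R Q N _ 0) //.
  by apply: unif_mean_le => w; exact: expR_ge0.
rewrite ler_pdivrMr ?(lt_le_trans ltr01) //.
apply: (@le_trans _ _ C); last by rewrite ler_peMr.
apply: le_trans CN; apply: unif_mean_le => w; rewrite -expRD ler_expR.
apply: (@le_trans _ _ ((k + b / 2) * sqnorm (V N w))).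
  by rewrite mulrDl lerD2l EN_le.
by rewrite ler_wpM2r ?sqnorm_ge0.
Unshelve. all: end_near.
Qed.

Lemma gibbs_cvg_gaussian (W : 'I_(Ss * Q) -> {RV P >-> R}) :
  random_vector W = gauss_image Om X lv ->
  gibbs_cvg_in_law A S (fun N => @fluctuation R Ss Q N (S N)) W.
Proof.
move=> WE f cf [M fM]; rewrite WE.
pose L := 1 + \sum_i lv i.
have L1 : 1 <= L by rewrite lerDl sumr_ge0.
(* The first term leaves room for the Gibbs moments, the second makes 2 k times any limit variance
   at most 1 / 2, so the limit has the same moment; [L] is at least 1 and above every variance. *)
pose k := Num.min ((eta - b) / 2) (4 * L)^-1.
have L0 : 0 < L by apply: lt_le_trans L1.
have k0 : 0 < k by rewrite lt_min divr_gt0 ?subr_gt0 // invr_gt0 mulr_gt0.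
have kb : k + b / 2 <= eta / 2.
  have : k <= (eta - b) / 2 by rewrite ge_min lexx.
  by rewrite mulrBl; lra.
have klv i : 2 * k * lv i < 1.
  have kL : k <= (4 * L)^-1 by rewrite ge_min lexx orbT.
  have lvL : lv i <= L.
    rewrite /L (bigD1 i) //= addrCA lerDl addr_ge0 // sumr_ge0 //.
  apply: (@le_lt_trans _ _ (2 * (4 * L)^-1 * L)).
    by apply: ler_pM => //; rewrite ?mulr_ge0 ?(ltW k0) // ler_pM2l.
  by rewrite invfM mulrA divfK ?gt_eqF // ltr_pdivrMr // mul1r (ltr_nat R 2 4).
pose C3 : R := \prod_i (Num.sqrt (1 - 2 * k * lv i))^-1.
pose C4 := Num.max C C3.
have mW := measurable_gauss_image Om X lv.
have eW : (\int[P]_w (expR (k * sqnorm (gauss_image Om X lv w)))%:E <= C4%:E)%E.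
  by rewrite (gauss_image_exp_sqnorm OT OO Xe lv_ge0 klv) lee_fin le_max lexx orbT.
have gf : growth 0 f by split=> //; exists M => x; rewrite mul0r expR0 mulr1.
have gkf : growth k f by apply: growthW gf; exact: ltW.
have -> : ('E_P[f \o gauss_image Om X lv])%E =
    (\int[P]_(w in setT) f (gauss_image Om X lv w))%:E.
  rewrite unlock /Rintegral fineK //.
  by have := growth_integrable mW eW gkf; exact: integrable_fin_num.
apply: cvg_EFin; first by near=> N.
apply: (@expectation_like_cvg R _ k C4
  (fun N f => gibbs_mean A (S N) (fun w : config Q N => f (V N w)))
  (fun f => \int[P]_(w in setT) f (gauss_image Om X lv w)) 0 f) => //.
- near=> N; apply: (@finite_expectation_like R _ _ (fun w => gibbs A (S N) w) (V N)).
    by move=> w; exact: gibbs_ge0.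
  apply: (@le_trans _ _ C); last by rewrite le_max lexx.
  by near: N; exact: gibbs_exp_sqnorm.
- exact: integral_expectation_like.
- move=> t c; pose t' : 'cV[R]_(Ss * Q) := \col_i t i.
  have tE x : \sum_i t i * x i 0 = \sum_j t' j 0 * x j 0.
    by apply: eq_bigr => j _; rewrite [t' j 0]mxE.
  have -> : (fun N => gibbs_mean A (S N) (fun w : config Q N => cos (\sum_i t i * V N w i 0 + c))) =
      (fun N => gibbs_mean A (S N) (fun w : config Q N => cos (\sum_j t' j 0 * V N w j 0 + c))).
    by apply/funext => N; congr gibbs_mean; apply/funext => w; rewrite tE.
  have -> : \int[P]_w cos (\sum_i t i * gauss_image Om X lv w i 0 + c) = W_cos t' c.
    rewrite /Rintegral; under eq_integral do rewrite tE.
    by rewrite (gauss_image_cos OT Xc lv_ge0).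
  exact: gibbs_cos_cvg.
- by rewrite lexx.
Unshelve. all: end_near.
Qed.

End GibbsLimit.

Theorem theorem1 (R : realType) (s q : nat) (hs : (1 <= s)%N) (hq : (2 <= q)%N)
    (S : forall N : nat, 'I_s -> {set 'I_N})
    (hS : forall N : nat, (s <= N)%N -> is_block_partition (S N))
    (gamma : 'rV[R]_s)
    (hgamma : forall k : 'I_s,
       (#|S N k|%:R / N%:R : R) @[N --> \oo] --> gamma 0 k)
    (alpha beta : R) (halpha : 0 < alpha) (hbeta : alpha < beta)
    (hequal : Gamma q gamma = s%:R^-1 *: 1%:M)
    (htemp : spectral_norm
        (sqrt_diag (Gamma q gamma) *m calA q (interaction s alpha beta)
           *m sqrt_diag (Gamma q gamma)) < zeta R q) :
  \det (limit_cov q (interaction s alpha beta)) = 0 /\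
  exists (d : measure_display) (T : measurableType d) (P : probability T R)
    (W : 'I_(s * q) -> {RV P >-> R}),
    is_centered_gaussian W (limit_cov q (interaction s alpha beta)) /\
    gibbs_cvg_in_law (interaction s alpha beta) S
      (fun N => @fluctuation R s q N (S N)) W.
Proof.
(* Successor sizes supply the index 0, the all-ones direction of each tensor factor. *)
case: s => [//|s] in hs S hS gamma hgamma hequal htemp *.
case: q => [//|q] in hq hequal htemp *.
have top_lt : top_eig s alpha beta < zeta R q.+1.
  by apply: le_lt_trans htemp; exact: top_eig_le_spectral_norm.
have tilt1 := tilt_lt1 halpha hbeta (lt_le_trans top_lt (zeta_le R hq)).
have hcard k : (#|S N k|%:R / N%:R : R) @[N --> \oo] --> (s.+1%:R^-1 : R).
  suff <- : gamma 0 k = s.+1%:R^-1 by exact: hgamma.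
  have /matrixP /(_ (mxtens_index (k, 0)) (mxtens_index (k, 0))) := hequal.
  by rewrite tensmxE !mxE !eqxx !mulr1n !mulr1.
split; first exact: limit_cov_det.
have [d [T [P [X [Xe Xc]]]]] := gaussian_space R (s.+1 * q.+1).
have lv0 i : 0 <= @lim_var R s q alpha beta i.
  by rewrite divr_ge0 ?subr_ge0 ?(ltW (tilt1 _)) // mulr_ge0 ?invr_ge0.
have [W WE] := gauss_image_RV (eigenbasis R s q) X (@lim_var R s q alpha beta).
exists d, T, P, W; split.
  rewrite limit_cov_spec //.
  exact: (gauss_image_gaussian (eigenbasis_tr R s q) Xe Xc lv0 WE).
(* Thirds of the gap place [b] and [eta] strictly between the top eigenvalue and zeta. *)
pose gap := zeta R q.+1 - top_eig s alpha beta.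
apply: (@gibbs_cvg_gaussian R s q alpha beta halpha hbeta hq S hS hcard
  (top_eig s alpha beta + gap / 3) (top_eig s alpha beta + 2 * gap / 3)) Xe Xc W WE.
- by rewrite ltrDl divr_gt0 // subr_gt0.
- by rewrite ltrD2l ltr_pM2r ?invr_gt0 // ltr_pMl ?subr_gt0 // ltr1n.
- by rewrite /gap; lra.
Qed.
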